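(* Let $\omega:\mathbb{R}_{\geq 0}\to\mathbb{R}^3$ be continuous and bounded, let $g=[g_1,g_2,g_3]^\top\in\mathbb{R}^3$ be a constant vector, and let $\hat R:\mathbb{R}_{\geq0}\to SO(3)$ be a continuous signal. Let $N\in\mathbb{N}_{>0}$ and let $C:\mathbb{R}_{\geq0}\to\mathbb{R}^{3N\times 15}$ be continuous and bounded. Define $$A(t)=\begin{bmatrix} -\omega^\times & 0_3 & 0_3 & 0_3 & I_3\\ 0_3 & -\omega^\times & 0_3 & 0_3 & 0_3\\ 0_3&0_3&-\omega^\times&0_3&0_3\\ 0_3&0_3&0_3&-\omega^\times&0_3\\ 0_3& g_1I_3& g_2 I_3& g_3 I_3& -\omega^\times\end{bmatrix}\in\mathbb{R}^{15\times15},$$ and suppose the pair $(A(t),C(t))$ is uniformly observable. Pick $k_R>0$ and three distinct scalars $\rho_1,\rho_2,\rho_3>0$, and set $M=\mathrm{diag}(\rho_1,\rho_2,\rho_3)$ and $$\Gamma(t)=\tfrac{k_R}{2}\,[\,0_3,\ \rho_1 e_1^\times\hat R(t),\ \rho_2 e_2^\times \hat R(t),\ \rho_3 e_3^\times\hat R(t),\ 0_3\,]\in\mathbb{R}^{3\times 15}.$$ Let $Q:\mathbb{R}_{\geq0}\to\mathbb{R}^{3N\times 3N}$ and $V:\mathbb{R}_{\geq0}\to\mathbb{R}^{15\times15}$ be continuous, bounded and uniformly positive definite, let $P$ be the solution of the continuous Riccati equation $\dot P=A(t)P+PA(t)^\top-PC(t)^\top Q(t)C(t)P+V(t)$ with $P(0)$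 symmetric positive definite, and let $K(t)=P(t)C(t)^\top Q(t)$. Consider the closed-loop system on $SO(3)\times\mathbb{R}^{15}$ $$\dot{\tilde R}=\tilde R\big(-k_R\psi_a(M\tilde R)-\Gamma(t)\tilde x\big)^\times,\qquad \dot{\tilde x}=A(t)\tilde x-K(t)\sigma_y,\qquad \sigma_y=C(t)\tilde x.$$ Then: (i) all solutions converge to the set $\{(I_3,0_{15\times1})\}\cup\Psi_M$, where $\Psi_M:=\{(\tilde R,\tilde x)\in SO(3)\times\mathbb{R}^{15}:\ \tilde R=\mathcal{R}_\alpha(\pi,v),\ v\in\mathcal{E}(M),\ \tilde x=0_{15\times1}\}$; (ii) the equilibrium $(I_3,0_{15\times1})$ is locally exponentially stable; (iii) all equilibria in $\Psi_M$ are unstable, and $(I_3,0_{15\times1})$ is almost globally asymptotically stable.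
   Context: For $x\in\mathbb{R}^3$, $x^\times$ is the skew-symmetric matrix with $x^\times y=x\times y$; $\mathrm{vec}$ is its inverse. For $A\in\mathbb{R}^{3\times3}$, $\psi_a(A)=\mathrm{vec}\big((A-A^\top)/2\big)$. $e_i$ denotes the $i$-th standard basis vector of $\mathbb{R}^3$. $\mathcal{E}(M)$ is the set of unit eigenvectors of $M$, and $\mathcal{R}_\alpha(\pi,v)$ is the rotation by angle $\pi$ about the unit axis $v$. A pair $(A(t),C(t))$ of continuous bounded matrix functions is uniformly observable if there exist $\delta,\mu>0$ such that $\frac1\delta\int_t^{t+\delta}\Phi(\tau,t)^\top C(\tau)^\top C(\tau)\Phi(\tau,t)\,d\tau\geq\mu I$ for all $t\geq0$, where $\Phi$ is the state transition matrix of $A(t)$. Almost global asymptotic stability means the equilibrium is stable and attracts all solutions starting outside a set of Lebesgue measure zero. *)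

(* Defs.v *)
From HB Require Import structures.
From mathcomp Require Import all_boot all_order all_algebra.
From mathcomp Require Import all_classical all_reals all_analysis.
Set Implicit Arguments. Unset Strict Implicit. Unset Printing Implicit Defensive.
Import Order.TTheory GRing.Theory Num.Theory.
Import numFieldNormedType.Exports.
Local Open Scope classical_set_scope.
Local Open Scope ring_scope.

Section Defs.
Variable R : realType.

(* x^x : the skew-symmetric matrix with (skew x) *m y = x cross y *)
Definition skew (x : 'cV[R]_3) : 'M[R]_3 :=
  let x1 := x (inord 0) 0 in let x2 := x (inord 1) 0 in let x3 := x (inord 2) 0 in
  \matrix_(i < 3, j < 3)
    match nat_of_ord i, nat_of_ord j with
    | 0, 1 => - x3 | 0, 2 => x2
    | 1, 0 => x3   | 1, 2 => - x1
    | 2, 0 => - x2 | 2, 1 => x1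
    | _, _ => 0
    end.

(* vec : inverse of skew on skew-symmetric matrices *)
Definition vex (S : 'M[R]_3) : 'cV[R]_3 :=
  \col_(i < 3) match nat_of_ord i with
               | 0 => S (inord 2) (inord 1)
               | 1 => S (inord 0) (inord 2)
               | _ => S (inord 1) (inord 0)
               end.

Definition psi_a (A : 'M[R]_3) : 'cV[R]_3 := vex (2^-1 *: (A - A^T)).

Definition ebasis (i : 'I_3) : 'cV[R]_3 := delta_mx i 0.

Definition is_SO3 (Rm : 'M[R]_3) : Prop := Rm^T *m Rm = 1%:M /\ \det Rm = 1.

Definition blk5x5 (B : 'I_5 -> 'I_5 -> 'M[R]_3) : 'M[R]_15 :=
  \matrix_(i < 15, j < 15)
     B (inord (i %/ 3)) (inord (j %/ 3)) (inord (i %% 3)) (inord (j %% 3)).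

Definition blk1x5 (B : 'I_5 -> 'M[R]_3) : 'M[R]_(3, 15) :=
  \matrix_(i < 3, j < 15) B (inord (j %/ 3)) i (inord (j %% 3)).

Definition Amat (w : 'cV[R]_3) (g : 'cV[R]_3) : 'M[R]_15 :=
  blk5x5 (fun I J =>
    match nat_of_ord I, nat_of_ord J with
    | 0, 0 | 1, 1 | 2, 2 | 3, 3 | 4, 4 => - skew w
    | 0, 4 => 1%:M
    | 4, 1 => (g (inord 0) 0)%:M
    | 4, 2 => (g (inord 1) 0)%:M
    | 4, 3 => (g (inord 2) 0)%:M
    | _, _ => 0
    end).

Definition Gammat (kR rho1 rho2 rho3 : R) (Rh : 'M[R]_3) : 'M[R]_(3, 15) :=
  (kR / 2) *: blk1x5 (fun I =>
    match nat_of_ord I with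
    | 1 => rho1 *: (skew (ebasis (inord 0)) *m Rh)
    | 2 => rho2 *: (skew (ebasis (inord 1)) *m Rh)
    | 3 => rho3 *: (skew (ebasis (inord 2)) *m Rh)
    | _ => 0
    end).

(* rotation by angle th about the unit axis v (Rodrigues formula) *)
Definition rot_axis (th : R) (v : 'cV[R]_3) : 'M[R]_3 :=
  1%:M + sin th *: skew v + (1 - cos th) *: (skew v *m skew v).

Definition unit_eigvec (M : 'M[R]_3) (v : 'cV[R]_3) : Prop :=
  (v^T *m v) 0 0 = 1 /\ exists lam : R, M *m v = lam *: v.

Definition qform n (S : 'M[R]_n) (v : 'cV[R]_n) : R := (v^T *m S *m v) 0 0.

Definition bounded_on_nonneg (V : normedModType R) (f : R -> V) : Prop :=
  exists B : R, forall t : R, 0 <= t -> `|f t| <= B.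

Definition unif_pos_def n (S : R -> 'M[R]_n) : Prop :=
  exists c : R, 0 < c /\ forall t : R, 0 <= t ->
    (S t)^T = S t /\ forall v : 'cV[R]_n, c * qform 1%:M v <= qform (S t) v.

Definition sym_pos_def n (S : 'M[R]_n) : Prop :=
  S^T = S /\ forall v : 'cV[R]_n, v != 0 -> 0 < qform S v.

Definition transition_matrix n (A : R -> 'M[R]_n) (Phi : R -> R -> 'M[R]_n) : Prop :=
  forall t : R, 0 <= t ->
    Phi t t = 1%:M /\
    {within [set s | 0 <= s], continuous (fun s => Phi s t)} /\
    forall s : R, 0 < s -> is_derive s 1 (fun tau => Phi tau t) (A s *m Phi s t).

Definition mx_integral m n (F : R -> 'M[R]_(m, n)) (a b : R) : 'M[R]_(m, n) :=
  \matrix_(i < m, j < n)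
     Rintegral (@lebesgue_measure R) `[a, b] (fun tau => F tau i j).

Definition unif_observable n p (A : R -> 'M[R]_n) (C : R -> 'M[R]_(p, n)) : Prop :=
  forall Phi, transition_matrix A Phi ->
  exists delta mu : R, 0 < delta /\ 0 < mu /\
    forall t : R, 0 <= t -> forall v : 'cV[R]_n,
      mu * qform 1%:M v <=
      qform (delta^-1 *: mx_integral
              (fun tau => (Phi tau t)^T *m (C tau)^T *m C tau *m Phi tau t)
              t (t + delta)) v.

Definition null_set n (E : set 'cV[R]_n) : Prop :=
  forall eps : R, 0 < eps ->
    exists a b : nat -> 'cV[R]_n,
      (forall z, E z -> exists k, forall i, a k i 0 <= z i 0 <= b k i 0) /\
      (forall K, \sum_(k < K) \prod_(i < n) Num.max 0 (b k i 0 - a k i 0) <= eps).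

Definition quat_rot (q : 'cV[R]_4) : 'M[R]_3 :=
  let w := q (inord 0) 0 in let x := q (inord 1) 0 in
  let y := q (inord 2) 0 in let z := q (inord 3) 0 in
  let nq := w ^+ 2 + x ^+ 2 + y ^+ 2 + z ^+ 2 in
  nq^-1 *: \matrix_(i < 3, j < 3)
    match nat_of_ord i, nat_of_ord j with
    | 0, 0 => w ^+ 2 + x ^+ 2 - y ^+ 2 - z ^+ 2
    | 0, 1 => 2 * (x * y - w * z)
    | 0, 2 => 2 * (x * z + w * y)
    | 1, 0 => 2 * (x * y + w * z)
    | 1, 1 => w ^+ 2 - x ^+ 2 + y ^+ 2 - z ^+ 2
    | 1, 2 => 2 * (y * z - w * x)
    | 2, 0 => 2 * (x * z - w * y)
    | 2, 1 => 2 * (y * z + w * x)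
    | _, _ => w ^+ 2 - x ^+ 2 - y ^+ 2 + z ^+ 2
    end.

(* Lebesgue-null subsets of SO(3) x R^15 : null preimage under the smooth
   submersion (R^4 \ {0}) x R^15 -> SO(3) x R^15, (q, x) |-> (quat_rot q, x);
   points of R^19 are split as (first 4 coords, last 15 coords). *)
Definition null_set_SO3xR15 (S : set ('M[R]_3 * 'cV[R]_15)) : Prop :=
  null_set [set z : 'cV[R]_(4 + 15) |
             usubmx z != 0 /\ S (quat_rot (usubmx z), dsubmx z)].

Definition closed_loop_sol p (kR : R) (M : 'M[R]_3) (Gam : R -> 'M[R]_(3, 15))
  (A : R -> 'M[R]_15) (K : R -> 'M[R]_(15, p)) (C : R -> 'M[R]_(p, 15))
  (t0 : R) (Rs : R -> 'M[R]_3) (xs : R -> 'cV[R]_15) : Prop :=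
  0 <= t0 /\ is_SO3 (Rs t0) /\
  {within [set t | t0 <= t], continuous Rs} /\
  {within [set t | t0 <= t], continuous xs} /\
  forall t : R, t0 < t ->
    is_derive t 1 Rs (Rs t *m skew (- (kR *: psi_a (M *m Rs t)) - Gam t *m xs t)) /\
    is_derive t 1 xs (A t *m xs t - K t *m (C t *m xs t)).

Definition state := ('M[R]_3 * 'cV[R]_15)%type.

Definition sdist (s e : state) : R := `|s.1 - e.1| + `|s.2 - e.2|.

Definition solpred := R -> (R -> 'M[R]_3) -> (R -> 'cV[R]_15) -> Prop.

Definition stable (sol : solpred) (e : state) : Prop :=
  forall t0 eps : R, 0 <= t0 -> 0 < eps -> exists del, 0 < del /\
    forall Rs xs, sol t0 Rs xs -> sdist (Rs t0, xs t0) e < del ->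
      forall t : R, t0 <= t -> sdist (Rs t, xs t) e < eps.

Definition unstable (sol : solpred) (e : state) : Prop := ~ stable sol e.

Definition loc_exp_stable (sol : solpred) (e : state) : Prop :=
  exists r k lam : R, 0 < r /\ 0 < k /\ 0 < lam /\
    forall (t0 : R) Rs xs, sol t0 Rs xs -> sdist (Rs t0, xs t0) e < r ->
      forall t : R, t0 <= t ->
        sdist (Rs t, xs t) e <= k * expR (- (lam * (t - t0))) * sdist (Rs t0, xs t0) e.

Definition conv_to_set (S : set state) (Rs : R -> 'M[R]_3) (xs : R -> 'cV[R]_15) : Prop :=
  forall eps : R, 0 < eps -> exists T, forall t : R, T <= t ->
    exists e, S e /\ sdist (Rs t, xs t) e < eps.

Definition almost_GAS (sol : solpred) (e : state) : Prop :=
  stable sol e /\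
  forall t0 : R, 0 <= t0 -> exists Nset : set state, null_set_SO3xR15 Nset /\
    forall Rs xs, sol t0 Rs xs -> ~ Nset (Rs t0, xs t0) -> conv_to_set [set e] Rs xs.

Definition PsiM (M : 'M[R]_3) : set state :=
  [set s | exists v, unit_eigvec M v /\ s.1 = rot_axis pi v /\ s.2 = 0].

End Defs.

(* Main.v *)
(* Observability and uniform positivity of V give two-sided bounds on the Riccati solution P, so the
   estimation error x decays exponentially, independently of the rotation.  The rotation R is then a
   gradient system for U = tr(M(1 - R)) with an exponentially decaying input: U plus a multiple of the
   decay envelope is a Lyapunov function, so psi_a(MR) tends to 0.  Since (MR)^2 = M^2 when MR is
   symmetric, and M has distinct eigenvalues, R approaches the identity or one of the three diagonal
   half-turns; near the identity the same estimate makes the convergence exponential.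
   Each half-turn about e_k is left along the explicit solution that rotates about e_k.  Finally, two
   trajectories that both stay near the half-turn differ along its expanding direction by at most a
   multiple of their difference in the other coordinates (invariant cone), so after pulling back by the backward Lipschitz flow the
   set of exceptional initial states is a countable union of Lipschitz images of sets of one dimension
   less, hence null.  No stable manifold theorem is needed. *)
Require Import Defs.
From HB Require Import structures.
From mathcomp Require Import all_boot all_order all_algebra.
From mathcomp Require Import all_classical all_reals all_analysis.
From mathcomp Require Import ring lra.
Import Order.TTheory GRing.Theory Num.Theory.
Import numFieldNormedType.Exports.
Local Open Scope classical_set_scope.
Local Open Scope ring_scope.
Set Implicit Arguments.
Unset Strict Implicit.
Unset Printing Implicit Defensive.

Local Notation skew := Defs.skew.
Local Notation null_set := Defs.null_set.

(** * Calculus on half-lines *)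

Section Calculus.
Context {R : realType}.
Implicit Types (a b t : R) (f g : R -> R).

(** Solutions of the closed loop are given data: the exceptional set consists of the initial states
    of trajectories that fail to converge, and the null-set argument only ever compares two given
    trajectories. Existence has to be proved for linear equations: [unif_observable] quantifies over
    all transition matrices, so it yields nothing before one is built, and the bounds on [P] are
    read off adjoint solutions with a prescribed final value. At the half-turn about [e_k] the
    linearization is diagonal in the coordinates [psi_a (flip k *m F)]. The rate along [e_k] is
    always positive; the signs of the other two depend on the order of the [rho i], and distinctness
    only makes them nonzero. The cone treats all sign patterns at once and drops the single
    coordinate [k]. Null sets of the state space are defined through quaternions, so the norm of the
    quaternion is one more parameter, and the set is cut into pieces on which a rotation and this
    norm determine the quaternion. Estimates use the squared Frobenius norm, which is differentiable
    along solutions; square roots are taken only at the end. *)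

Definition cont_from a (U : topologicalType) (f : R -> U) :=
  {within [set t : R | a <= t], continuous f}.

(** Differentiability is asked only after [a], with mere continuity at [a]: this is how solutions
    are given, and the mean value theorem asks for no more. *)
Definition der a f f' :=
  cont_from a f /\ forall t, a < t -> is_derive t 1 f (f' t).

Lemma cont_fromW a b (U : topologicalType) (f : R -> U) :
  a <= b -> cont_from a f -> cont_from b f.
Proof. by move=> ab; apply: continuous_subspaceW => t /=; apply: le_trans. Qed.

Lemma cont_from_itv a b c (U : topologicalType) (f : R -> U) :
  a <= b -> cont_from a f -> {within `[b, c], continuous f}.
Proof.
by move=> ab; apply: continuous_subspaceW => t /=; rewrite in_itv/= => /andP[+ _]; apply: le_trans.
Qed.

Lemma continuous_cont_from a (U : topologicalType) (f : R -> U) :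
  continuous f -> cont_from a f.
Proof. exact: continuous_subspaceT. Qed.

Lemma cont_fromD a (V : normedModType R) (f g : R -> V) :
  cont_from a f -> cont_from a g -> cont_from a (fun t => f t + g t).
Proof. by move=> cf cg t; apply: cvgD; [exact: cf|exact: cg]. Qed.

Lemma cont_fromN a (V : normedModType R) (f : R -> V) :
  cont_from a f -> cont_from a (fun t => - f t).
Proof. by move=> cf t; apply: cvgN; exact: cf. Qed.

Lemma cont_fromM a f g :
  cont_from a f -> cont_from a g -> cont_from a (fun t => f t * g t).
Proof. by move=> cf cg t; apply: cvgM; [exact: cf|exact: cg]. Qed.

Lemma cont_from_cst a (U : topologicalType) (c : U) : cont_from a (fun=> c).
Proof. by move=> t; apply: cvg_cst. Qed.

Lemma cont_from_sum a (I : Type) (r : seq I) (F : I -> R -> R) :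
  (forall i, cont_from a (F i)) -> cont_from a (fun t => \sum_(i <- r) F i t).
Proof.
move=> cF; elim: r => [|i r IH].
  by under eq_fun do rewrite big_nil; exact: cont_from_cst.
by under eq_fun do rewrite big_cons; exact: cont_fromD.
Qed.

Lemma eq_der a f g f' g' :
  (forall t, a < t -> f' t = g' t) -> (forall t, f t = g t) ->
  der a f f' -> der a g g'.
Proof.
move=> e' /funext e [cf df]; rewrite -e; split=> // t at_.
by rewrite -e' //; exact: df.
Qed.

Lemma derW a b f f' : a <= b -> der a f f' -> der b f f'.
Proof.
move=> ab [cf df]; split; first exact: cont_fromW cf.
by move=> t bt; apply: df; apply: le_lt_trans bt.
Qed.

Lemma der_global f f' a : (forall t, is_derive t 1 f (f' t)) -> der a f f'.
Proof.
move=> df; split=> //; apply: continuous_cont_from => t.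
apply/differentiable_continuous; rewrite -derivable1_diffP.
by have [] := df t.
Qed.

Lemma der_cst a (c : R) : der a (fun=> c) (fun=> 0).
Proof. by apply: der_global => t; exact: is_derive_cst. Qed.

Lemma derD a f g f' g' : der a f f' -> der a g g' ->
  der a (fun t => f t + g t) (fun t => f' t + g' t).
Proof.
move=> [cf df] [cg dg]; split; first exact: cont_fromD.
by move=> t at_; apply: is_deriveD; [exact: df|exact: dg].
Qed.

Lemma derN a f f' : der a f f' -> der a (fun t => - f t) (fun t => - f' t).
Proof.
move=> [cf df]; split; first exact: cont_fromN.
by move=> t at_; apply: is_deriveN; exact: df.
Qed.

Lemma derB a f g f' g' : der a f f' -> der a g g' ->
  der a (fun t => f t - g t) (fun t => f' t - g' t).
Proof. by move=> df dg; apply: derD => //; exact: derN. Qed.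

Lemma derM a f g f' g' : der a f f' -> der a g g' ->
  der a (fun t => f t * g t) (fun t => f' t * g t + f t * g' t).
Proof.
move=> [cf df] [cg dg]; split; first exact: cont_fromM.
move=> t at_; apply: (is_derive_eq (is_deriveM (df t at_) (dg t at_))).
by rewrite /GRing.scale/= addrC mulrC.
Qed.

Lemma derZ a (c : R) f f' : der a f f' -> der a (fun t => c * f t) (fun t => c * f' t).
Proof.
move=> df; apply: eq_der (derM (der_cst a c) df) => // t _.
by rewrite mul0r add0r.
Qed.

Lemma der_sum a (I : Type) (r : seq I) (F F' : I -> R -> R) :
  (forall i, der a (F i) (F' i)) ->
  der a (fun t => \sum_(i <- r) F i t) (fun t => \sum_(i <- r) F' i t).
Proof.
move=> dF; elim: r => [|i r IH].
  by apply: eq_der (der_cst a 0) => t; rewrite big_nil.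
by apply: eq_der (derD (dF i) IH) => t; rewrite big_cons.
Qed.

Lemma der_id a : der a id (fun=> 1).
Proof. by apply: der_global => t; exact: is_derive_id. Qed.

Lemma der_exp a (c s : R) :
  der a (fun t => expR (c * (t - s))) (fun t => c * expR (c * (t - s))).
Proof.
apply: der_global => t.
have d1 : is_derive t 1 (fun x : R => c * (x - s)) c.
  have [_ /(_ t)] := derZ c (derB (der_id (t - 1)) (der_cst (t - 1) s)).
  rewrite ltrBlDr ltrDl ltr01 => /(_ isT) H; apply: (is_derive_eq H).
  by rewrite subr0 mulr1.
apply: (is_derive_eq (is_derive1_comp (is_derive_expR _) d1)).
by rewrite mulrC.
Qed.

Lemma der_MVT a f f' s t : der a f f' -> a <= s -> s <= t ->
  exists2 c, s <= c <= t & f t - f s = f' c * (t - s).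
Proof.
move=> [cf df] as_ st.
have [x xst|c cst ->] := @MVT_segment R f f' s t st _ (cont_from_itv as_ cf).
  by apply: df; apply: le_lt_trans as_ _; rewrite (itvP xst).
by exists c => //; rewrite !(itvP cst).
Qed.

(* The endpoint is excluded from the hypothesis on [f']: there [f] is only continuous. *)
Lemma der_le a f f' s t : der a f f' -> a <= s -> s <= t ->
  (forall r, s < r -> r <= t -> f' r <= 0) -> f t <= f s.
Proof.
move=> [cf df] as_; rewrite le_eqVlt => /predU1P[<-//|st] f'0.
have [x xst|c cst e] := @MVT R f f' s t st _ (cont_from_itv as_ cf).
  by apply: df; apply: le_lt_trans as_ _; rewrite (itvP xst).
rewrite -subr_le0 e; apply: mulr_le0_ge0; last by rewrite subr_ge0 ltW.
by apply: f'0; rewrite ?(itvP cst).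
Qed.

Lemma der_ge a f f' s t : der a f f' -> a <= s -> s <= t ->
  (forall r, s < r -> r <= t -> 0 <= f' r) -> f s <= f t.
Proof.
move=> df as_ st f'0; rewrite -lerN2.
by apply: (der_le (derN df) as_ st) => r sr rt; rewrite oppr_le0 f'0.
Qed.

(** The product of [f] with [expR (- c * (t - s))] is nonincreasing, whatever the signs of [c] and
    [f]. *)
Lemma gronwall_le a f f' (c : R) s t : der a f f' -> a <= s -> s <= t ->
  (forall r, s < r -> r <= t -> f' r <= c * f r) ->
  f t <= expR (c * (t - s)) * f s.
Proof.
move=> df as_ st H.
have := der_le (derM df (der_exp a (- c) s)) as_ st.
rewrite subrr mulr0 expR0 mulr1 => /(_ _)/wrap[r sr rt|].
  rewrite mulrCA mulrA -mulrDl; apply: mulr_le0_ge0; last exact: expR_ge0.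
  by have := H r sr rt; lra.
by rewrite mulNr expRN ler_pdivrMr ?expR_gt0 // mulrC.
Qed.

Lemma gronwall_ge a f f' (c : R) s t : der a f f' -> a <= s -> s <= t ->
  (forall r, s < r -> r <= t -> c * f r <= f' r) ->
  expR (c * (t - s)) * f s <= f t.
Proof.
move=> df as_ st H; rewrite -lerN2 -mulrN.
apply: (gronwall_le (derN df) as_ st) => r sr rt.
by rewrite mulrN lerN2 H.
Qed.

Lemma cont_from_bounded a b f : cont_from a f ->
  exists2 B, 0 <= B & forall t, a <= t -> t <= b -> `|f t| <= B.
Proof.
move=> cf; have [ab|ba] := leP a b; last first.
  by exists 0 => // t at_ tb; have := le_lt_trans (le_trans at_ tb) ba; rewrite ltxx.
have c1 : {within `[a, b], continuous (fun t => `|f t|)}.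
  by move=> t; apply: cvg_norm; exact: (cont_from_itv (lexx a) cf).
have [c cab H] := EVT_max ab c1.
by exists `|f c| => // t at_ tb; apply: H; rewrite in_itv/= at_.
Qed.

Lemma cont_from_pos a f : cont_from a f -> (forall t, a <= t -> f t != 0) ->
  0 < f a -> forall t, a <= t -> 0 < f t.
Proof.
move=> cf f0 fa t at_; rewrite ltNge; apply/negP => ft.
have [] := @IVT R f a t 0 at_ (cont_from_itv (lexx a) cf).
  by rewrite ge_min le_max ft (ltW fa) orbT.
move=> c cat fc; have := f0 c; rewrite fc eqxx => /(_ _)/wrap[|//].
by rewrite (itvP cat).
Qed.

(** Freezing the argument at [a] extends [f] to a function continuous on the whole line. *)
Lemma cont_from_max a f : cont_from a f -> continuous (fun t => f (Num.max a t)).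
Proof.
move=> /subspace_continuousP cf t.
have H : Num.max a s @[s --> t] --> Num.max a t.
  by apply: (@continuous_max _ _ (fun=> a) id); [exact: cvg_cst|exact: cvg_id].
have at_ : a <= Num.max a t by rewrite le_max lexx.
apply: (@cvg_comp _ _ _ (fun s => Num.max a s) f _
  (within [set s | a <= s] (nbhs (Num.max a t)))); last exact: cf.
move=> A wA.
have HA : \forall s \near t, a <= Num.max a s -> A (Num.max a s) := H _ wA.
suff : \forall s \near t, A (Num.max a s) by [].
by apply: filterS HA => s; apply; rewrite le_max lexx.
Qed.

Lemma antiderivative a f : cont_from a f ->
  exists2 F, der a F f & F a = 0.
Proof.
move=> cf; set g := fun t => f (Num.max a t).
have cg : continuous g by exact: cont_from_max.
(* Integrating from [a - 1] makes [a] an interior point, where the primitive is differentiable and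
   hence continuous. *)
pose G t := Rintegral (@lebesgue_measure R) `[a - 1, t] g.
have dG t : a - 1 < t -> is_derive t 1 G (g t).
  move=> at_; have tt : t < t + 1 by rewrite ltrDl.
  have ig : (@lebesgue_measure R).-integrable `[a - 1, t + 1] (EFin \o g).
    apply: continuous_compact_integrable; first exact: segment_compact.
    exact: continuous_subspaceT.
  have [d e] := continuous_FTC1_closed tt ig at_ (cg t).
  by rewrite -e derive1E; exact: derivableP.
exists (fun t => G t - G a); last by rewrite subrr.
apply: (@eq_der a (fun t => G t - G a) _ (fun t => g t - 0)) => //.
  by move=> t at_; rewrite subr0 /g max_r // ltW.
apply: derB; last exact: der_cst.
split=> [|t at_]; last by apply: dG; apply: lt_trans at_; rewrite gtrBl.
apply: continuous_in_subspaceT => t; rewrite inE => /= at_.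
apply/differentiable_continuous; rewrite -derivable1_diffP.
by have [] := dG t _; first by apply: lt_le_trans at_; rewrite gtrBl.
Qed.

(** Turns the integral of the observability hypothesis into the increment of an antiderivative; from
    then on only differential equations occur. *)
Lemma Rintegral_der a b f F : a < b -> cont_from a f -> der a F f ->
  Rintegral (@lebesgue_measure R) `[a, b] f = F b - F a.
Proof.
move=> ab cf [cF dF]; rewrite /Rintegral.
rewrite (@continuous_FTC2 _ f F) //.
- exact: cont_from_itv cf.
- split.
  + by move=> t tab; have [] := dF t; rewrite ?(itvP tab).
  + by have /continuous_within_itvP-/(_ ab)[] := cont_from_itv (lexx a) cF (c := b).
  + by have /continuous_within_itvP-/(_ ab)[] := cont_from_itv (lexx a) cF (c := b).
- move=> t tab; rewrite derive1E.
  have d : is_derive t 1 F (f t) by apply: dF; rewrite (itvP tab).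
  exact: derive_val.
Qed.

End Calculus.

(** * Frobenius inner product and matrix-valued derivatives *)

Section Frobenius.
Context {R : realType}.

Definition fdot m n (A B : 'M[R]_(m, n)) : R := \sum_i \sum_j A i j * B i j.
(** Unlike the entrywise maximum [|A|], this is differentiable along solutions, and it is
    submultiplicative without a dimension factor. *)
Definition fsq m n (A : 'M[R]_(m, n)) : R := fdot A A.

Section Dims.
Context {m n : nat}.
Implicit Types A B C : 'M[R]_(m, n).

Lemma fdot_tr A B : fdot A B = \tr (A^T *m B).
Proof.
rewrite /fdot exchange_big; apply: eq_bigr => j _; rewrite mxE.
by apply: eq_bigr => i _; rewrite mxE.
Qed.

Lemma fdotC A B : fdot A B = fdot B A.
Proof. by rewrite !fdot_tr -mxtrace_tr trmx_mul trmxK. Qed.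

Lemma fdotDr A B C : fdot A (B + C) = fdot A B + fdot A C.
Proof. by rewrite !fdot_tr mulmxDr mxtraceD. Qed.

Lemma fdotZr (c : R) A B : fdot A (c *: B) = c * fdot A B.
Proof. by rewrite !fdot_tr -scalemxAr mxtraceZ. Qed.

Lemma fdotNr A B : fdot A (- B) = - fdot A B.
Proof. by rewrite -scaleN1r fdotZr mulN1r. Qed.

Lemma fdotBr A B C : fdot A (B - C) = fdot A B - fdot A C.
Proof. by rewrite fdotDr fdotNr. Qed.

Lemma fdot0r A : fdot A 0 = 0.
Proof. by rewrite fdot_tr mulmx0 mxtrace0. Qed.

Lemma fdotDl A B C : fdot (A + B) C = fdot A C + fdot B C.
Proof. by rewrite !(fdotC _ C) fdotDr. Qed.

Lemma fdotZl (c : R) A B : fdot (c *: A) B = c * fdot A B.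
Proof. by rewrite !(fdotC _ B) fdotZr. Qed.

Lemma fdotNl A B : fdot (- A) B = - fdot A B.
Proof. by rewrite !(fdotC _ B) fdotNr. Qed.

Lemma fdotBl A B C : fdot (A - B) C = fdot A C - fdot B C.
Proof. by rewrite fdotDl fdotNl. Qed.

Lemma fsq_ge0 A : 0 <= fsq A.
Proof. by apply: sumr_ge0 => i _; apply: sumr_ge0 => j _; rewrite -expr2 sqr_ge0. Qed.

Lemma fsq_entry A i j : A i j ^+ 2 <= fsq A.
Proof.
rewrite /fsq /fdot (bigD1 i) //= (bigD1 j) //= -expr2 -addrA lerDl.
apply: addr_ge0; first by apply: sumr_ge0 => k _; rewrite -expr2 sqr_ge0.
by apply: sumr_ge0 => k _; apply: sumr_ge0 => l _; rewrite -expr2 sqr_ge0.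
Qed.

Lemma fsq_eq0 A : (fsq A == 0) = (A == 0).
Proof.
apply/eqP/eqP => [A0|->]; last by rewrite /fsq fdot0r.
apply/matrixP => i j; rewrite mxE; apply/eqP; rewrite -sqrf_eq0 eq_le sqr_ge0 andbT.
by rewrite -A0 fsq_entry.
Qed.

Lemma fsq0 : fsq (0 : 'M[R]_(m, n)) = 0.
Proof. by rewrite /fsq fdot0r. Qed.

Lemma fsqN A : fsq (- A) = fsq A.
Proof. by rewrite /fsq fdotNl fdotNr opprK. Qed.

Lemma fsqZ (c : R) A : fsq (c *: A) = c ^+ 2 * fsq A.
Proof. by rewrite /fsq fdotZl fdotZr mulrA. Qed.

(** Expands [fsq (A - c^-1 *: B)]. Used more often than Cauchy-Schwarz because it keeps estimates
    linear in squared norms. *)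
Lemma fdot_young (c : R) A B : 0 < c -> 2 * fdot A B <= c * fsq A + c^-1 * fsq B.
Proof.
move=> c0; have := fsq_ge0 (A - c^-1 *: B).
rewrite /fsq !(fdotBl, fdotBr) !(fdotZl, fdotZr) (fdotC B A).
set x := fdot A A; set y := fdot A B; set z := fdot B B => H.
have : 0 <= c * (x - c^-1 * y - (c^-1 * y - c^-1 * (c^-1 * z))) by rewrite mulr_ge0 // ltW.
have -> : c * (x - c^-1 * y - (c^-1 * y - c^-1 * (c^-1 * z))) = c * x - 2 * y + c^-1 * z.
  by field; rewrite gt_eqF.
by lra.
Qed.

Lemma fdot_CS A B : fdot A B ^+ 2 <= fsq A * fsq B.
Proof.
have [A0|A0] := eqVneq (fsq A) 0.
  by move/eqP: A0; rewrite fsq_eq0 => /eqP ->; rewrite fdotC fdot0r fsq0 expr0n mul0r.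
have Ap : 0 < fsq A by rewrite lt_def A0 fsq_ge0.
have := fsq_ge0 (fsq A *: B - fdot A B *: A).
rewrite /fsq !(fdotBl, fdotBr) !(fdotZl, fdotZr) (fdotC B A) -/(fsq A) -/(fsq B).
move: (fsq A) (fsq B) (fdot A B) Ap => x z y Ap H.
rewrite -subr_ge0 -(pmulr_rge0 _ Ap); apply: le_trans H _.
by rewrite le_eqVlt; apply/orP; left; apply/eqP; ring.
Qed.

Lemma fsqD_le A B : fsq (A + B) <= 2 * (fsq A + fsq B).
Proof.
have := fdot_young A B ltr01; rewrite /fsq !(fdotDl, fdotDr) (fdotC B A) invr1 /fsq.
by lra.
Qed.

Lemma fsq_sum A : fsq A = \sum_i \sum_j A i j ^+ 2.
Proof. by apply: eq_bigr => i _; apply: eq_bigr => j _; rewrite expr2. Qed.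

Lemma mx_norm_le A (c : R) : 0 <= c -> (forall i j, `|A i j| <= c) -> `|A| <= c.
Proof. by move=> c0 H; rewrite /Num.Def.normr/= mx_normrE bigmax_le // => -[i j] _ /=. Qed.

Lemma mx_norm_entry A i j : `|A i j| <= `|A|.
Proof. by rewrite [leRHS]/Num.Def.normr/= mx_normrE; exact: (le_bigmax _ (fun k => `|A k.1 k.2|) (i, j)). Qed.

Lemma mx_norm_sq_le A : `|A| ^+ 2 <= fsq A.
Proof.
rewrite -(sqr_sqrtr (fsq_ge0 A)) lerXn2r ?nnegrE ?sqrtr_ge0 //.
apply: mx_norm_le; first exact: sqrtr_ge0.
by move=> i j; rewrite -sqrtr_sqr ler_wsqrtr // fsq_entry.
Qed.

Lemma fsq_le_norm A : fsq A <= (m * n)%:R * `|A| ^+ 2.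
Proof.
have e : (m * n)%:R * `|A| ^+ 2 = \sum_(i < m) \sum_(j < n) `|A| ^+ 2.
  under eq_bigr do rewrite sumr_const card_ord.
  by rewrite sumr_const card_ord -mulrnA mulr_natl mulnC.
rewrite e fsq_sum; apply: ler_sum => i _; apply: ler_sum => j _.
by rewrite -real_normK ?num_real // lerXn2r ?nnegrE // mx_norm_entry.
Qed.

End Dims.

Lemma fdot_mull m n p (A : 'M[R]_(m, n)) (B : 'M[R]_(n, p)) C :
  fdot (A *m B) C = fdot B (A^T *m C).
Proof. by rewrite !fdot_tr trmx_mul mulmxA. Qed.

Lemma fdot_mulr m n p (A : 'M[R]_(m, n)) (B : 'M[R]_(n, p)) C :
  fdot (A *m B) C = fdot A (C *m B^T).
Proof. by rewrite !fdot_tr trmx_mul -!mulmxA mxtrace_mulC !mulmxA. Qed.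

Lemma fsq_tr m n (A : 'M[R]_(m, n)) : fsq A^T = fsq A.
Proof. by rewrite /fsq !fdot_tr trmxK mxtrace_mulC. Qed.

Lemma fsq_mul m n p (A : 'M[R]_(m, n)) (B : 'M[R]_(n, p)) :
  fsq (A *m B) <= fsq A * fsq B.
Proof.
have e : fsq (A *m B) = \sum_i \sum_k fdot (row i A) (col k B)^T ^+ 2.
  rewrite fsq_sum; apply: eq_bigr => i _; apply: eq_bigr => k _; congr (_ ^+ 2).
  by rewrite mxE /fdot big_ord1; apply: eq_bigr => j _; rewrite !mxE.
have eA : fsq A = \sum_i fsq (row i A).
  by apply: eq_bigr => i _; rewrite /fsq /fdot big_ord1; apply: eq_bigr => j _; rewrite !mxE.
have eB : fsq B = \sum_k fsq (col k B)^T.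
  rewrite /fsq /fdot exchange_big; apply: eq_bigr => i _; rewrite big_ord1.
  by apply: eq_bigr => j _; rewrite !mxE.
rewrite e eA eB mulr_suml; apply: ler_sum => i _; rewrite mulr_sumr.
by apply: ler_sum => k _; exact: fdot_CS.
Qed.

Lemma qformE n (S : 'M[R]_n) v : qform S v = fdot v (S *m v).
Proof. by rewrite fdot_tr /mxtrace big_ord1 mulmxA. Qed.

Lemma qform1 n (v : 'cV[R]_n) : qform 1%:M v = fsq v.
Proof. by rewrite qformE mul1mx. Qed.

Lemma unif_pos_defP n (S : R -> 'M[R]_n) : unif_pos_def S ->
  exists2 c, 0 < c & forall t, 0 <= t ->
    (S t)^T = S t /\ forall v : 'cV[R]_n, c * fsq v <= fdot v (S t *m v).
Proof.
move=> [c [c0 H]]; exists c => // t t0; have [sS Sv] := H t t0.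
by split=> // v; rewrite -qform1 -qformE.
Qed.

Lemma bounded_fsq m n (F : R -> 'M[R]_(m, n)) : bounded_on_nonneg F ->
  exists2 b, 0 < b & forall t, 0 <= t -> fsq (F t) <= b.
Proof.
move=> [B HB]; exists ((m * n)%:R * B ^+ 2 + 1).
  by apply: ltr_wpDl => //; rewrite mulr_ge0 ?ler0n ?sqr_ge0.
move=> t t0; apply: ler_wpDr => //; apply: le_trans (fsq_le_norm _) _.
apply: ler_wpM2l; first exact: ler0n.
have B0 : 0 <= B by apply: le_trans (HB t t0).
by rewrite lerXn2r ?nnegrE // HB.
Qed.

End Frobenius.

(** * Entrywise calculus of matrix-valued functions *)

Section MatrixDer.
Context {R : realType}.
Implicit Types (a t : R).

(** Entrywise, so that product rule and mean value theorem are inherited from scalar functions;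
    [mderP] relates it to the derivative of the matrix-valued map. *)
Definition mder m n a (F F' : R -> 'M[R]_(m, n)) :=
  forall i j, der a (fun t => F t i j) (fun t => F' t i j).

Lemma cont_from_mxP m n a (F : R -> 'M[R]_(m, n)) :
  cont_from a F <-> forall i j, cont_from a (fun t => F t i j).
Proof.
split=> [/subspace_continuousP cF i j|cF]; apply/subspace_continuousP => t at_.
  apply/cvgrPdist_le => e e0; have /cvgrPdist_le/(_ e e0) := cF t at_.
  apply: filterS => s; apply: le_trans.
  by apply: le_trans (mx_norm_entry _ i j); rewrite !mxE.
apply/cvgrPdist_le => e e0.
have H : \forall s \near within [set t | a <= t] (nbhs t),
    forall ij : 'I_m * 'I_n, `|F t ij.1 ij.2 - F s ij.1 ij.2| <= e.
  apply: filter_forall => -[i j].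
  by have /subspace_continuousP/(_ t at_)/cvgrPdist_le/(_ e e0) := cF i j.
apply: filterS H => s H; apply: mx_norm_le; first exact: ltW.
by move=> i j; rewrite !mxE; exact: (H (i, j)).
Qed.

Lemma is_derive_mxP m n t (F : R -> 'M[R]_(m, n)) (D : 'M[R]_(m, n)) :
  is_derive t 1 F D <-> forall i j, is_derive t 1 (fun s => F s i j) (D i j).
Proof.
split=> [[d e] i j|H].
  have d' := (derivable_mxP _ _ _).1 d i j.
  by apply: DeriveDef => //; rewrite -e derive_mx // mxE.
have d : derivable F t 1 by apply/derivable_mxP => i j; have [] := H i j.
apply: DeriveDef => //; rewrite derive_mx //; apply/matrixP => i j; rewrite mxE.
by have [] := H i j.
Qed.

Lemma mderP m n a (F F' : R -> 'M[R]_(m, n)) :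
  mder a F F' <->
  cont_from a F /\ forall t, a < t -> is_derive t 1 F (F' t).
Proof.
split=> [H|[cF dF] i j].
  split; first by apply/cont_from_mxP => i j; have [] := H i j.
  by move=> t at_; apply/is_derive_mxP => i j; have [_] := H i j; apply.
split; first exact: (cont_from_mxP _ _).1.
by move=> t at_; exact: (is_derive_mxP _ _ _).1 (dF t at_) i j.
Qed.

Section Rules.
Context {m n : nat} {a : R}.
Implicit Types F G : R -> 'M[R]_(m, n).

Lemma eq_mder F G F' G' : (forall t, a < t -> F' t = G' t) ->
  (forall t, F t = G t) -> mder a F F' -> mder a G G'.
Proof.
by move=> e' e H i j; apply: eq_der (H i j) => t; [move=> /e' -> | rewrite e].
Qed.

Lemma mderW b F F' : a <= b -> mder a F F' -> mder b F F'.
Proof. by move=> ab H i j; apply: derW (H i j). Qed.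

Lemma mder_cst (A : 'M[R]_(m, n)) : mder a (fun=> A) (fun=> 0).
Proof. by move=> i j; apply: eq_der (der_cst a (A i j)) => // t _; rewrite mxE. Qed.

Lemma mderD F G F' G' : mder a F F' -> mder a G G' ->
  mder a (fun t => F t + G t) (fun t => F' t + G' t).
Proof.
by move=> H K i j; apply: eq_der (derD (H i j) (K i j)) => t; rewrite mxE.
Qed.

Lemma mderN F F' : mder a F F' -> mder a (fun t => - F t) (fun t => - F' t).
Proof. by move=> H i j; apply: eq_der (derN (H i j)) => t; rewrite mxE. Qed.

Lemma mderB F G F' G' : mder a F F' -> mder a G G' ->
  mder a (fun t => F t - G t) (fun t => F' t - G' t).
Proof. by move=> H K; apply: mderD => //; exact: mderN. Qed.

Lemma mderT F F' : mder a F F' -> mder a (fun t => (F t)^T) (fun t => (F' t)^T).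
Proof. by move=> H i j; apply: eq_der (H j i) => t; rewrite mxE. Qed.

Lemma mderM p F F' (G G' : R -> 'M[R]_(n, p)) : mder a F F' -> mder a G G' ->
  mder a (fun t => F t *m G t) (fun t => F' t *m G t + F t *m G' t).
Proof.
move=> H K i j.
apply: eq_der (der_sum (index_enum 'I_n) (fun k => derM (H i k) (K k j))) => t.
  by rewrite !mxE big_split.
by rewrite mxE.
Qed.

Lemma mderMl p (A : 'M[R]_(p, m)) F F' : mder a F F' ->
  mder a (fun t => A *m F t) (fun t => A *m F' t).
Proof.
move=> H i j.
apply: eq_der (der_sum (index_enum 'I_m) (fun k => derZ (A i k) (H k j))) => t;
  by rewrite mxE.
Qed.

Lemma der_fdot F G F' G' : mder a F F' -> mder a G G' ->
  der a (fun t => fdot (F t) (G t)) (fun t => fdot (F' t) (G t) + fdot (F t) (G' t)).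
Proof.
move=> H K; pose df i j := derM (H i j) (K i j).
apply: eq_der (der_sum (index_enum 'I_m) (fun i => der_sum (index_enum 'I_n) (df i))) => // t _.
rewrite /fdot -big_split; apply: eq_bigr => i _.
by rewrite -big_split.
Qed.

Lemma der_fsq F F' : mder a F F' ->
  der a (fun t => fsq (F t)) (fun t => 2 * fdot (F t) (F' t)).
Proof.
move=> H; apply: eq_der (der_fdot H H) => // t _.
by rewrite (fdotC (F' t)) mulr_natl mulr2n.
Qed.

End Rules.

Lemma mderMr m n p a (A : 'M[R]_(n, p)) (F F' : R -> 'M[R]_(m, n)) : mder a F F' ->
  mder a (fun t => F t *m A) (fun t => F' t *m A).
Proof.
move=> H; apply: eq_mder (mderM H (@mder_cst _ _ a A)) => // t _.
by rewrite mulmx0 addr0.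
Qed.

Lemma cont_from_mulmx m n p a (F : R -> 'M[R]_(m, n)) (G : R -> 'M[R]_(n, p)) :
  cont_from a F -> cont_from a G -> cont_from a (fun t => F t *m G t).
Proof.
move=> /cont_from_mxP cF /cont_from_mxP cG; apply/cont_from_mxP => i j.
under eq_fun do rewrite mxE.
by apply: cont_from_sum => k; exact: cont_fromM.
Qed.

Lemma cont_from_trmx m n a (F : R -> 'M[R]_(m, n)) :
  cont_from a F -> cont_from a (fun t => (F t)^T).
Proof.
move=> /cont_from_mxP cF; apply/cont_from_mxP => i j.
under eq_fun do rewrite mxE.
exact: cF.
Qed.

Lemma cont_from_fsq_bounded m n a b (F : R -> 'M[R]_(m, n)) : cont_from a F ->
  exists2 B, 0 <= B & forall t, a <= t -> t <= b -> fsq (F t) <= B.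
Proof.
move=> /cont_from_mxP cF.
have [|B B0 HB] := @cont_from_bounded _ a b (fun t => fsq (F t)).
  by apply: cont_from_sum => i; apply: cont_from_sum => j; exact: cont_fromM.
by exists B => // t at_ tb; apply: le_trans (HB t at_ tb); exact: ler_norm.
Qed.

Lemma gronwall_fwd m n a (F F' : R -> 'M[R]_(m, n)) K s t : mder a F F' ->
  a <= s -> s <= t -> 
  (forall r, s < r -> r <= t -> fsq (F' r) <= K * fsq (F r)) ->
  fsq (F t) <= expR ((1 + K) * (t - s)) * fsq (F s).
Proof.
move=> dF as_ st H; apply: (gronwall_le (der_fsq dF) as_ st) => r sr rt.
apply: le_trans (fdot_young _ _ ltr01) _; rewrite invr1 !mul1r mulrDl mul1r lerD2l.
exact: H.
Qed.

End MatrixDer.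

(** * Linear differential equations *)

Section LinearODE.
Context {R : realType}.

Lemma mx_norm_mulmx m n p (A : 'M[R]_(m, n)) (B : 'M[R]_(n, p)) :
  `|A *m B| <= n%:R * (`|A| * `|B|).
Proof.
apply: mx_norm_le => [|i j]; first by rewrite mulr_ge0 // mulr_ge0.
rewrite mxE; apply: le_trans (ler_norm_sum _ _ _) _.
have -> : n%:R * (`|A| * `|B|) = \sum_(k < n) `|A| * `|B|.
  by rewrite sumr_const card_ord mulr_natl.
by apply: ler_sum => k _; rewrite normrM ler_pM // mx_norm_entry.
Qed.

Lemma mx_antiderivative m n a (F : R -> 'M[R]_(m, n)) (X0 : 'M[R]_(m, n)) :
  cont_from a F -> exists2 G, mder a G F & G a = X0.
Proof.
move=> /cont_from_mxP cF.
have H ij := cid2 (antiderivative (cF ij.1 ij.2)).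
exists (fun t => \matrix_(i, j) (s2val (H (i, j)) t + X0 i j)).
  move=> i j; have d := s2valP (H (i, j)).
  apply: eq_der (derD d (der_cst a (X0 i j))) => t; first by rewrite /= addr0.
  by rewrite mxE.
by apply/matrixP => i j; rewrite mxE (s2valP' (H (i, j))) add0r.
Qed.

Lemma mder_cont m n a (F F' : R -> 'M[R]_(m, n)) : mder a F F' -> cont_from a F.
Proof. by case/mderP. Qed.

Section Picard.
Context {n : nat} (B : R -> 'M[R]_n) (cB : cont_from 0 B).

(** Continuity of [G] is a premise inside the sigma type, so that [picard] is a plain recursion; a
    discontinuous [G] is returned unchanged. *)
Lemma picard_step (G : R -> 'M[R]_n) : {G' : R -> 'M[R]_n | cont_from 0 G ->
  [/\ cont_from 0 G', G' 0 = 1%:M & mder 0 G' (fun t => B t *m G t)]}.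
Proof.
apply: cid; have [cG|] := pselect (cont_from 0 G); last by exists G.
have [G' dG' G'0] := mx_antiderivative 1%:M (cont_from_mulmx cB cG).
by exists G' => _; split=> //; exact: mder_cont dG'.
Qed.

Fixpoint picard k : R -> 'M[R]_n :=
  if k is l.+1 then sval (picard_step (picard l)) else fun=> 1%:M.

Lemma picard_cont k : cont_from 0 (picard k).
Proof.
elim: k => [|k IH]; first exact: cont_from_cst.
by have [] := svalP (picard_step (picard k)) IH.
Qed.

Arguments picard_cont k : clear implicits.

Lemma picard0 k : picard k 0 = 1%:M.
Proof. by case: k => // k; have [] := svalP (picard_step (picard k)) (picard_cont k). Qed.

Lemma picard_der k : mder 0 (picard k.+1) (fun t => B t *m picard k t).
Proof. by have [] := svalP (picard_step (picard k)) (picard_cont k). Qed.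

Arguments picard_der k : clear implicits.

(** Both [g - f] and [g + f] are nondecreasing and start nonnegative. *)
Lemma der_abs_le (f f' g g' : R -> R) t : der 0 f f' -> der 0 g g' -> 0 <= t ->
  `|f 0| <= g 0 -> (forall r, 0 < r -> r <= t -> `|f' r| <= g' r) -> `|f t| <= g t.
Proof.
move=> df dg t0 fg0 H; rewrite ler_norml; move: fg0; rewrite ler_norml => /andP[h1 h2].
have := der_ge (derB dg df) (lexx 0) t0; have := der_ge (derD dg df) (lexx 0) t0.
move=> /(_ _)/wrap[r r0 rt|A1].
  by have := H r r0 rt; rewrite ler_norml => /andP[]; lra.
move=> /(_ _)/wrap[r r0 rt|A2].
  by have := H r r0 rt; rewrite ler_norml => /andP[]; lra.
by apply/andP; split; lra.
Qed.

Lemma mx_norm_bounded m p b (F : R -> 'M[R]_(m, p)) : cont_from 0 F ->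
  exists2 C, 0 < C & forall t, 0 <= t -> t <= b -> `|F t| <= C.
Proof.
move=> /(cont_from_fsq_bounded b)[C C0 HC]; exists (C + 1); first by rewrite ltr_wpDl.
move=> t t0 tb; rewrite -(@ler_pXn2r _ 2) ?nnegrE ?addr_ge0 //.
apply: le_trans (mx_norm_sq_le _) _; apply: le_trans (HC t t0 tb) _.
by rewrite sqrrD; have := sqr_ge0 C; lra.
Qed.

(* The weight [exp (2 L t)] makes the Picard map a contraction of ratio 1/2. *)
Lemma picard_diff b : exists2 C, 0 < C & forall k t, 0 <= t -> t <= b ->
  `|picard k.+1 t - picard k t| <= C * 2^-1 ^+ k.
Proof.
have [LB LB0 HB] := mx_norm_bounded b cB.
have [c c0 Hc] := mx_norm_bounded b (cont_fromD (picard_cont 1) (cont_fromN (picard_cont 0))).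
pose L := n%:R * LB; have L0 : 0 <= L by rewrite mulr_ge0 // ltW.
suff H k t : 0 <= t -> t <= b ->
    `|picard k.+1 t - picard k t| <= c * 2^-1 ^+ k * expR (2 * L * (t - 0)).
  exists (c * expR (2 * L * b)); first by rewrite mulr_gt0 ?expR_gt0.
  move=> k t t0 tb; apply: le_trans (H k t t0 tb) _.
  rewrite mulrAC ler_wpM2r ?exprn_ge0 ?invr_ge0 // ler_wpM2l ?(ltW c0) // ler_expR.
  by rewrite subr0 ler_wpM2l // mulr_ge0.
elim: k t => [|k IH] t t0 tb.
  rewrite expr0 mulr1; apply: le_trans (Hc t t0 tb) _.
  rewrite ler_peMr ?(ltW c0) // -expR0 ler_expR subr0 mulr_ge0 //.
  by rewrite mulr_ge0.
have C0 : 0 <= c * 2^-1 ^+ k.+1 by rewrite mulr_ge0 ?(ltW c0) // exprn_ge0 // invr_ge0.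
apply: mx_norm_le => [|i j]; first by rewrite mulr_ge0 ?expR_ge0.
have d1 := mderB (picard_der k.+1) (picard_der k).
have d2 := derZ (c * 2^-1 ^+ k.+1) (der_exp 0 (2 * L) 0).
have := der_abs_le (d1 i j) d2 t0; apply.
  rewrite !picard0 !mxE !subrr normr0 mulr_ge0 ?expR_ge0 //.
move=> r r0 rt; rewrite -mulmxBr; apply: le_trans (mx_norm_entry _ _ _) _.
apply: le_trans (mx_norm_mulmx _ _) _.
have rb := le_trans rt tb.
apply: (@le_trans _ _ (L * (c * 2^-1 ^+ k * expR (2 * L * (r - 0))))).
  rewrite mulrA ler_pM ?mulr_ge0 //; last exact: IH (ltW r0) rb.
  by rewrite ler_wpM2l // HB // ltW.
by rewrite exprS le_eqVlt; apply/orP; left; apply/eqP; field.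
Qed.

Lemma picard_tail b : exists2 C, 0 < C & forall k l t, 0 <= t -> t <= b ->
  `|picard (k + l) t - picard k t| <= C * 2^-1 ^+ k.
Proof.
have [C C0 HC] := picard_diff b; exists (2 * C); first by rewrite mulr_gt0.
move=> k l t t0 tb.
(* With a difference of powers on the right the induction on [l] telescopes. *)
suff H : `|picard (k + l) t - picard k t| <= 2 * C * (2^-1 ^+ k - 2^-1 ^+ (k + l)).
  apply: le_trans H _; rewrite ler_wpM2l ?mulr_ge0 ?(ltW C0) // gerBl.
  by rewrite exprn_ge0 // invr_ge0.
elim: l => [|l IH]; first by rewrite addn0 !subrr normr0 mulr0.
have := lerD (HC (k + l)%N t t0 tb) IH; rewrite addnS; move: (ler_normD (picard (k + l).+1 t - picard (k + l) t) (picard (k + l) t - picard k t)).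
rewrite addrA subrK => H1 H2; apply: le_trans H1 _; apply: le_trans H2 _.
by rewrite exprS le_eqVlt; apply/orP; left; apply/eqP; field.
Qed.

Lemma half_exp_lt (C e : R) : 0 < C -> 0 < e -> exists k : nat, C * 2^-1 ^+ k < e.
Proof.
move=> C0 e0; pose k := (Num.truncn (C / e)).+1; exists k.
have h : C / e < k%:R by exact: truncnS_gt.
rewrite exprVn ltr_pdivrMr ?exprn_gt0 // mulrC -ltr_pdivrMr //.
apply: lt_trans h _; rewrite -natrX ltr_nat; exact: ltn_expl.
Qed.

(** The limit is taken entrywise, once for all times; the horizon [b] enters only the constants. *)
Lemma picard_lim : exists X : R -> 'M[R]_n, forall b, exists2 C, 0 < C &
  forall k t, 0 <= t -> t <= b -> `|X t - picard k t| <= C * 2^-1 ^+ k.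
Proof.
pose X t : 'M[R]_n := \matrix_(i, j) limn (fun k => picard k t i j).
exists X => b; have [C C0 HC] := picard_tail b; exists C => // k t t0 tb.
apply: mx_norm_le => [|i j]; first by rewrite mulr_ge0 ?(ltW C0) // exprn_ge0 // invr_ge0.
have : cvgn (fun k => picard k t i j).
  apply/cauchy_cvgP/cauchy_exP => e e0; have [l Hl] := half_exp_lt C0 e0.
  exists (picard l t i j); exists l => // m /= lm; rewrite -(subnKC lm) /ball/= distrC.
  apply: le_lt_trans Hl; apply: le_trans (HC l (m - l)%N t t0 tb).
  by apply: le_trans (mx_norm_entry _ i j); rewrite !mxE.
move=> /cvgrPdist_le cvX; rewrite !mxE; apply/ler_addgt0Pr => e e0.
have [N _ HN] := cvX e e0.
have := HN (k + N)%N (leq_addl _ _); have := HC k N t t0 tb.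
move=> /(le_trans (mx_norm_entry _ i j)); rewrite !mxE => H1 H2.
rewrite [leRHS]addrC; apply: le_trans (lerD H2 H1).
by apply: le_trans (ler_normD _ _); rewrite addrA subrK.
Qed.

Theorem linear_ode : exists2 X : R -> 'M[R]_n, mder 0 X (fun t => B t *m X t) & X 0 = 1%:M.
Proof.
have [X HX] := picard_lim.
have cX : cont_from 0 X.
  apply/subspace_continuousP => t t0; apply/cvgrPdist_le => e e0.
  have [C C0 HC] := HX (t + 1); have e3 : 0 < e / 3 by rewrite divr_gt0.
  have [k Hk] := half_exp_lt C0 e3.
  have /subspace_continuousP/(_ t t0)/cvgrPdist_le/(_ _ e3) := picard_cont k.
  rewrite !near_withinE; apply: filter_app; near=> s => h s0.
  have st : s <= t + 1.
    by near: s; apply: lt_le_nbhsl; rewrite ltrDl.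
  have h1 := HC k s s0 st; have h2 := HC k t t0 (ler_wpDr ler01 (lexx t)).
  have := ler_normD (X t - picard k t) (picard k t - picard k s).
  have := ler_normD (X t - picard k t + (picard k t - picard k s)) (picard k s - X s).
  rewrite (distrC (picard k s)) !addrA !subrK => h3 h4.
  by move: Hk (h s0) h1 h2 h3 h4; rewrite /from_subspace; lra.
(* Instead of differentiating the limit, [X] is compared with the antiderivative [F] of [B *m X]:
   both are within a multiple of [2^-1 ^+ k] of the iterates, so they agree. *)
have [F dF F0] := mx_antiderivative 1%:M (cont_from_mulmx cB cX).
suff e t : 0 <= t -> X t = F t.
  by exists F => //; apply: eq_mder dF => // t t0; rewrite e // ltW.
move=> t0; have [C C0 HC] := HX t; have [LB LB0 HB] := mx_norm_bounded t cB.
pose K := n%:R * LB * C * t; have K0 : 0 <= K by rewrite !mulr_ge0 // ltW.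
have H k : `|picard k.+1 t - F t| <= K * 2^-1 ^+ k.
  have p0 : 0 <= 2^-1 ^+ k :> R by rewrite exprn_ge0 // invr_ge0.
  apply: mx_norm_le => [|i j]; first by rewrite mulr_ge0.
  have [c /andP[c0 ct]] := der_MVT (mderB (picard_der k) dF i j) (lexx 0) t0.
  rewrite !picard0 F0 subrr [in X in _ - X]mxE !subr0 => ->.
  rewrite normrM (ger0_norm t0) /K mulrAC ler_wpM2r // -mulmxBr.
  apply: le_trans (mx_norm_entry _ _ _) _; apply: le_trans (mx_norm_mulmx _ _) _.
  rewrite -!mulrA ler_wpM2l // ler_pM // ?HB //.
  by rewrite distrC HC.
apply/eqP; rewrite -subr_eq0 -normr_eq0 eq_le normr_ge0 andbT.
apply/ler_addgt0Pr => e e0; rewrite add0r.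
have [k] := half_exp_lt (ltr_wpDl K0 C0) e0.
have p0 : 0 < 2^-1 ^+ k :> R by rewrite exprn_gt0 // invr_gt0.
have := HC k.+1 t t0 (lexx t); have := H k.
have := ler_normD (X t - picard k.+1 t) (picard k.+1 t - F t); rewrite addrA subrK.
have : C * 2^-1 ^+ k.+1 <= C * 2^-1 ^+ k.
  by rewrite exprS mulrCA ler_piMl ?mulr_ge0 ?(ltW C0) ?(ltW p0) // invf_le1 // ler1n.
by rewrite mulrDl; lra.
Unshelve. all: by end_near. Qed.

End Picard.

Lemma mder_eq0 m n (F : R -> 'M[R]_(m, n)) : mder 0 F (fun=> 0) ->
  forall t, 0 <= t -> F t = F 0.
Proof.
move=> dF t t0; apply/matrixP => i j.
have [c _ /eqP] := der_MVT (dF i j) (lexx 0) t0.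
by rewrite mxE mul0r subr_eq0 => /eqP.
Qed.

(* The inverse fundamental matrix is itself the solution of a linear equation, the transpose of
   the adjoint one. *)
Theorem fundamental_matrix n (B : R -> 'M[R]_n) : cont_from 0 B ->
  exists X Y : R -> 'M[R]_n,
  [/\ mder 0 X (fun t => B t *m X t), mder 0 Y (fun t => - (Y t *m B t)) &
      forall t, 0 <= t -> Y t *m X t = 1%:M /\ X t *m Y t = 1%:M].
Proof.
move=> cB; have [X dX X0] := linear_ode cB.
have [Z dZ Z0] := linear_ode (cont_fromN (cont_from_trmx cB)).
exists X, (fun t => (Z t)^T); split=> //.
  by apply: eq_mder (mderT dZ) => // t _; rewrite mulNmx linearN /= trmx_mul trmxK.
move=> t t0; suff e : (Z t)^T *m X t = 1%:M by split=> //; exact: mulmx1C.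
have d : mder 0 (fun s => (Z s)^T *m X s) (fun=> 0).
  apply: eq_mder (mderM (mderT dZ) dX) => // s _.
  by rewrite mulNmx linearN /= trmx_mul trmxK mulNmx mulmxA addNr.
by rewrite (mder_eq0 d t0) Z0 X0 trmx1 mulmx1.
Qed.

End LinearODE.

(** * The Riccati equation *)

Section Riccati.
Context {R : realType} {n p : nat}.
Variables (A : R -> 'M[R]_n) (C : R -> 'M[R]_(p, n)) (Q : R -> 'M[R]_p).
Variables (V P : R -> 'M[R]_n).
Hypotheses (cA : cont_from 0 A) (bA : bounded_on_nonneg A).
Hypotheses (cC : cont_from 0 C) (bC : bounded_on_nonneg C).
Hypotheses (cQ : cont_from 0 Q) (bQ : bounded_on_nonneg Q) (pQ : unif_pos_def Q).
Hypotheses (bV : bounded_on_nonneg V) (pV : unif_pos_def V).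
Hypothesis P0 : sym_pos_def (P 0).
Hypothesis dP : mder 0 P (fun t =>
  A t *m P t + P t *m (A t)^T - P t *m (C t)^T *m Q t *m C t *m P t + V t).

Let S t := (C t)^T *m Q t *m C t.

Lemma information_cont : cont_from 0 S.
Proof.
by do 2!apply: cont_from_mulmx => //; exact: cont_from_trmx.
Qed.

Lemma fsq_mul_le m1 m2 m3 (X : 'M[R]_(m1, m2)) (Y : 'M[R]_(m2, m3)) (x y : R) :
  fsq X <= x -> fsq Y <= y -> fsq (X *m Y) <= x * y.
Proof.
by move=> hx hy; apply: le_trans (fsq_mul _ _) _; rewrite ler_pM // fsq_ge0.
Qed.

Lemma information_bounded : exists2 s, 0 < s & forall t, 0 <= t -> fsq (S t) <= s.
Proof.
have [c c0 Hc] := bounded_fsq bC; have [q q0 Hq] := bounded_fsq bQ.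
exists (c * q * c) => [|t t0]; first by rewrite !mulr_gt0.
by rewrite !fsq_mul_le ?fsq_tr ?Hc ?Hq.
Qed.

Lemma trmxDE m1 m2 (X Y : 'M[R]_(m1, m2)) : (X + Y)^T = X^T + Y^T.
Proof. by apply/matrixP => i j; rewrite !mxE. Qed.

Lemma trmxNE m1 m2 (X : 'M[R]_(m1, m2)) : (- X)^T = - X^T.
Proof. by apply/matrixP => i j; rewrite !mxE. Qed.

Lemma cont_from_gram a (F : R -> 'M[R]_n) : 0 <= a -> cont_from a F ->
  cont_from a (fun s => (F s)^T *m (C s)^T *m C s *m F s).
Proof.
move=> a0 cF; have cCa := cont_fromW a0 cC.
exact: (cont_from_mulmx (cont_from_mulmx (cont_from_mulmx (cont_from_trmx cF) (cont_from_trmx cCa)) cCa) cF).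
Qed.

(** Symmetry is given at time 0 only. The defect [P - P^T] solves a linear equation whose
    coefficients are bounded on [[0, t]], so by Gronwall it stays zero. *)
Lemma riccati_sym t : 0 <= t -> (P t)^T = P t.
Proof.
move=> t0.
have [a a0 Ha] := bounded_fsq bA; have [s s0 Hs] := information_bounded.
have [b b0 Hb] := cont_from_fsq_bounded t (mder_cont dP).
have [q q0 Hq] := unif_pos_defP pQ; have [v v0 Hv] := unif_pos_defP pV.
pose D r := P r - (P r)^T.
have dD : mder 0 D (fun r =>
    (A r *m D r + D r *m (A r)^T) - (D r *m (S r *m P r) + (P r)^T *m (S r *m D r))).
  apply: eq_mder (mderB dP (mderT dP)) => // r r0; rewrite /D /S.
  have [sQ _] := Hq r (ltW r0); have [sV _] := Hv r (ltW r0).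
  rewrite !(trmxDE, trmxNE) !trmx_mul !trmxK sQ sV.
  rewrite !(mulmxBl, mulmxBr) !mulmxA !opprD !opprK !addrA.
  set x1 := A r *m P r; set x2 := P r *m _; set x3 := P r *m _ *m _ *m _ *m _.
  set x4 := _ *m (A r)^T; set x5 := A r *m _; set x6 := (P r)^T *m _ *m _ *m _ *m (P r)^T.
  set x7 := (P r)^T *m _ *m _ *m _ *m P r.
  by apply/matrixP => i j; rewrite !mxE; ring.
have D0 : D 0 = 0 by rewrite /D P0.1 subrr.
pose K := 2 * (2 * (a + a) + 2 * (s * b + b * s)).
have H := gronwall_fwd dD (lexx 0) t0 (K := K).
have : fsq (D t) <= 0.
  apply: le_trans (H _) _; last by rewrite D0 fsq0 mulr0.
  move=> r r0 rt.
  have hA := Ha r (ltW r0); have hS := Hs r (ltW r0); have hP := Hb r (ltW r0) rt.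
  have hD := lexx (fsq (D r)).
  have e1 := fsq_mul_le hA hD.
  have e2 : fsq (D r *m (A r)^T) <= fsq (D r) * a by apply: fsq_mul_le; rewrite ?fsq_tr.
  have e3 := fsq_mul_le hD (fsq_mul_le hS hP).
  have e4 : fsq ((P r)^T *m (S r *m D r)) <= b * (s * fsq (D r)).
    by apply: fsq_mul_le; rewrite ?fsq_tr //; exact: fsq_mul_le.
  have := fsqD_le (A r *m D r) (D r *m (A r)^T).
  have := fsqD_le (D r *m (S r *m P r)) ((P r)^T *m (S r *m D r)).
  have := fsqD_le (A r *m D r + D r *m (A r)^T) (- (D r *m (S r *m P r) + (P r)^T *m (S r *m D r))).
  by rewrite fsqN /K; lra.
move=> D_le0; have : D t == 0 by rewrite -fsq_eq0 eq_le D_le0 fsq_ge0.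
by rewrite subr_eq0 => /eqP <-.
Qed.

Lemma fdot_mulmx_sym (M : 'M[R]_n) (u v : 'cV[R]_n) : M^T = M -> fdot u (M *m v) = fdot (M *m u) v.
Proof. by move=> sM; rewrite fdot_mull sM. Qed.

(** Along the adjoint dynamics the terms in [A] cancel. The free input [eta] is a steering control
    in the upper bound on [P] and the feedback [Q C P z] in the lower bound. *)
Lemma riccati_energy a (z : R -> 'cV[R]_n) (eta : R -> 'cV[R]_p) : 0 <= a ->
  mder a z (fun t => - ((A t)^T *m z t) + (C t)^T *m eta t) ->
  der a (fun t => fdot (z t) (P t *m z t))
    (fun t => fdot (z t) (V t *m z t)
      - fdot (C t *m (P t *m z t)) (Q t *m (C t *m (P t *m z t)))
      + 2 * fdot (eta t) (C t *m (P t *m z t))).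
Proof.
move=> a0 dz.
apply: eq_der (der_fdot dz (mderM (mderW a0 dP) dz)) => // t at_.
have sP := riccati_sym (le_trans a0 (ltW at_)).
have sw (u w : 'cV[R]_n) : fdot u (P t *m w) = fdot (P t *m u) w by exact: fdot_mulmx_sym.
set y := P t *m z t.
have e1 : fdot (- ((A t)^T *m z t) + (C t)^T *m eta t) y = - fdot (z t) (A t *m y) + fdot (eta t) (C t *m y).
  by rewrite fdotDl fdotNl !fdot_mull !trmxK.
rewrite fdotDr [fdot (z t) (P t *m _)]sw -/y [fdot y (- _ + _)]fdotC e1.
rewrite !(mulmxDl, mulmxBl, mulNmx) -!mulmxA -/y !(fdotDr, fdotNr) !sw -/y.
rewrite [fdot y ((A t)^T *m _)]fdotC fdot_mull trmxK.
rewrite [fdot y ((C t)^T *m _)]fdotC fdot_mull trmxK [fdot (Q t *m _) _]fdotC.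
by ring.
Qed.

Lemma fdot_bound m (M : 'M[R]_m) (v : 'cV[R]_m) b : fsq M <= b -> 2 * fdot v (M *m v) <= (1 + b) * fsq v.
Proof.
move=> Mb; apply: le_trans (fdot_young _ _ ltr01) _; rewrite invr1 !mul1r mulrDl mul1r lerD2l.
by apply: fsq_mul_le.
Qed.

Lemma fsq_ode_step (M : 'M[R]_n) (z w : 'cV[R]_n) a b : fsq M <= a -> fsq w <= b ->
  2 * fdot z (M *m z + w) <= (1 + 2 * a) * fsq z + 2 * b.
Proof.
move=> Ma wb; apply: le_trans (fdot_young _ _ ltr01) _; rewrite invr1 !mul1r.
have := fsqD_le (M *m z) w; have := fsq_mul_le Ma (lexx (fsq z)).
by lra.
Qed.

(** Since [1 <= al], the constant forcing is absorbed by applying Gronwall to [f + be]. *)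
Lemma gronwall_forced a (f f' : R -> R) al be s t : 1 <= al -> 0 <= be ->
  der a f f' -> a <= s -> s <= t ->
  (forall r, s < r -> r <= t -> f' r <= al * f r + be) ->
  f t <= expR (al * (t - s)) * (f s + be).
Proof.
move=> al1 be0 df as_ st H.
have := gronwall_le (derD df (der_cst a be)) as_ st (c := al).
move=> /(_ _)/wrap[r sr rt|]; last by lra.
rewrite addr0; apply: le_trans (H r sr rt) _; rewrite mulrDr lerD2l.
by rewrite ler_peMl.
Qed.

Lemma pd_unitmx m (W : 'M[R]_m) c : 0 < c -> (forall v : 'cV[R]_m, c * fsq v <= fdot v (W *m v)) ->
  W \in unitmx.
Proof.
move=> c0 H; rewrite -unitmx_tr unitmxE unitfE; apply/det0P => -[v v0 vW].
have := H v^T; rewrite -(trmxK W) -trmx_mul vW trmx0 fdot0r pmulr_rle0 // => h.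
have : fsq v^T == 0 by rewrite eq_le h fsq_ge0.
by rewrite fsq_eq0 -(inj_eq (@trmx_inj _ _ _)) trmxK trmx0 (negPf v0).
Qed.

Lemma pd_solution_bound m (W : 'M[R]_m) (y xi : 'cV[R]_m) c : 0 < c ->
  c * fsq y <= fdot y (W *m y) -> W *m y = xi -> fsq y <= c^-1 ^+ 2 * fsq xi.
Proof.
move=> c0 H e; rewrite e in H; have := fdot_young y xi c0 => h.
have h2 : c * fsq y <= c^-1 * fsq xi by lra.
by rewrite expr2 -mulrA -ler_pdivrMl ?invr_gt0 // invrK.
Qed.

(** * Two-sided bounds on the Riccati solution and decay of the estimation error *)

Hypothesis obs : unif_observable A C.

(** The transition matrix fed to [obs] is [X s *m Y t], from the fundamental matrix and its inverse.
    The integral becomes any antiderivative [G] vanishing at [t], and the averaging factor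
    [delta^-1] is absorbed into [c]. *)
Lemma observability_gramian : exists X Y : R -> 'M[R]_n, exists delta c : R,
  [/\ mder 0 X (fun t => A t *m X t), mder 0 Y (fun t => - (Y t *m A t)),
      forall t, 0 <= t -> Y t *m X t = 1%:M /\ X t *m Y t = 1%:M &
  [/\ 0 < delta, 0 < c & forall t G, 0 <= t ->
    mder t G (fun s => (X s *m Y t)^T *m (C s)^T *m C s *m (X s *m Y t)) -> G t = 0 ->
    forall v : 'cV[R]_n, c * fsq v <= fdot v (G (t + delta) *m v)]].
Proof.
have [X [Y [dX dY XY]]] := fundamental_matrix cA.
have [|delta [mu [d0 [m0 H]]]] := obs (Phi := fun s t => X s *m Y t).
  move=> t t0; split; first by have [] := XY t t0.
  have d := mderMr (Y t) dX; split; first exact: mder_cont d.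
  move=> s s0; rewrite mulmxA; have [_] := (mderP _ _ _).1 d; exact.
exists X, Y, delta, (delta * mu); split=> //; split=> //; first by rewrite mulr_gt0.
move=> t G t0 dG G0 v; have := H t t0 v; rewrite qform1 qformE -scalemxAl fdotZr.
rewrite ler_pdivlMl // mulrA; congr (_ <= fdot v (_ *m v)).
have cX := mder_cont (mderMr (Y t) dX).
have cF : cont_from t (fun s => (X s *m Y t)^T *m (C s)^T *m C s *m (X s *m Y t)).
  exact: cont_from_gram t0 (cont_fromW t0 cX).
apply/matrixP => i j; rewrite mxE (Rintegral_der _ _ (dG i j)) ?ltrDl //.
  by rewrite G0 [X in _ - X]mxE subr0.
exact: (cont_from_mxP _ _).1 cF i j.
Qed.

(* The adjoint state is steered from [0] at time [t - d] to [v] at time [t] by the input [C F y]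
   read off the inverse observability Gramian; completing the square in the Riccati equation bounds
   [v^T P(t) v] by the cost of this input. *)
Lemma riccati_upper_late : exists d pbar : R, [/\ 0 < d, 0 < pbar &
  forall t (v : 'cV[R]_n), d <= t -> fdot v (P t *m v) <= pbar * fsq v].
Proof.
have [X [Y [delta [c [dX dY XY [d0 c0 obsG]]]]]] := observability_gramian.
have [a a0 Ha] := bounded_fsq bA; have [b b0 Hb] := bounded_fsq bC.
have [q q0 Hq] := unif_pos_defP pQ; have [v0 v00 Hv0] := bounded_fsq bV.
(* On the window, [phi] bounds the transition matrix; [etab] and [zb] bound the input and the
   adjoint state relative to [fsq v]; [m] bounds the cost per unit of time, its first term coming
   from [V] and its second from completing the square against [Q]. *)
pose phi := expR ((1 + a) * delta) * fsq (1%:M : 'M[R]_n).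
have phi0 : 0 <= phi by rewrite mulr_ge0 ?expR_ge0 ?fsq_ge0.
pose etab := b * phi * (c^-1 ^+ 2 * phi).
have etab0 : 0 <= etab.
  by apply: mulr_ge0; apply: mulr_ge0 => //; rewrite ?(ltW b0) ?sqr_ge0.
pose zb := expR ((1 + 2 * a) * delta) * (2 * (b * etab)).
have zb0 : 0 <= zb.
  by apply: mulr_ge0; [exact: expR_ge0|apply: mulr_ge0 => //; apply: mulr_ge0 => //; exact: ltW].
pose m := (1 + v0) * zb + q^-1 * etab.
have m0 : 0 <= m.
  apply: addr_ge0; apply: mulr_ge0 => //; first by rewrite addr_ge0 // ltW.
  by rewrite invr_ge0 ltW.
exists delta, (m * delta + 1); split=> //.
  by apply: ltr_wpDl => //; apply: mulr_ge0 => //; exact: ltW.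
move=> t v dt; set s := t - delta; have s0 : 0 <= s by rewrite subr_ge0.
have sd : s + delta = t by rewrite subrK.
have st : s <= t by rewrite -sd lerDl ltW.
have t0 := le_trans s0 st.
pose F r := X r *m Y s; pose Psi r := (Y r)^T *m (X s)^T.
have dF : mder s F (fun r => A r *m F r).
  by apply: eq_mder (mderMr (Y s) (mderW s0 dX)) => // r _; rewrite mulmxA.
have dPsi : mder s Psi (fun r => - ((A r)^T *m Psi r)).
  apply: eq_mder (mderMr (X s)^T (mderT (mderW s0 dY))) => // r _.
  by rewrite trmxNE trmx_mul mulNmx mulmxA.
have PsiF r : 0 <= r -> Psi r *m (F r)^T = 1%:M.
  move=> r0; rewrite /Psi /F trmx_mul mulmxA -(mulmxA _ (X s)^T) -trmx_mul.
  by rewrite (XY s s0).1 trmx1 mulmx1 -trmx_mul (XY r r0).2 trmx1.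
have cF : cont_from s (fun r => (F r)^T *m (C r)^T *m C r *m F r).
  exact: cont_from_gram s0 (mder_cont dF).
have [G dG Gs] := mx_antiderivative 0 cF.
have HG := obsG s G s0 dG Gs; rewrite sd in HG.
have WU := pd_unitmx c0 HG.
pose xi := (F t)^T *m v; pose y := invmx (G t) *m xi.
have Wy : G t *m y = xi by rewrite /y mulmxA mulmxV // mul1mx.
(* As [Psi] solves the adjoint equation and [Psi r *m (F r)^T = 1%:M], differentiating [G] produces
   exactly the input [(C r)^T *m eta r], and [z t = Psi t *m xi = v]. *)
pose eta r := C r *m (F r *m y); pose z r := Psi r *m (G r *m y).
have dz : mder s z (fun r => - ((A r)^T *m z r) + (C r)^T *m eta r).
  apply: eq_mder (mderM dPsi (mderMr y dG)) => // r sr.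
  rewrite mulNmx /z /eta !mulmxA; congr (_ + _).
  by rewrite PsiF ?mul1mx // (le_trans s0) // ltW.
have Fb r : s <= r -> r <= t -> fsq (F r) <= phi.
  move=> sr rt; have := gronwall_fwd dF (lexx s) sr (K := a).
  move=> /(_ _)/wrap[u su ur|h].
    by apply: fsq_mul_le => //; rewrite Ha // (le_trans s0) // ltW.
  apply: le_trans h _; rewrite [F s]/F (XY s s0).2 ler_wpM2r ?fsq_ge0 // ler_expR.
  by rewrite ler_wpM2l ?addr_ge0 ?(ltW a0) // lerBlDl sd.
have yb : fsq y <= c^-1 ^+ 2 * phi * fsq v.
  apply: le_trans (pd_solution_bound c0 (HG y) Wy) _; rewrite -mulrA ler_wpM2l ?sqr_ge0 //.
  by apply: fsq_mul_le; rewrite ?fsq_tr ?Fb.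
have etaB r : s <= r -> r <= t -> fsq (eta r) <= etab * fsq v.
  move=> sr rt; have r0 := le_trans s0 sr.
  have -> : etab * fsq v = b * (phi * (c^-1 ^+ 2 * phi * fsq v)) by rewrite /etab; ring.
  by apply: fsq_mul_le; [exact: Hb|apply: fsq_mul_le => //; exact: Fb].
have zB r : s <= r -> r <= t -> fsq (z r) <= zb * fsq v.
  move=> sr rt.
  have al1 : 1 <= 1 + 2 * a by rewrite lerDl mulr_ge0 // ltW.
  have be0 : 0 <= 2 * (b * (etab * fsq v)).
    apply: mulr_ge0 => //; apply: mulr_ge0; first exact: ltW.
    by apply: mulr_ge0 => //; exact: fsq_ge0.
  have := gronwall_forced al1 be0 (der_fsq dz) (lexx s) sr.
  move=> /(_ _)/wrap[u su ur|].
    rewrite -mulNmx; apply: fsq_ode_step; have u0 := le_trans s0 (ltW su).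
      by rewrite fsqN fsq_tr Ha.
    by apply: fsq_mul_le; [rewrite fsq_tr Hb|apply: etaB; [exact: ltW|exact: le_trans rt]].
  rewrite [z s]/z Gs mul0mx mulmx0 fsq0 add0r => h; apply: le_trans h _.
  have -> : zb * fsq v = expR ((1 + 2 * a) * delta) * (2 * (b * (etab * fsq v))).
    by rewrite /zb; ring.
  rewrite ler_wpM2r // ler_expR ler_wpM2l //; first exact: le_trans al1.
  by rewrite lerBlDl sd.
have en := riccati_energy s0 dz.
have := der_le (derB en (derZ (m * fsq v) (der_id s))) (lexx s) st.
move=> /(_ _)/wrap[r sr rt|].
  have r0 := le_trans s0 (ltW sr); have [_ Qr] := Hq r r0.
  set ze := C r *m _; have := Qr ze.
  have := fdot_young ze (eta r) q0; rewrite (fdotC ze (eta r)).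
  have := fdot_bound (z r) (Hv0 r r0).
  have hz := zB r (ltW sr) rt.
  have h1 : (1 + v0) * fsq (z r) <= (1 + v0) * (zb * fsq v).
    by rewrite ler_wpM2l ?addr_ge0 // ltW.
  have h2 : q^-1 * fsq (eta r) <= q^-1 * (etab * fsq v).
    by rewrite ler_wpM2l ?invr_ge0 ?(ltW q0) // etaB // ltW.
  have h3 : 0 <= (1 + v0) * (zb * fsq v).
    apply: mulr_ge0; first by rewrite addr_ge0 // ltW.
    by apply: mulr_ge0 => //; exact: fsq_ge0.
  by rewrite /m; lra.
have zt : z t = v by rewrite /z Wy /xi mulmxA PsiF // mul1mx.
rewrite zt [z s]/z Gs mul0mx mulmx0 mulmx0 fdot0r => h.
have := fsq_ge0 v; have : t - s = delta by rewrite /s; ring.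
move=> e; have -> : t = s + delta by rewrite sd.
rewrite sd; have : m * fsq v * t - m * fsq v * s = m * delta * fsq v by rewrite -e; ring.
by lra.
Qed.

(** Before time [d] no full observation window has elapsed; there continuity of [P] on a compact
    interval gives the bound. *)
Lemma riccati_upper : exists2 pbar, 0 < pbar &
  forall t (v : 'cV[R]_n), 0 <= t -> fdot v (P t *m v) <= pbar * fsq v.
Proof.
have [d [p1 [d0 p10 H1]]] := riccati_upper_late.
have [b b0 Hb] := cont_from_fsq_bounded d (mder_cont dP).
exists (p1 + (1 + b)) => [|t v t0]; first by rewrite ltr_wpDr // addr_ge0.
have v0 := fsq_ge0 v; rewrite mulrDl.
have [dt|td] := leP d t.
  apply: ler_wpDr; last exact: H1.
  by rewrite mulr_ge0 ?addr_ge0.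
have := fdot_bound v (Hb t t0 (ltW td)).
have : 0 <= p1 * fsq v by rewrite mulr_ge0 // ltW.
have : 0 <= b * fsq v by rewrite mulr_ge0.
by rewrite mulrDl; lra.
Qed.

(* The adjoint of the closed-loop filter matrix [A - P S]: along its solutions the quadratic form
   of [P] is nondecreasing. *)
Let B t := - (A t)^T + S t *m P t.

Lemma adjoint_cont : cont_from 0 B.
Proof.
apply: cont_fromD; first by apply: cont_fromN; exact: cont_from_trmx.
by apply: cont_from_mulmx; [exact: information_cont|exact: mder_cont dP].
Qed.

Lemma adjoint_energy (z : R -> 'cV[R]_n) : mder 0 z (fun t => B t *m z t) ->
  exists2 f', der 0 (fun t => fdot (z t) (P t *m z t)) f' &
    forall t, 0 < t -> fdot (z t) (V t *m z t) <= f' t.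
Proof.
move=> dz; pose eta t := Q t *m (C t *m (P t *m z t)).
have dz' : mder 0 z (fun t => - ((A t)^T *m z t) + (C t)^T *m eta t).
  by apply: eq_mder dz => // t _; rewrite /B /eta /S mulmxDl mulNmx !mulmxA.
eexists; first exact: riccati_energy dz'.
move=> t t0; have [q q0 /(_ t (ltW t0))[_ /(_ (C t *m (P t *m z t)))]] := unif_pos_defP pQ.
set w := C t *m _; rewrite /= (fdotC (eta t)) -/w => h.
have := mulr_ge0 (ltW q0) (fsq_ge0 w).
by rewrite /eta -/w; lra.
Qed.

Lemma adjoint_solution t (v : 'cV[R]_n) : 0 <= t ->
  exists2 z : R -> 'cV[R]_n, mder 0 z (fun s => B s *m z s) & z t = v.
Proof.
move=> t0; have [X [Y [dX _ XY]]] := fundamental_matrix adjoint_cont.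
exists (fun s => X s *m (Y t *m v)); last by rewrite mulmxA (XY t t0).2 mul1mx.
by apply: eq_mder (mderMr (Y t *m v) dX) => // s _; rewrite -mulmxA.
Qed.

(** Every vector at time [t] is the end of an adjoint solution, along which the form increases from
    its nonnegative value at time 0. *)
Lemma riccati_psd t (v : 'cV[R]_n) : 0 <= t -> 0 <= fdot v (P t *m v).
Proof.
move=> t0; have [z dz zt] := adjoint_solution v t0.
have [f' df Hf] := adjoint_energy dz.
have h := der_ge df (lexx 0) t0; rewrite -zt; apply: le_trans (h _).
  have [->|z0] := eqVneq (z 0) 0; first by rewrite mulmx0 fdot0r.
  by rewrite -qformE; apply: ltW; exact: P0.2.
move=> r r0 _; apply: le_trans (Hf r r0).
have [c c0 /(_ r (ltW r0))[_ H]] := unif_pos_defP pV.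
by apply: le_trans (H _); rewrite mulr_ge0 ?fsq_ge0 // ltW.
Qed.

Lemma fsq_delta m (i : 'I_m) : fsq (delta_mx i 0 : 'cV[R]_m) = 1.
Proof.
rewrite fsq_sum (bigD1 i) //= big_ord1 mxE !eqxx expr1n big1 ?addr0 // => j ji.
by rewrite big_ord1 mxE (negPf ji) expr0n.
Qed.

Lemma fdot_delta m1 m2 (M : 'M[R]_(m1, m2)) i j :
  fdot (delta_mx i 0 : 'cV[R]_m1) (M *m (delta_mx j 0 : 'cV[R]_m2)) = M i j.
Proof.
rewrite -colE /fdot (bigD1 i) //= big_ord1 !mxE !eqxx mul1r big1 ?addr0 // => k ki.
by rewrite big_ord1 mxE (negPf ki) mul0r.
Qed.

(** Polarization: semidefiniteness and the upper bound on the form control each entry. *)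
Lemma riccati_bounded : exists2 b, 0 < b & forall t, 0 <= t -> fsq (P t) <= b.
Proof.
have [pb pb0 H] := riccati_upper; apply: bounded_fsq; exists pb => t t0.
apply: mx_norm_le; first exact: ltW.
move=> i j; set ei : 'cV[R]_n := delta_mx i 0; set ej : 'cV[R]_n := delta_mx j 0.
have e : 4 * P t i j = fdot (ei + ej) (P t *m (ei + ej)) - fdot (ei - ej) (P t *m (ei - ej)).
  rewrite !(mulmxDr, mulmxN) !(fdotDl, fdotDr, fdotNl, fdotNr).
  have -> : fdot ej (P t *m ei) = fdot ei (P t *m ej).
    by rewrite fdot_mulmx_sym ?riccati_sym // fdotC.
  by rewrite -(fdot_delta (P t) i j) -/ei -/ej; ring.
have h1 := riccati_psd (ei + ej) t0; have h2 := riccati_psd (ei - ej) t0.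
have h3 := H t (ei + ej) t0; have h4 := H t (ei - ej) t0.
have h5 : pb * fsq (ei + ej) <= pb * 4.
  by rewrite ler_wpM2l ?(ltW pb0) //; have := fsqD_le ei ej; rewrite !fsq_delta; lra.
have h6 : pb * fsq (ei - ej) <= pb * 4.
  by rewrite ler_wpM2l ?(ltW pb0) //; have := fsqD_le ei (- ej); rewrite fsqN !fsq_delta; lra.
by rewrite ler_norml; apply/andP; split; lra.
Qed.

(** Coercivity without compactness of the sphere: testing the form on [pb *: v - u], where
    [u = P 0 *m v], gives [fsq u <= pb * fdot v u], and invertibility of [P 0] bounds [fsq v] by
    [fsq u]. *)
Lemma initial_lower : exists2 l, 0 < l & forall v : 'cV[R]_n, l * fsq v <= fdot v (P 0 *m v).
Proof.
have [pb pb0 H] := riccati_upper.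
have psd (v : 'cV[R]_n) : 0 <= fdot v (P 0 *m v) by exact: riccati_psd.
have W : P 0 \in unitmx.
  rewrite -unitmx_tr unitmxE unitfE; apply/det0P => -[v v0 vP].
  have vT0 : v^T != 0 by rewrite -(inj_eq (@trmx_inj _ _ _)) trmxK trmx0.
  have := P0.2 v^T vT0; rewrite /qform trmxK -mulmxA -{1}P0.1.
  by rewrite mulmxA vP mul0mx mxE ltxx.
pose k := fsq (invmx (P 0)) + 1; have k0 : 0 < k by rewrite ltr_wpDl ?fsq_ge0.
exists (k * pb)^-1 => [|v]; first by rewrite invr_gt0 mulr_gt0.
rewrite ler_pdivrMl ?mulr_gt0 //; set u := P 0 *m v.
have hu : fsq u <= pb * fdot v u.
  have := psd (pb *: v - u); rewrite mulmxBr -scalemxAr !(fdotBl, fdotBr, fdotZl, fdotZr).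
  rewrite -/u (fdot_mulmx_sym v u) ?P0.1 // -/u -!/(fsq _) => h.
  have h2 := H 0 u (lexx 0).
  have : 0 <= pb * (pb * fdot v u - fsq u) by move: (h) h2; lra.
  by rewrite pmulr_rge0 // subr_ge0.
have hv : fsq v <= k * fsq u.
  have -> : v = invmx (P 0) *m u by rewrite /u mulmxA mulVmx // mul1mx.
  apply: le_trans (fsq_mul _ _) _.
  by rewrite ler_wpM2r ?fsq_ge0 // lerDl.
apply: le_trans hv _; rewrite -mulrA ler_wpM2l // ltW //.
Qed.

(** For [pl] small against [V], the form of [P] minus [pl * fsq z] is nondecreasing along adjoint
    solutions, and [pl <= l] makes it nonnegative at time 0. *)
Lemma riccati_lower : exists2 pl, 0 < pl &
  forall t (v : 'cV[R]_n), 0 <= t -> pl * fsq v <= fdot v (P t *m v).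
Proof.
have [l l0 Hl] := initial_lower; have [c c0 Hc] := unif_pos_defP pV.
have [a a0 Ha] := bounded_fsq bA; have [s s0 Hs] := information_bounded.
have [b b0 Hb] := riccati_bounded.
pose L := 2 * (a + s * b); have L0 : 0 < L by rewrite mulr_gt0 ?addr_gt0 ?mulr_gt0.
have HB t : 0 <= t -> fsq (B t) <= L.
  move=> t0; apply: le_trans (fsqD_le _ _) _; rewrite fsqN fsq_tr.
  have := Ha t t0; have := fsq_mul_le (Hs t t0) (Hb t t0); rewrite /L; lra.
pose pl := Num.min l (c / (1 + L)).
have pl0 : 0 < pl by rewrite lt_min l0 divr_gt0 // addr_gt0.
exists pl => // t v t0; have [z dz zt] := adjoint_solution v t0.
have [f' df Hf] := adjoint_energy dz.
have := der_ge (derB df (derZ pl (der_fsq dz))) (lexx 0) t0.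
move=> /(_ _)/wrap[r r0 rt|].
  have [_ /(_ (z r)) h1] := Hc r (ltW r0); have h2 := Hf r r0.
  have h3 := fdot_bound (z r) (HB r (ltW r0)).
  have h4 : pl * (2 * fdot (z r) (B r *m z r)) <= c * fsq (z r).
    apply: (@le_trans _ _ (pl * ((1 + L) * fsq (z r)))).
      by rewrite ler_wpM2l // ltW.
    rewrite mulrA ler_wpM2r ?fsq_ge0 // -ler_pdivlMr ?addr_gt0 //.
    by rewrite ge_min lexx orbT.
  by lra.
rewrite zt => h.
have : pl * fsq (z 0) <= fdot (z 0) (P 0 *m z 0).
  by apply: le_trans (Hl _); rewrite ler_wpM2r ?fsq_ge0 // ge_min lexx.
by lra.
Qed.

(* Duality: the adjoint solution [z] ending at [x t] has [z . x] constant while [z^T P z] grows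
   exponentially, which avoids differentiating [P^-1]. *)
Theorem riccati_decay : exists k lam : R, [/\ 0 < k, 0 < lam &
  forall t0 (x : R -> 'cV[R]_n), 0 <= t0 ->
    mder t0 x (fun t => A t *m x t - P t *m (C t)^T *m Q t *m (C t *m x t)) ->
    forall t, t0 <= t -> fsq (x t) <= k * expR (- lam * (t - t0)) * fsq (x t0)].
Proof.
have [pb pb0 Hpb] := riccati_upper; have [pl pl0 Hpl] := riccati_lower.
have [c c0 Hc] := unif_pos_defP pV.
exists (pb / pl), (c / pb); split; rewrite ?divr_gt0 // => t0 x t00 dx t tt.
have t_0 := le_trans t00 tt; have [z dz zt] := adjoint_solution (x t) t_0.
have [q q0 Hq] := unif_pos_defP pQ.
have dzx : der t0 (fun s => fdot (z s) (x s)) (fun=> 0).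
  apply: eq_der (der_fdot (mderW t00 dz) dx) => // s s0; rewrite /B.
  have s_0 := le_trans t00 (ltW s0).
  rewrite mulmxDl mulNmx fdotDl fdotNl fdotBr !fdot_mull trmxK.
  rewrite /S !trmx_mul trmxK riccati_sym // (Hq s s_0).1 !mulmxA.
  by ring.
have zx : fdot (z t0) (x t0) = fsq (x t).
  have [s _] := der_MVT dzx (lexx t0) tt; rewrite mul0r zt => /eqP.
  by rewrite subr_eq0 => /eqP.
have [f' df Hf] := adjoint_energy dz.
have := gronwall_ge df t00 tt (c := c / pb).
move=> /(_ _)/wrap[r r0 rt|].
  have r_0 : 0 < r := le_lt_trans t00 r0.
  apply: le_trans (Hf r r_0); have [_ Hr] := Hc r (ltW r_0); apply: le_trans (Hr _).
  by rewrite -mulrA ler_wpM2l ?(ltW c0) // ler_pdivrMl // Hpb // ltW.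
rewrite zt; set e := expR _ => h.
have e0 : 0 < e by exact: expR_gt0.
have h1 := Hpb t (x t) t_0; have h2 := Hpl t0 (z t0) t00.
(* This bounds the square of [fsq (x t)] by [fsq (z t0) * fsq (x t0)]. The factor [fsq (z t0)] is
   exponentially small relative to [fsq (x t)], and one power of [fsq (x t)] is cancelled. *)
have CS := fdot_CS (z t0) (x t0); rewrite zx in CS.
have hz : e * (pl * fsq (z t0)) <= pb * fsq (x t).
  by apply: le_trans h1; apply: le_trans h; rewrite ler_wpM2l // ltW.
have x0 := fsq_ge0 (x t0); have [xt0|xt0] := eqVneq (fsq (x t)) 0.
  by rewrite xt0 !mulr_ge0 ?expR_ge0 ?invr_ge0 // ltW.
have xt : 0 < fsq (x t) by rewrite lt_def xt0 fsq_ge0.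
have -> : expR (- (c / pb) * (t - t0)) = e^-1 by rewrite mulNr expRN.
rewrite -(ler_pM2l xt) -expr2; apply: le_trans CS _.
have hz2 : fsq (z t0) <= pb / pl * e^-1 * fsq (x t).
  rewrite -(ler_pM2l (mulr_gt0 e0 pl0)) -mulrA; apply: le_trans hz _.
  rewrite le_eqVlt; apply/orP; left; apply/eqP; field.
  by rewrite !gt_eqF.
apply: le_trans (ler_wpM2r x0 hz2) _.
by rewrite le_eqVlt; apply/orP; left; apply/eqP; ring.
Qed.

End Riccati.

(** * Rotations in dimension three *)

Section Dim3.
Context {R : realType}.

Lemma ord3P (i : 'I_3) : [\/ i = inord 0, i = inord 1 | i = inord 2].
Proof.
case: i => -[|[|[|//]]] h; [apply: Or31|apply: Or32|apply: Or33];
  by apply/val_inj; rewrite /= inordK.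
Qed.

Lemma big_ord3 (F : 'I_3 -> R) : \sum_i F i = F (inord 0) + F (inord 1) + F (inord 2).
Proof.
rewrite !big_ord_recr big_ord0 /= add0r.
by congr (F _ + F _ + F _); apply/val_inj; rewrite /= inordK.
Qed.

Lemma inord3_neq :
  (((inord 0 == inord 1 :> 'I_3) = false)%R *
  ((inord 0 == inord 2 :> 'I_3) = false)%R *
  ((inord 1 == inord 0 :> 'I_3) = false)%R *
  ((inord 1 == inord 2 :> 'I_3) = false)%R *
  ((inord 2 == inord 0 :> 'I_3) = false)%R *
  ((inord 2 == inord 1 :> 'I_3) = false)%R)%type.
Proof. by do !split; rewrite -(inj_eq val_inj) /= !inordK. Qed.

Lemma skewE (x : 'cV[R]_3) :
  ((skew x (inord 0) (inord 0) = 0)%R *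
  (skew x (inord 0) (inord 1) = - x (inord 2) 0)%R *
  (skew x (inord 0) (inord 2) = x (inord 1) 0)%R *
  (skew x (inord 1) (inord 0) = x (inord 2) 0)%R *
  (skew x (inord 1) (inord 1) = 0)%R *
  (skew x (inord 1) (inord 2) = - x (inord 0) 0)%R *
  (skew x (inord 2) (inord 0) = - x (inord 1) 0)%R *
  (skew x (inord 2) (inord 1) = x (inord 0) 0)%R *
  (skew x (inord 2) (inord 2) = 0)%R)%type.
Proof. by do !split; rewrite mxE !inordK. Qed.

Lemma psiE (A : 'M[R]_3) :
  ((psi_a A (inord 0) 0 = 2^-1 * (A (inord 2) (inord 1) - A (inord 1) (inord 2)))%R *
  (psi_a A (inord 1) 0 = 2^-1 * (A (inord 0) (inord 2) - A (inord 2) (inord 0)))%R *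
  (psi_a A (inord 2) 0 = 2^-1 * (A (inord 1) (inord 0) - A (inord 0) (inord 1)))%R)%type.
Proof. by do !split; rewrite !mxE inordK //= !mxE. Qed.

Lemma entry_tr m n (A : 'M[R]_(m, n)) i j : A^T i j = A j i.
Proof. by rewrite mxE. Qed.

Lemma entryN m n (A : 'M[R]_(m, n)) i j : (- A) i j = - A i j.
Proof. by rewrite mxE. Qed.

Lemma entryD m n (A B : 'M[R]_(m, n)) i j : (A + B) i j = A i j + B i j.
Proof. by rewrite mxE. Qed.

Lemma entryZ m n c (A : 'M[R]_(m, n)) i j : (c *: A) i j = c * A i j.
Proof. by rewrite mxE. Qed.

Lemma entryM3 m n (A : 'M[R]_(m, 3)) (B : 'M[R]_(3, n)) i j : (A *m B) i j =
  A i (inord 0) * B (inord 0) j + A i (inord 1) * B (inord 1) j + A i (inord 2) * B (inord 2) j.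
Proof. by rewrite mxE big_ord3. Qed.

Lemma entry1 i j : (1%:M : 'M[R]_3) i j = (i == j)%:R.
Proof. by rewrite mxE. Qed.

(** After case analysis on the indices by [ord3P], this reduces matrix identities to polynomial
    ones. *)
Definition entryE := (entry_tr, entryN, entryD, entryZ, entryM3, entry1, skewE, psiE, inord3_neq, eqxx).

Lemma skew_tr (x : 'cV[R]_3) : (skew x)^T = - skew x.
Proof.
apply/matrixP => i j.
by case: (ord3P i) => ->; case: (ord3P j) => ->; rewrite !entryE ?opprK ?oppr0.
Qed.

Lemma fsq_skew (x : 'cV[R]_3) : fsq (skew x) = 2 * fsq x.
Proof. by rewrite !fsq_sum !big_ord3 !big_ord1 !skewE; ring. Qed.

Lemma skewB (x y : 'cV[R]_3) : skew (x - y) = skew x - skew y.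
Proof.
apply/matrixP => i j.
by case: (ord3P i) => ->; case: (ord3P j) => ->; rewrite !entryE; ring.
Qed.

Lemma skew_psi (A : 'M[R]_3) : skew (psi_a A) = 2^-1 *: (A - A^T).
Proof.
apply/matrixP => i j.
by case: (ord3P i) => ->; case: (ord3P j) => ->; rewrite !entryE; ring.
Qed.

Lemma fsq_psi (A : 'M[R]_3) : fsq (A - A^T) = 8 * fsq (psi_a A).
Proof.
have -> : A - A^T = 2 *: skew (psi_a A) by rewrite skew_psi scalerA divff // scale1r.
by rewrite fsqZ fsq_skew; ring.
Qed.

Lemma fsq_psi_le (A : 'M[R]_3) : fsq (psi_a A) <= fsq A.
Proof.
have := fsqD_le A (- A^T); rewrite fsq_psi fsqN fsq_tr; have := fsq_ge0 A.
by lra.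
Qed.

Lemma mder_psi a (F F' : R -> 'M[R]_3) : mder a F F' ->
  mder a (fun t => psi_a (F t)) (fun t => psi_a (F' t)).
Proof.
move=> dF i j; rewrite ord1.
have H k l m : (forall A : 'M[R]_3, psi_a A m 0 = 2^-1 * (A k l - A l k)) ->
    der a (fun t => psi_a (F t) m 0) (fun t => psi_a (F' t) m 0).
  by move=> e; apply: eq_der (derZ 2^-1 (derB (dF k l) (dF l k))) => t; rewrite e.
by case: (ord3P i) => ->; apply: H => A; rewrite psiE.
Qed.

Lemma fdot_skew (A : 'M[R]_3) (u : 'cV[R]_3) : fdot A^T (skew u) = - (2 * fdot (psi_a A) u).
Proof. by rewrite /fdot !big_ord3 !big_ord1 !entryE; field. Qed.

Lemma det3 (A : 'M[R]_3) : \det A =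
  A (inord 0) (inord 0) * (A (inord 1) (inord 1) * A (inord 2) (inord 2) - A (inord 1) (inord 2) * A (inord 2) (inord 1))
  - A (inord 0) (inord 1) * (A (inord 1) (inord 0) * A (inord 2) (inord 2) - A (inord 1) (inord 2) * A (inord 2) (inord 0))
  + A (inord 0) (inord 2) * (A (inord 1) (inord 0) * A (inord 2) (inord 1) - A (inord 1) (inord 1) * A (inord 2) (inord 0)).
Proof.
have e00 : ord0 = inord 0 :> 'I_3 by apply/val_inj; rewrite /= inordK.
have l h k (j : 'I_2) : (h < 3)%N -> (k < 3)%N -> bump h j = k -> lift (inord h : 'I_3) j = inord k.
  by move=> h3 k3 e; apply/val_inj; rewrite /= !inordK ?e.
have l0 := l 0 1 ord0 isT isT erefl; have l1 := l 0 2 (lift ord0 0) isT isT erefl.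
have l2 := l 1 0 ord0 isT isT erefl; have l3 := l 1 2 (lift ord0 0) isT isT erefl.
have l4 := l 2 0 ord0 isT isT erefl; have l5 := l 2 1 (lift ord0 0) isT isT erefl.
have l6 : lift (lift ord0 ord0 : 'I_2) 0 = ord0 by apply/val_inj.
have l7 : lift ord0 ord0 = lift ord0 0 :> 'I_2 by apply/val_inj.
rewrite (expand_det_row _ (inord 0)) big_ord3 /cofactor.
rewrite !(expand_det_row _ ord0) !big_ord_recl !big_ord0 /cofactor !det_mx11 !mxE.
rewrite l6 ?l7 l0 l1 l2 l3 l4 l5 !inordK //=.
by ring.
Qed.

Lemma SO3_mulT (A : 'M[R]_3) : A^T *m A = 1%:M -> A *m A^T = 1%:M.
Proof. exact: mulmx1C. Qed.

End Dim3.

(** * Invariance of SO(3), near-diagonal rotations and the potential *)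

Section RotationDynamics.
Context {R : realType}.

Lemma fsq_orth n (A : 'M[R]_n) : A^T *m A = 1%:M -> fsq A = n%:R.
Proof. by move=> AA; rewrite /fsq fdot_tr AA mxtrace1. Qed.

Lemma fdot_comm_skew n (G S : 'M[R]_n) : S^T = - S -> fdot G (G *m S - S *m G) = 0.
Proof.
move=> sS; rewrite fdotBr.
have : fdot G (G *m S) = - fdot G (G *m S) by rewrite {1}fdotC fdot_mulr sS mulmxN fdotNr.
have : fdot G (S *m G) = - fdot G (S *m G) by rewrite {1}fdotC fdot_mull sS mulNmx fdotNr.
by lra.
Qed.

Lemma cont_from_det3 a (F : R -> 'M[R]_3) : cont_from a F -> cont_from a (fun t => \det (F t)).
Proof.
move=> /cont_from_mxP cF; under eq_fun do rewrite det3.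
have c2 i j k l : cont_from a (fun t => F t i j * F t k l) by apply: cont_fromM.
have cB i j k l i' j' k' l' : cont_from a (fun t => F t i j * F t k l - F t i' j' * F t k' l').
  by apply: cont_fromD => //; exact: cont_fromN.
by apply: cont_fromD; [apply: cont_fromD; [|apply: cont_fromN]|]; apply: cont_fromM.
Qed.

(** The defect [F^T F - 1] evolves by a commutator with a skew matrix, so its Frobenius norm is
    constant, here zero. The determinant then squares to 1, and continuity keeps its sign. *)
Lemma SO3_invariant t0 (F : R -> 'M[R]_3) (u : R -> 'cV[R]_3) :
  mder t0 F (fun t => F t *m skew (u t)) -> is_SO3 (F t0) ->
  forall t, t0 <= t -> is_SO3 (F t).
Proof.
move=> dF [orth0 det0].
have orth t : t0 <= t -> (F t)^T *m F t = 1%:M.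
  move=> tt; pose G s := (F s)^T *m F s - 1%:M.
  have dG : mder t0 G (fun s => G s *m skew (u s) - skew (u s) *m G s).
    apply: eq_mder (mderB (mderM (mderT dF) dF) (mder_cst 1%:M)) => // s _.
    rewrite /G trmx_mul skew_tr mulmxBl mulmxBr mul1mx mulmx1 subr0 -!mulmxA !mulNmx.
    by rewrite opprB addrA subrK addrC.
  have [s _] := der_MVT (der_fsq dG) (lexx t0) tt.
  rewrite fdot_comm_skew ?skew_tr // mulr0 mul0r {2}/G orth0 subrr fsq0 subr0 => /eqP.
  by rewrite fsq_eq0 subr_eq0 => /eqP.
move=> t tt; split; first exact: orth.
have sq s : t0 <= s -> \det (F s) ^+ 2 = 1.
  by move=> ss; rewrite expr2 -{1}det_tr -det_mulmx orth // det1.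
have dp : 0 < \det (F t).
  apply: (cont_from_pos (cont_from_det3 (mder_cont dF))) tt; last by rewrite det0.
  by move=> s ss; rewrite -sqrf_eq0 sq // oner_eq0.
by apply/eqP; rewrite -(@eqrXn2 _ 2) ?ltW // sq // expr1n.
Qed.

Context {rho : 'I_3 -> R} {rm rM : R}.
Hypotheses (rm0 : 0 < rm) (rhom : forall i, rm <= rho i) (rhoM : forall i, rho i <= rM).
Hypothesis rho_inj : forall i j, i != j -> rho i != rho j.

Let M : 'M[R]_3 := diag_mx (\row_i rho i).

Let rho0 i : 0 < rho i. Proof. exact: lt_le_trans (rhom i). Qed.
Let rM0 : 0 < rM. Proof. exact: lt_le_trans (rho0 (inord 0)) (rhoM _). Qed.

Lemma entry_diag_mulmx (A : 'M[R]_3) i j : (M *m A) i j = rho i * A i j.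
Proof. by rewrite mul_diag_mx !mxE. Qed.

Lemma entry_mulmx_diag (A : 'M[R]_3) i j : (A *m M) i j = A i j * rho j.
Proof. by rewrite mul_mx_diag !mxE. Qed.

(** The candidate limit of an almost diagonal orthogonal matrix; its determinant may still be -1. *)
Definition signmx (A : 'M[R]_3) : 'M[R]_3 :=
  diag_mx (\row_i (if 0 <= A i i then 1 else -1)).

Lemma signmxE A i j : signmx A i j = (if 0 <= A i i then 1 else -1) *+ (i == j).
Proof. by rewrite !mxE. Qed.

Lemma orth_row (A : 'M[R]_3) i : A^T *m A = 1%:M -> \sum_j A i j ^+ 2 = 1.
Proof.
move=> /SO3_mulT/matrixP/(_ i i); rewrite !mxE eqxx mulr1n => <-.
by apply: eq_bigr => j _; rewrite mxE expr2.
Qed.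

Lemma orth_entry (A : 'M[R]_3) i j : A^T *m A = 1%:M -> A i j ^+ 2 <= 1.
Proof.
move=> AA; rewrite -(orth_row i AA) (bigD1 j) //= lerDl.
by apply: sumr_ge0 => k _; exact: sqr_ge0.
Qed.

(* With [B = M A], orthogonality gives [B B^T = M^2], i.e. [B^2 = M^2 + B S] for the skew part [S
   = B - B^T]; hence [B] almost commutes with [M^2], which has distinct eigenvalues. *)
Lemma near_diagonal : exists2 c, 0 < c & forall A : 'M[R]_3, A^T *m A = 1%:M ->
  fsq (A - signmx A) <= c * fsq (psi_a (M *m A)).
Proof.
(* Inverse of the factor by which entry [(i, j)] of [A] is multiplied in the commutator of [B] with
   [M *m M]; on the diagonal this factor is 0 and so, by convention, is its inverse. *)
pose q i j := (rho i * (rho j ^+ 2 - rho i ^+ 2))^-1.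
pose K := \sum_i \sum_j q i j ^+ 2.
have K0 : 0 <= K by apply: sumr_ge0 => i _; apply: sumr_ge0 => j _; exact: sqr_ge0.
pose b := fsq M * 3; have b0 : 0 <= b by rewrite mulr_ge0 ?fsq_ge0.
have K1 : 0 <= K * (4 * b ^+ 2) := mulr_ge0 K0 (mulr_ge0 (ler0n _ 4) (sqr_ge0 b)).
exists (18 * (K * (4 * b ^+ 2) * 8) + 1); first by move: K1; lra.
move=> A AA; have AA' := SO3_mulT AA.
set B := M *m A; set S := B - B^T; set e := K * (4 * b ^+ 2) * fsq S.
have e0 : 0 <= e := mulr_ge0 K1 (fsq_ge0 S).
have hB : fsq B <= b by apply: le_trans (fsq_mul _ _) _; rewrite (fsq_orth AA).
have hT : fsq (B *m S *m B - B *m B *m S) <= 4 * b ^+ 2 * fsq S.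
  apply: le_trans (fsqD_le _ _) _; rewrite fsqN.
  have h1 := fsq_mul_le (fsq_mul_le hB (lexx (fsq S))) hB.
  have h2 := fsq_mul_le (fsq_mul_le hB hB) (lexx (fsq S)).
  by lra.
have eT : B *m S *m B - B *m B *m S = B *m (M *m M) - M *m M *m B.
  have -> : M *m M = B *m B^T.
    by rewrite /B trmx_mul tr_diag_mx mulmxA -(mulmxA M) AA' mulmx1.
  rewrite /S !(mulmxBr, mulmxBl) !mulmxA opprB.
  by rewrite addrC addrA subrK.
have off i j : i != j -> A i j ^+ 2 <= e.
  move=> ij; have := fsq_entry (B *m S *m B - B *m B *m S) i j.
  move=> /le_trans/(_ hT); rewrite eT => h.
  have -> : A i j = q i j * (B *m (M *m M) - M *m M *m B) i j.
    rewrite entryD entryN mulmxA !entry_mulmx_diag -!mulmxA !entry_diag_mulmx /q; field.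
    rewrite (gt_eqF (rho0 i)) /= subr_eq0 eqrXn2 ?ltW //.
    by apply/negPf; rewrite eq_sym rho_inj.
  rewrite exprMn /e -mulrA ler_pM ?sqr_ge0 //.
  rewrite /K (bigD1 i) //= (bigD1 j) //= -addrA lerDl addr_ge0 //.
    by apply: sumr_ge0 => l _; exact: sqr_ge0.
  by apply: sumr_ge0 => l _; apply: sumr_ge0 => l' _; exact: sqr_ge0.
have ent i j : (A - signmx A) i j ^+ 2 <= 2 * e.
  rewrite entryD entryN signmxE; case: (eqVneq i j) => [<-|ij]; last first.
    by rewrite mulr0n subr0; have := off i j ij; lra.
  have : 1 - A i i ^+ 2 <= 2 * e.
    have := orth_row i AA; rewrite big_ord3; have [[[[[n01 n02] n10] n12] n20] n21] := inord3_neq.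
    have o k l : k == l = false -> A k l ^+ 2 <= e by move=> /negbT; exact: off.
    case: (ord3P i) => ->.
    - by have := o (inord 0) (inord 1) n01; have := o (inord 0) (inord 2) n02; lra.
    - by have := o (inord 1) (inord 0) n10; have := o (inord 1) (inord 2) n12; lra.
    - by have := o (inord 2) (inord 0) n20; have := o (inord 2) (inord 1) n21; lra.
  (* For a diagonal entry [a] with [|a| <= 1], the square of [1 - |a|] is at most [1 - a ^+ 2]. *)
  have := orth_entry i i AA; rewrite mulr1n; case: ifP => s1 h1 h2.
    by have := mulr_ge0 s1 (_ : 0 <= 1 - A i i); nra.
  by move/negbT: s1; rewrite -ltNge => s1; nra.
have h18 : fsq (A - signmx A) <= 18 * e.
  rewrite fsq_sum; have -> : 18 * e = \sum_(i < 3) \sum_(j < 3) 2 * e by rewrite !big_ord3; ring.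
  by apply: ler_sum => i _; apply: ler_sum => j _; exact: ent.
apply: le_trans h18 _; rewrite /e /S fsq_psi -/B.
have := fsq_ge0 (psi_a B); lra.
Qed.

Definition flip (k : 'I_3) : 'M[R]_3 := diag_mx (\row_i (if i == k then 1 else -1)).

Lemma flipE k i j : flip k i j = (if i == k then 1 else -1) *+ (i == j).
Proof. by rewrite !mxE. Qed.

(** With off-diagonal squares at most 1/10, each of the five other products in the determinant is at
    most 1/10 in absolute value. So the product of the diagonal entries is positive, and none or
    exactly two of them are negative. *)
Lemma signmx_SO3 (A : 'M[R]_3) : is_SO3 A -> fsq (A - signmx A) <= 10^-1 ->
  signmx A = 1%:M \/ exists k, signmx A = flip k.
Proof.
move=> [AA dA] h.
have off i j : i != j -> A i j ^+ 2 <= 10^-1.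
  move=> ij; apply: le_trans h; have := fsq_entry (A - signmx A) i j.
  by rewrite entryD entryN signmxE (negPf ij) mulr0n subr0.
have p3 (x y z : R) : x ^+ 2 <= 1 -> y ^+ 2 <= 10^-1 -> z ^+ 2 <= 10^-1 -> - 10^-1 <= x * y * z <= 10^-1.
  move=> hx hy hz.
  have e1 := sqr_ge0 (x * y - z); have e2 := sqr_ge0 (x * y + z).
  have e3 : (x * y) ^+ 2 <= 10^-1.
    by rewrite exprMn; apply: le_trans hy; rewrite ler_piMl ?sqr_ge0.
  by move: e1 e2; rewrite sqrrB sqrrD => e1 e2; apply/andP; split; lra.
have ent i j := orth_entry i j AA.
have pos : 0 < A (inord 0) (inord 0) * A (inord 1) (inord 1) * A (inord 2) (inord 2).
  have [[[[[n01 n02] n10] n12] n20] n21] := inord3_neq; move: dA; rewrite det3.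
  have o i j : i == j = false -> A i j ^+ 2 <= 10^-1 by move=> /negbT; exact: off.
  have /andP[a1 b1] := p3 _ _ _ (ent (inord 0) (inord 0)) (o (inord 1) (inord 2) n12) (o (inord 2) (inord 1) n21).
  have /andP[a2 b2] := p3 _ _ _ (ent (inord 2) (inord 2)) (o (inord 0) (inord 1) n01) (o (inord 1) (inord 0) n10).
  have /andP[a3 b3] := p3 _ _ _ (ent (inord 0) (inord 1)) (o (inord 1) (inord 2) n12) (o (inord 2) (inord 0) n20).
  have /andP[a4 b4] := p3 _ _ _ (ent (inord 0) (inord 2)) (o (inord 1) (inord 0) n10) (o (inord 2) (inord 1) n21).
  have /andP[a5 b5] := p3 _ _ _ (ent (inord 1) (inord 1)) (o (inord 0) (inord 2) n02) (o (inord 2) (inord 0) n20).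
  by lra.
have E B : (forall i, (if 0 <= A i i then 1 else -1) = B i) -> signmx A = diag_mx (\row_i B i).
  by move=> eB; apply/matrixP => i j; rewrite signmxE !mxE eB.
have s0 := lerP 0 (A (inord 0) (inord 0)); have s1 := lerP 0 (A (inord 1) (inord 1)).
have s2 := lerP 0 (A (inord 2) (inord 2)).
move: pos.
have c1 : (forall i, (if 0 <= A i i then 1 else -1) = 1 :> R) -> signmx A = 1%:M.
  by move=> /E ->; apply/matrixP => i j; rewrite !mxE.
have ck k : (forall i, (if 0 <= A i i then 1 else -1) = (if i == k then 1 else -1) :> R) -> signmx A = flip k.
  by move=> /E ->.
case: (ltrgtP 0 (A (inord 0) (inord 0))) => h0; last by rewrite -h0 !mul0r ltxx.
  rewrite -mulrA pmulr_rgt0 //; case: (ltrgtP 0 (A (inord 1) (inord 1))) => h1; last by rewrite -h1 mul0r ltxx.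
    rewrite pmulr_rgt0 // => h2; left; apply: c1 => i.
    by case: (ord3P i) => ->; rewrite ltW.
  rewrite nmulr_rgt0 // => h2; right; exists (inord 0); apply: ck => i.
  by case: (ord3P i) => ->; rewrite ?inord3_neq ?eqxx ?(ltW h0) // leNgt ?h1 ?h2.
rewrite -mulrA nmulr_rgt0 //; case: (ltrgtP 0 (A (inord 1) (inord 1))) => h1; last by rewrite -h1 mul0r ltxx.
  rewrite pmulr_rlt0 // => h2; right; exists (inord 1); apply: ck => i.
  by case: (ord3P i) => ->; rewrite ?inord3_neq ?eqxx ?(ltW h1) // leNgt ?h0 ?h2.
rewrite nmulr_rlt0 // => h2; right; exists (inord 2); apply: ck => i.
by case: (ord3P i) => ->; rewrite ?inord3_neq ?eqxx ?(ltW h2) // leNgt ?h0 ?h1.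
Qed.

Definition potential (A : 'M[R]_3) : R := fdot M (1%:M - A).

Lemma potentialE A : potential A = \sum_i rho i * (1 - A i i).
Proof.
apply: eq_bigr => i _; rewrite (bigD1 i) //= big1 ?addr0 => [|j ji].
  by rewrite !mxE eqxx mulr1n.
by rewrite !mxE eq_sym (negPf ji) mulr0n mul0r.
Qed.

Lemma fsq_1B (A : 'M[R]_3) : A^T *m A = 1%:M -> fsq (1%:M - A) = 2 * \sum_i (1 - A i i).
Proof.
move=> AA; rewrite /fsq !(fdotBl, fdotBr) (fdotC A) -!/(fsq _) !fsq_orth ?trmx1 ?mul1mx //.
by rewrite fdot_tr trmx1 mul1mx /mxtrace !big_ord3; ring.
Qed.

Lemma diag_le1 (A : 'M[R]_3) i : A^T *m A = 1%:M -> A i i <= 1.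
Proof. by move=> /(orth_entry i i) => h; nra. Qed.

Lemma potential_le A : A^T *m A = 1%:M -> potential A <= rM * fsq (1%:M - A).
Proof.
move=> AA; have := fsq_ge0 (1%:M - A); rewrite fsq_1B // potentialE.
set s := \sum_i _ => s0; set x := (X in X <= _).
have : x <= rM * s.
  rewrite mulr_sumr; apply: ler_sum => i _; rewrite ler_wpM2r //.
  by rewrite subr_ge0 diag_le1.
have : 0 <= rM * (2 * s) by rewrite mulr_ge0 // ltW.
by lra.
Qed.

Lemma potential_ge A : A^T *m A = 1%:M -> rm * fsq (1%:M - A) <= 2 * potential A.
Proof.
move=> AA; rewrite fsq_1B // potentialE mulrCA ler_wpM2l // mulr_sumr.
by apply: ler_sum => i _; rewrite ler_wpM2r // subr_ge0 diag_le1.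
Qed.

Lemma potential_ge0 A : A^T *m A = 1%:M -> 0 <= potential A.
Proof.
by move=> /potential_ge; have := mulr_ge0 (ltW rm0) (fsq_ge0 (1%:M - A)); lra.
Qed.

Lemma der_potential a (F : R -> 'M[R]_3) (u : R -> 'cV[R]_3) :
  mder a F (fun t => F t *m skew (u t)) ->
  der a (fun t => potential (F t)) (fun t => 2 * fdot (psi_a (M *m F t)) (u t)).
Proof.
move=> dF; apply: eq_der (der_fdot (mder_cst M) (mderB (mder_cst 1%:M) dF)) => // t _.
rewrite (fdotC 0) fdot0r add0r sub0r fdotNr.
by rewrite -[2 * _]opprK -fdot_skew trmx_mul tr_diag_mx fdot_mull trmxK.
Qed.

End RotationDynamics.

(** * Gradient flow on SO(3) with an exponentially decaying input *)

Section RotationConvergence.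
Context {R : realType} {rho : 'I_3 -> R} {rm rM : R}.
Hypotheses (rm0 : 0 < rm) (rhom : forall i, rm <= rho i) (rhoM : forall i, rho i <= rM).
Hypothesis rho_inj : forall i j, i != j -> rho i != rho j.
Context {kR lam : R}.
Hypotheses (kR0 : 0 < kR) (lam0 : 0 < lam).

Let M : 'M[R]_3 := diag_mx (\row_i rho i).

Section Trajectory.
Context {t0 D : R} {F : R -> 'M[R]_3} {d : R -> 'cV[R]_3}.
Hypothesis D0 : 0 <= D.
Hypothesis dF : mder t0 F (fun t => F t *m skew (- (kR *: psi_a (M *m F t)) - d t)).
Hypothesis F0 : is_SO3 (F t0).
Hypothesis hd : forall t, t0 <= t -> fsq (d t) <= D * expR (- lam * (t - t0)).

Let psi t := psi_a (M *m F t).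
(** With this factor the envelope decreases at rate [2 D e / kR], where [e] is the exponential: half
    pays for the term in [d] left by Young's inequality, half remains in [lyapunov_der]. *)
Let kap := 2 / (kR * lam).
Let G t := potential (rho := rho) (F t) + kap * D * expR (- lam * (t - t0)).

Let kap0 : 0 < kap. Proof. by rewrite divr_gt0 // mulr_gt0. Qed.

Let SO t : t0 <= t -> is_SO3 (F t). Proof. exact: SO3_invariant dF F0 t. Qed.

Let OF t : t0 <= t -> (F t)^T *m F t = 1%:M. Proof. by case/SO. Qed.

Lemma lyapunov_der : exists2 G', der t0 G G' & forall t, t0 < t ->
  G' t <= - (kR * fsq (psi t)) - kR^-1 * D * expR (- lam * (t - t0)).
Proof.
eexists.
  exact: derD (der_potential (rho := rho) dF) (derZ (kap * D) (der_exp t0 (- lam) t0)).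
move=> t tt /=; rewrite -/(psi t) fdotBr fdotNr fdotZr -/(fsq _).
have := fdot_young (psi t) (- d t) kR0; rewrite fdotNr fsqN => h1.
have h2 : kR^-1 * fsq (d t) <= kR^-1 * (D * expR (- lam * (t - t0))).
  by rewrite ler_wpM2l ?invr_ge0 ?(ltW kR0) // hd // ltW.
have -> : kap * D * (- lam * expR (- lam * (t - t0))) = - (2 * (kR^-1 * (D * expR (- lam * (t - t0))))).
  by rewrite /kap; field; rewrite !gt_eqF.
by lra.
Qed.

Let eD t : 0 <= D * expR (- lam * (t - t0)).
Proof. by rewrite mulr_ge0 ?expR_ge0. Qed.

Lemma lyapunov_ge0 t : t0 <= t -> 0 <= G t.
Proof.
move=> tt; apply: addr_ge0; first exact: (potential_ge0 rm0 rhom) (OF tt).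
by rewrite -mulrA; exact: mulr_ge0 (ltW kap0) (eD t).
Qed.

Lemma lyapunov_noninc s t : t0 <= s -> s <= t -> G t <= G s.
Proof.
move=> ss st; have [G' dG HG] := lyapunov_der; apply: (der_le dG ss st) => r sr rt.
have := HG r (le_lt_trans ss sr); have := mulr_ge0 (ltW kR0) (fsq_ge0 (psi r)).
have : 0 <= kR^-1 * (D * expR (- lam * (r - t0))).
  by apply: mulr_ge0 (eD r); rewrite invr_ge0 ltW.
by lra.
Qed.

(** The field is bounded along the trajectory, so [fsq psi] drops at rate at most [L]; this gives
    the excursions in [psi_cvg0] their minimal duration. *)
Lemma psi_lipschitz : exists2 L, 0 < L & forall s t, t0 <= s -> s <= t ->
  fsq (psi s) - L * (t - s) <= fsq (psi t).
Proof.
pose m := fsq M * 3; have m0 : 0 <= m by rewrite mulr_ge0 ?fsq_ge0.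
have psib t : t0 <= t -> fsq (psi t) <= m.
  move=> tt; apply: le_trans (fsq_psi_le _) _; apply: le_trans (fsq_mul _ _) _.
  by rewrite (fsq_orth (OF tt)).
pose U := 2 * (kR ^+ 2 * m + D); pose L := m + m * (2 * U) + 1.
have U0 : 0 <= U.
  by apply: mulr_ge0 => //; apply: addr_ge0 => //; apply: mulr_ge0 => //; exact: sqr_ge0.
have L0 : 0 < L.
  by apply: ltr_wpDl => //; apply: addr_ge0 => //; apply: mulr_ge0 => //; apply: mulr_ge0.
exists L => // s t ss st.
pose u r := - (kR *: psi r) - d r.
have ub r : t0 <= r -> fsq (u r) <= U.
  move=> rr; apply: le_trans (fsqD_le _ _) _; rewrite !fsqN fsqZ.
  apply: ler_wpM2l => //; apply: lerD; first by rewrite ler_wpM2l ?sqr_ge0 ?psib.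
  apply: le_trans (hd rr) _; rewrite ler_piMr // -expR0 ler_expR.
  by rewrite mulNr oppr_le0 mulr_ge0 ?(ltW lam0) // subr_ge0.
have dpsi := mder_psi (mderMl M dF).
have := der_ge (derD (der_fsq dpsi) (derZ L (der_id t0))) ss st.
move=> /(_ _)/wrap[r sr rt|]; last by rewrite -/(psi s) -/(psi t); lra.
have rr : t0 <= r := le_trans ss (ltW sr).
rewrite -/(psi r) -/(u r); set w := psi_a (M *m (F r *m _)).
have hw : fsq w <= m * (2 * U).
  apply: le_trans (fsq_psi_le _) _; rewrite mulmxA.
  apply: fsq_mul_le; first by apply: fsq_mul_le => //; rewrite (fsq_orth (OF rr)).
  by rewrite fsq_skew ler_wpM2l ?ub.
have := fdot_young (psi r) (- w) ltr01; rewrite fdotNr fsqN invr1.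
by have := psib r rr; rewrite /L; lra.
Qed.

(* Barbalat: each late excursion of [fsq psi] above [eps] lasts a fixed time, hence lowers [G] by
   a fixed amount, which is impossible near its infimum. *)
Lemma psi_cvg0 eps : 0 < eps -> exists2 T, t0 <= T & forall t, T <= t -> fsq (psi t) < eps.
Proof.
move=> e0; have [L L0 HL] := psi_lipschitz.
(* During a time [h] the value drops by at most [eps / 2], which forces [G] to decrease by at least
   [c]. *)
pose h := eps / (2 * L); have h0 : 0 < h by rewrite divr_gt0 // mulr_gt0.
pose c := kR * (eps / 2) * h; have c0 : 0 < c by apply: mulr_gt0 => //; apply: mulr_gt0 => //; rewrite divr_gt0.
pose A := [set G t | t in [set t | t0 <= t]].
have hA : has_inf A.
  split; first by exists (G t0); exists t0 => /=.
  by exists 0 => _ [t /= tt <-]; exact: lyapunov_ge0.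
have [_ [T /= T0 <-] HT] := inf_adherent c0 hA.
exists T => // t Tt; rewrite ltNge; apply/negP => he.
have tt := le_trans T0 Tt.
have th : t <= t + h by rewrite lerDl ltW.
have [G' dG HG] := lyapunov_der.
have := der_le (derD dG (derZ (kR * (eps / 2)) (der_id t0))) tt th.
move=> /(_ _)/wrap[r tr rt|H].
  have := HG r (le_lt_trans tt tr); have := HL t r tt (ltW tr).
  have : L * (r - t) <= eps / 2.
    have -> : eps / 2 = L * h by rewrite /h; field; rewrite gt_eqF.
    by rewrite ler_wpM2l ?(ltW L0) // lerBlDl.
  move=> h1 h2 h3.
  have h4 : kR * (eps / 2) <= kR * fsq (psi r) by rewrite ler_wpM2l ?(ltW kR0) //; lra.
  have : 0 <= kR^-1 * (D * expR (- lam * (r - t0))).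
    by apply: mulr_ge0 (eD r); rewrite invr_ge0 ltW.
  by lra.
have h1 := lyapunov_noninc T0 Tt.
have h2 : inf A <= G (t + h).
  by apply: ge_inf; [exact: hA.2|exists (t + h) => //=; exact: le_trans th].
have e : kR * (eps / 2) * (t + h) - kR * (eps / 2) * t = c by rewrite /c; ring.
by move: H h1 h2 HT e; rewrite /=; lra.
Qed.

Lemma rotation_near_signmx eps : 0 < eps -> exists2 T, t0 <= T &
  forall t, T <= t -> fsq (F t - signmx (F t)) < eps.
Proof.
move=> e0; have [c c0 Hc] := near_diagonal rm0 rhom rho_inj.
have [T T0 HT] := psi_cvg0 (divr_gt0 e0 c0); exists T => // t Tt.
apply: le_lt_trans (Hc _ (OF (le_trans T0 Tt))) _.
by rewrite mulrC -ltr_pdivlMr // HT.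
Qed.

End Trajectory.

(** In a small sublevel set of the Lyapunov function the diagonal stays nonnegative, so [signmx] is
    the identity and [near_diagonal] becomes a gradient inequality: the potential is at most a
    multiple of [fsq psi]. The decrease is then exponential. *)
Lemma rotation_exp_stable : exists r c l : R, [/\ 0 < r, 0 < c, 0 < l &
  forall (t0 D : R) (F : R -> 'M[R]_3) (d : R -> 'cV[R]_3), 0 <= D ->
  mder t0 F (fun t => F t *m skew (- (kR *: psi_a (M *m F t)) - d t)) ->
  is_SO3 (F t0) ->
  (forall t, t0 <= t -> fsq (d t) <= D * expR (- lam * (t - t0))) ->
  fsq (1%:M - F t0) + D <= r -> forall t, t0 <= t ->
  fsq (1%:M - F t) <= c * expR (- l * (t - t0)) * (fsq (1%:M - F t0) + D)].
Proof.
have [cd cd0 Hcd] := near_diagonal rm0 rhom rho_inj.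
have rM0 : 0 < rM by apply: lt_le_trans rm0 _; exact: le_trans (rhom ord0) (rhoM ord0).
pose kap := 2 / (kR * lam).
have kap0 : 0 < kap by rewrite divr_gt0 // mulr_gt0.
pose b := rM + kap; have b0 : 0 < b by rewrite addr_gt0.
(* This radius keeps [fsq (1%:M - F s)] at most 1/2, which excludes negative diagonal entries. In
   [l] below, the two terms of the minimum serve the potential and the envelope. *)
pose r := rm / (4 * b); have r0 : 0 < r by rewrite divr_gt0 // mulr_gt0.
pose l := Num.min (kR / (rM * cd)) (lam / 2).
have l0 : 0 < l by rewrite lt_min !divr_gt0 // mulr_gt0.
exists r, (2 * b / rm), l; split=> //; first by rewrite divr_gt0 // mulr_gt0.
move=> t0 D F d D0 dF F0 hd hr t tt.
have OF s : t0 <= s -> (F s)^T *m F s = 1%:M.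
  by move=> ss; have [] := SO3_invariant dF F0 ss.
pose e s := expR (- lam * (s - t0)).
pose G s := potential (rho := rho) (F s) + kap * D * e s.
have Gt0 : G t0 <= b * (fsq (1%:M - F t0) + D).
  have := potential_le rm0 rhom rhoM (OF t0 (lexx t0)).
  rewrite /G /e subrr mulr0 expR0 mulr1 /b !mulrDl !mulrDr.
  have := mulr_ge0 (ltW kap0) (fsq_ge0 (1%:M - F t0)); have := mulr_ge0 (ltW rM0) D0.
  by lra.
have pot s : t0 <= s -> rm * fsq (1%:M - F s) <= 2 * G s.
  move=> ss; apply: le_trans (potential_ge rhom (OF s ss)) _.
  rewrite ler_wpM2l // lerDl; apply: mulr_ge0 (expR_ge0 _).
  by apply: mulr_ge0 => //; exact: ltW.
have [G' dG HG] := lyapunov_der dF hd.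
have near1 s : t0 <= s -> signmx (F s) = 1%:M.
  move=> ss; have h1 : rm * fsq (1%:M - F s) <= rm * (1 / 2).
    apply: le_trans (pot s ss) _.
    have h2 : G s <= G t0 := lyapunov_noninc D0 dF hd (lexx t0) ss.
    have h3 : b * (fsq (1%:M - F t0) + D) <= b * r by rewrite ler_wpM2l // ltW.
    have h4 : b * r = rm / 4 by rewrite /r; field; rewrite gt_eqF.
    have h5 : G s <= rm / 4 by rewrite -h4; exact: le_trans h2 (le_trans Gt0 h3).
    by lra.
  rewrite ler_pM2l // in h1.
  apply/matrixP => i j; rewrite signmxE mxE.
  suff -> : 0 <= F s i i by [].
  have := fsq_entry (1%:M - F s) i i; rewrite !mxE eqxx mulr1n => h5.
  by rewrite leNgt; apply/negP => h6; nra.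
have H := gronwall_le dG (lexx t0) tt (c := - l).
have {H} : G t <= expR (- l * (t - t0)) * G t0.
  apply: H => s ss st; have s0 := ltW ss; apply: le_trans (HG s ss) _.
  have := Hcd _ (OF s s0); rewrite near1 // -fsqN opprB => h1.
  have h2 := potential_le rm0 rhom rhoM (OF s s0).
  have h3 : l * potential (rho := rho) (F s) <= kR * fsq (psi_a (M *m F s)).
    apply: (@le_trans _ _ (kR / (rM * cd) * potential (rho := rho) (F s))).
      rewrite ler_wpM2r ?ge_min ?lexx //; exact: potential_ge0 rm0 rhom _ (OF s s0).
    rewrite -mulrA ler_wpM2l ?(ltW kR0) // ler_pdivrMl ?mulr_gt0 // -mulrA.
    by apply: le_trans h2 _; rewrite ler_wpM2l // ltW.
  have eD : 0 <= D * e s by rewrite mulr_ge0 ?expR_ge0.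
  have h4 : l * (kap * D * e s) <= kR^-1 * D * e s.
    have -> : l * (kap * D * e s) = l * kap * (D * e s) by ring.
    rewrite -[leRHS]mulrA; apply: ler_wpM2r => //.
    apply: (@le_trans _ _ (lam / 2 * kap)).
      by rewrite ler_wpM2r ?(ltW kap0) // ge_min lexx orbT.
    by rewrite le_eqVlt; apply/orP; left; apply/eqP; rewrite /kap; field; rewrite !gt_eqF.
  change (- (kR * fsq (psi_a (M *m F s))) - kR^-1 * D * e s
    <= - l * (potential (rho := rho) (F s) + kap * D * e s)).
  by rewrite mulrDr !mulNr; lra.
move=> h; rewrite -(ler_pM2l rm0); apply: le_trans (pot t tt) _.
have h2 : 2 * G t <= 2 * (expR (- l * (t - t0)) * (b * (fsq (1%:M - F t0) + D))).
  by rewrite ler_wpM2l //; apply: le_trans h _; rewrite ler_wpM2l ?expR_ge0.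
apply: le_trans h2 _; rewrite le_eqVlt; apply/orP; left; apply/eqP.
by field; rewrite gt_eqF.
Qed.

End RotationConvergence.

(** * Cone argument *)

Section Cone.
Context {R : realType}.

Lemma norm_tr m n (A : 'M[R]_(m, n)) : `|A^T| <= `|A|.
Proof. by apply: mx_norm_le => // i j; rewrite mxE mx_norm_entry. Qed.

Lemma norm_skew (x : 'cV[R]_3) : `|skew x| <= `|x|.
Proof.
apply: mx_norm_le => // i j.
by case: (ord3P i) => ->; case: (ord3P j) => ->; rewrite !skewE ?normrN ?normr0 // mx_norm_entry.
Qed.

Lemma norm_half (x y c : R) : `|x| <= c -> `|y| <= c -> `|2^-1 * (x - y)| <= c.
Proof. by rewrite !ler_norml => /andP[a b] /andP[a' b']; apply/andP; split; lra. Qed.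

Lemma norm_psi (A : 'M[R]_3) : `|psi_a A| <= `|A|.
Proof.
apply: mx_norm_le => // i j; rewrite ord1.
by case: (ord3P i) => ->; rewrite !psiE norm_half // mx_norm_entry.
Qed.

Lemma psiD (A B : 'M[R]_3) : psi_a (A + B) = psi_a A + psi_a B.
Proof.
apply/matrixP => i j; rewrite ord1.
by case: (ord3P i) => ->; rewrite !entryE; ring.
Qed.

Lemma psiB (A B : 'M[R]_3) : psi_a (A - B) = psi_a A - psi_a B.
Proof.
apply/matrixP => i j; rewrite ord1.
by case: (ord3P i) => ->; rewrite !entryE; ring.
Qed.

Lemma psi_skew (x : 'cV[R]_3) : psi_a (skew x) = x.
Proof.
apply/matrixP => i j; rewrite ord1.
by case: (ord3P i) => ->; rewrite !entryE; field.
Qed.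

(* Near the identity the symmetric part of an orthogonal matrix is a higher-order function of its
   skew part, with a small Lipschitz constant. *)
Lemma orth_pair (Z1 Z2 : 'M[R]_3) (eps : R) : eps <= 6^-1 ->
  Z1^T *m Z1 = 1%:M -> Z2^T *m Z2 = 1%:M -> `|Z1 - 1%:M| <= eps -> `|Z2 - 1%:M| <= eps ->
  `|Z1 - Z2| <= 2 * `|psi_a (Z1 - Z2)| /\
  `|(Z1 - Z2) - skew (psi_a (Z1 - Z2))| <= 6 * eps * `|psi_a (Z1 - Z2)|.
Proof.
move=> e6 o1 o2 h1 h2; set K1 := Z1 - 1%:M in h1 *; set K2 := Z2 - 1%:M in h2 *.
set D := Z1 - Z2; set y := psi_a D; have e0 : 0 <= eps := le_trans (normr_ge0 _) h1.
have sym : D + D^T = - (D^T *m K1 + K2^T *m D).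
  rewrite /D /K1 /K2 !trmxDE !trmxNE trmx1 !(mulmxBl, mulmxBr) !mulmx1 !mul1mx.
  rewrite o1 o2.
  by apply/matrixP => i j; rewrite !mxE; ring.
have hs : `|D + D^T| <= 6 * eps * `|D|.
  rewrite sym normrN; apply: le_trans (ler_normD _ _) _.
  have a1 := mx_norm_mulmx D^T K1; have a2 := mx_norm_mulmx K2^T D.
  have b1 : `|D^T| * `|K1| <= `|D| * eps by rewrite ler_pM // norm_tr.
  have b2 : `|K2^T| * `|D| <= eps * `|D| by rewrite ler_pM // (le_trans (norm_tr _)).
  by lra.
have eH : D - skew y = 2^-1 *: (D + D^T).
  by rewrite /y skew_psi; apply/matrixP => i j; rewrite !mxE; field.
have hH : `|D - skew y| <= 3 * eps * `|D|.
  by rewrite eH normrZ ger0_norm ?invr_ge0 //; lra.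
have hD : `|D| <= 2 * `|y|.
  have := ler_normD (D - skew y) (skew y); rewrite subrK; have := norm_skew y.
  have : 3 * eps * `|D| <= 2^-1 * `|D| by rewrite ler_wpM2r //; lra.
  by lra.
split=> //; apply: le_trans hH _.
have : 3 * eps * `|D| <= 3 * eps * (2 * `|y|) by rewrite ler_wpM2l // mulr_ge0.
by lra.
Qed.

Section Step.
Context {m : 'I_3 -> R} {rM kR eps : R}.
Hypotheses (hm : forall i, `|m i| <= rM) (kR0 : 0 < kR) (e6 : eps <= 6^-1).
Let Md : 'M[R]_3 := diag_mx (\row_i m i).

(** The coordinates of [psi_a (Md *m skew y)] are [gain i * y i 0], so the linearized unforced flow
    is diagonal with rates [- (kR * gain i)]. The weights [m] may have either sign. *)
Definition gain i : R := 2^-1 * (m (inord 0) + m (inord 1) + m (inord 2) - m i).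

Let rM0 : 0 <= rM. Proof. exact: le_trans (hm (inord 0)). Qed.

Lemma psi_diag (A : 'M[R]_3) (y : 'cV[R]_3) i :
  `|psi_a (Md *m A) i 0 - gain i * y i 0| <= rM * `|A - skew y|.
Proof.
set H := A - skew y.
have h k l l' : `|m l * H l l'| <= rM * `|H| /\ `|m k * H k l'| <= rM * `|H|.
  by rewrite !normrM !ler_pM // mx_norm_entry.
have eA k l : A k l = H k l + skew y k l by rewrite /H entryD entryN subrK.
case: (ord3P i) => ->; rewrite /gain !psiE !entry_diag_mulmx !eA !skewE.
- rewrite (_ : _ - _ = 2^-1 * (m (inord 2) * H (inord 2) (inord 1) - m (inord 1) * H (inord 1) (inord 2))); last by field.
  by apply: norm_half; apply: (h _ _ _).2; exact: (inord 0).
- rewrite (_ : _ - _ = 2^-1 * (m (inord 0) * H (inord 0) (inord 2) - m (inord 2) * H (inord 2) (inord 0))); last by field.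
  by apply: norm_half; apply: (h _ _ _).2; exact: (inord 0).
- rewrite (_ : _ - _ = 2^-1 * (m (inord 1) * H (inord 1) (inord 0) - m (inord 0) * H (inord 0) (inord 1))); last by field.
  by apply: norm_half; apply: (h _ _ _).2; exact: (inord 0).
Qed.

Lemma norm_diag_mul (A : 'M[R]_3) : `|Md *m A| <= rM * `|A|.
Proof.
apply: mx_norm_le => [|i j]; first by rewrite mulr_ge0.
by rewrite entry_diag_mulmx normrM ler_pM // mx_norm_entry.
Qed.

(** The difference of two trajectories obeys the diagonal linear system up to an error proportional
    to [eps * |y|] and a term from the inputs. The quadratic terms are [(Z1 - 1%:M) *m skew du] and
    [D *m skew u2]; in each the factor not coming from the difference is of order [eps], which is
    why [d2] has to be small. *)
Lemma cone_step (Z1 Z2 : 'M[R]_3) (d1 d2 u1 u2 y : 'cV[R]_3) i :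
  u1 = - (kR *: psi_a (Md *m Z1)) - d1 -> u2 = - (kR *: psi_a (Md *m Z2)) - d2 ->
  y = psi_a Z1 - psi_a Z2 ->
  Z1^T *m Z1 = 1%:M -> Z2^T *m Z2 = 1%:M -> `|Z1 - 1%:M| <= eps -> `|Z2 - 1%:M| <= eps ->
  `|d2| <= eps ->
  `|(psi_a (Z1 *m skew u1) - psi_a (Z2 *m skew u2)) i 0 - (- (kR * gain i)) * y i 0|
    <= (18 * (kR * rM) + 6) * eps * `|y| + 2 * `|d1 - d2|.
Proof.
move=> eu1 eu2 ey o1 o2 h1 h2 hd.
have [hD hH] := orth_pair e6 o1 o2 h1 h2; rewrite psiB -ey in hD hH.
set D := Z1 - Z2 in hD hH.
have e0 : 0 <= eps := le_trans (normr_ge0 _) h1.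
set du := u1 - u2; set p := psi_a (Md *m D).
have edu : du = - (kR *: p) - (d1 - d2).
  rewrite /du eu1 eu2 /p /D mulmxBr psiB.
  by apply/matrixP => a b; rewrite !(entryD, entryN, entryZ); ring.
have hp : `|p| <= rM * (2 * `|y|).
  apply: le_trans (norm_psi _) _; apply: le_trans (norm_diag_mul _) _.
  by rewrite ler_wpM2l.
have hdu : `|du| <= kR * (rM * (2 * `|y|)) + `|d1 - d2|.
  rewrite edu; apply: le_trans (ler_normB _ _) _; rewrite normrN lerD2r normrZ gtr0_norm //.
  by rewrite ler_wpM2l // ltW.
have hu2 : `|u2| <= (kR * rM + 1) * eps.
  rewrite eu2; apply: le_trans (ler_normB _ _) _; rewrite normrN normrZ gtr0_norm //.
  have -> : psi_a (Md *m Z2) = psi_a (Md *m (Z2 - 1%:M)).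
    rewrite mulmxBr mulmx1 psiB; suff -> : psi_a Md = 0 by rewrite subr0.
    apply/matrixP => a b; rewrite ord1 [RHS]mxE.
    by case: (ord3P a) => ->; rewrite !psiE !mxE !inord3_neq !mulr0n subrr mulr0.
  have : `|psi_a (Md *m (Z2 - 1%:M))| <= rM * eps.
    apply: le_trans (norm_psi _) _; apply: le_trans (norm_diag_mul _) _.
    by rewrite ler_wpM2l.
  by move=> /(ler_wpM2l (ltW kR0)) h; rewrite mulrDl mul1r lerD // -mulrA.
have eq : psi_a (Z1 *m skew u1) - psi_a (Z2 *m skew u2) =
    du + psi_a ((Z1 - 1%:M) *m skew du) + psi_a (D *m skew u2).
  rewrite -{1}(psi_skew du) -!psiD -psiB; congr psi_a.
  rewrite /du skewB /D !(mulmxBl, mulmxBr) !mul1mx.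
  by apply/matrixP => a b; rewrite !(entryD, entryN); ring.
have edi : du i 0 = - (kR * p i 0) - (d1 i 0 - d2 i 0).
  by rewrite edu !(entryD, entryN, entryZ).
rewrite eq 2!entryD edi.
(* The terms [x1], [x2] and the linearization error contribute [6 (kR rM)], [6 (kR rM + 1)] and
   [6 (kR rM)] to the coefficient of [eps * |y|]. *)
pose x1 := psi_a ((Z1 - 1%:M) *m skew du) i 0; pose x2 := psi_a (D *m skew u2) i 0.
rewrite -/x1 -/x2.
have hx1 : `|x1| <= 3 * (eps * (kR * (rM * (2 * `|y|)) + `|d1 - d2|)).
  apply: le_trans (mx_norm_entry _ _ _) _; apply: le_trans (norm_psi _) _.
  apply: le_trans (mx_norm_mulmx _ _) _; rewrite ler_wpM2l // ler_pM //.
  exact: le_trans (norm_skew _) hdu.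
have hx2 : `|x2| <= 3 * (2 * `|y| * ((kR * rM + 1) * eps)).
  apply: le_trans (mx_norm_entry _ _ _) _; apply: le_trans (norm_psi _) _.
  apply: le_trans (mx_norm_mulmx _ _) _; rewrite ler_wpM2l // ler_pM //.
  exact: le_trans (norm_skew _) hu2.
have hx3 : `|(d1 - d2) i 0| <= `|d1 - d2| by exact: mx_norm_entry.
have hx4 : `|p i 0 - gain i * y i 0| <= rM * (6 * eps * `|y|).
  by apply: le_trans (psi_diag _ _ _) _; rewrite ler_wpM2l.
have hed : eps * `|d1 - d2| <= 6^-1 * `|d1 - d2| by rewrite ler_wpM2r.
move/(ler_wpM2l (ltW kR0)): hx4; rewrite -{1}(gtr0_norm kR0) -normrM.
move: hx1 hx2 hx3; rewrite [(d1 - d2) i 0]entryD entryN.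
move: (normr_ge0 (d1 - d2)) => nd.
rewrite !ler_norml => /andP[a1 a2] /andP[b1 b2] /andP[c1 c2] /andP[f1 f2].
by apply/andP; split; lra.
Qed.

End Step.

(* Otherwise [W = sum_i sign(a_i) y_i^2 - (6 / (al lam)) D exp(- lam (t - T))] is positive at [T]
   and, as [W' >= al W], unbounded. *)
Lemma cone_growth (T al lam D B eta : R) (a : 'I_3 -> R) (y y' : R -> 'cV[R]_3) (del : R -> R) :
  0 < al -> 0 < lam -> 0 <= D -> 0 <= eta -> eta <= al / 12 -> (forall i, al <= `|a i|) ->
  mder T y y' -> (forall t, T <= t -> fsq (y t) <= B) ->
  (forall t i, T <= t -> `|y' t i 0 - a i * y t i 0| <= eta * `|y t| + del t) ->
  (forall t, T <= t -> del t ^+ 2 <= D * expR (- lam * (t - T))) ->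
  \sum_i (if 0 < a i then 1 else -1) * y T i 0 ^+ 2 <= 6 / (al * lam) * D.
Proof.
move=> al0 lam0 D0 et0 eta_le ha dy yB hy hdel.
pose s i : R := if 0 < a i then 1 else -1; pose kap := 6 / (al * lam).
pose e t := expR (- lam * (t - T)).
pose W t := \sum_i s i * (y t i 0 * y t i 0) - kap * D * e t.
have dW := derB (der_sum (index_enum 'I_3) (fun i => derZ (s i) (derM (dy i 0) (dy i 0)))) (derZ (kap * D) (der_exp T (- lam) T)).
have yW t : T <= t -> W t <= fsq (y t).
  move=> Tt; rewrite fsq_sum /W lerBlDr ler_wpDr //.
    by rewrite mulr_ge0 ?expR_ge0 // mulr_ge0 // divr_ge0 // mulr_ge0 // ltW.
  apply: ler_sum => i _; rewrite big_ord1 -expr2 /s; case: ifP => _; first by rewrite mul1r.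
  by have := sqr_ge0 (y t i 0); lra.
have hW t : T <= t -> expR (al * (t - T)) * W T <= W t.
  move=> Tt; apply: (gronwall_ge dW (lexx T) Tt) => r Tr rt /=.
  have Tr' := ltW Tr; have fy := fsq_ge0 (y r).
  apply: (@le_trans _ _ (al * fsq (y r))); first by rewrite ler_wpM2l ?(ltW al0) ?yW.
  have hd := hdel r Tr'.
  (* Of the rate [al], a quarter pays for [del] by Young's inequality and another quarter for the
     three terms in [eta]. Differentiating the squares doubles the remaining half to [al], and the
     terms in [del] cancel against the envelope. *)
  have term i : al * y r i 0 ^+ 2 - eta * fsq (y r) - (al / 4) * y r i 0 ^+ 2 - al^-1 * del r ^+ 2
      <= s i * (y r i 0 * y' r i 0).
    have := hy r i Tr'; have := ha i.
    set v := y r i 0; set v' := y' r i 0 => hai.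
    have nv2 : `|v| ^+ 2 = v ^+ 2 by rewrite real_normK ?num_real.
    have n1 : `|v| * (eta * `|y r|) <= eta * fsq (y r).
      rewrite mulrCA ler_wpM2l //; apply: le_trans (mx_norm_sq_le _).
      by rewrite expr2 ler_wpM2r // mx_norm_entry.
    have n2 : `|v| * del r <= al / 4 * v ^+ 2 + al^-1 * del r ^+ 2.
      rewrite -nv2 -subr_ge0 -(pmulr_lge0 _ al0).
      have -> : (al / 4 * `|v| ^+ 2 + al^-1 * del r ^+ 2 - `|v| * del r) * al = (al / 2 * `|v| - del r) ^+ 2.
        by field; rewrite gt_eqF.
      exact: sqr_ge0.
    move=> h; have n3 : `|v * (v' - a i * v)| <= `|v| * (eta * `|y r| + del r).
      by rewrite normrM ler_wpM2l.
    have n4 : al * v ^+ 2 <= s i * a i * v ^+ 2.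
      apply: ler_wpM2r; first exact: sqr_ge0.
      move: hai; rewrite /s; case: ltrP => ai; first by rewrite mul1r gtr0_norm.
      by rewrite mulN1r ler0_norm.
    have n5 : - `|v * (v' - a i * v)| <= s i * (v * (v' - a i * v)).
      rewrite /s; case: ifP => _; first by rewrite mul1r lerNl -normrN ler_norm.
      by rewrite mulN1r lerN2 ler_norm.
    by move: n1 n2 n3 n4 n5; rewrite !mulrDr; lra.
  have t0 := term (inord 0); have t1 := term (inord 1); have t2 := term (inord 2).
  rewrite big_ord3; move: t0 t1 t2.
  have -> : kap * D * (- lam * expR (- lam * (r - T))) = - (6 * (al^-1 * (D * expR (- lam * (r - T))))).
    by rewrite /kap; field; rewrite !gt_eqF.
  have h4 : al^-1 * del r ^+ 2 <= al^-1 * (D * expR (- lam * (r - T))).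
    by rewrite ler_wpM2l // invr_ge0 ltW.
  have h5 : eta * fsq (y r) <= al / 12 * fsq (y r) by rewrite ler_wpM2r.
  move: h4 h5; have -> : fsq (y r) = y r (inord 0) 0 ^+ 2 + y r (inord 1) 0 ^+ 2 + y r (inord 2) 0 ^+ 2.
    by rewrite fsq_sum !big_ord3 !big_ord1.
  by lra.
have WT : W T <= 0.
  rewrite leNgt; apply/negP => WT0.
  have B0 : 0 <= B by apply: le_trans (yB T (lexx T)); exact: fsq_ge0.
  (* At this time already the linear minorant of the exponential yields [W T + B], above the bound
     [B]. *)
  pose t := T + B / (al * W T).
  have Tt : T <= t by rewrite lerDl divr_ge0 // mulr_ge0 // ltW.
  have := hW t Tt; have := yW t Tt; have := yB t Tt.
  have x0 : 0 <= al * (t - T) by rewrite mulr_ge0 ?(ltW al0) // subr_ge0.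
  have : (1 + al * (t - T)) * W T <= expR (al * (t - T)) * W T.
    by rewrite ler_wpM2r ?(ltW WT0) // expR_ge1Dx.
  have -> : (1 + al * (t - T)) * W T = W T + B.
    by rewrite /t; field; rewrite !gt_eqF.
  by lra.
move: WT; rewrite /W /e subrr mulr0 expR0 mulr1 subr_le0.
by under eq_bigr do rewrite -expr2.
Qed.

End Cone.

(** * Null sets *)

Section NullSets.
Context {R : realType} {n : nat}.
Implicit Types E : set 'cV[R]_n.

Lemma null_setS E E' : (forall z, E z -> E' z) -> null_set E' -> null_set E.
Proof.
move=> EE' H eps e0; have [a [b [h1 h2]]] := H eps e0.
by exists a, b; split=> // z /EE'; exact: h1.
Qed.

Let vol (a b : 'cV[R]_n) : R := \prod_(i < n) Num.max 0 (b i 0 - a i 0).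

Let vol_ge0 a b : 0 <= vol a b.
Proof. by apply: prodr_ge0 => i _; rewrite le_max lexx. Qed.

(* Cutting the range of [pi] into [m ^ #|J|] cells covers [E] by as many boxes of side [O(1/m)],
   of total volume [O(1/m)]. *)
Lemma null_lipschitz (J : finType) E (pi : 'cV[R]_n -> J -> R) (B L : R) :
  (#|J| < n)%N -> 0 < B -> 0 <= L -> (forall z j, E z -> `|pi z j| <= B) ->
  (forall z z' h, E z -> E z' -> (forall j, `|pi z j - pi z' j| <= h) ->
     forall i, `|z i 0 - z' i 0| <= L * h) ->
  null_set E.
Proof.
move=> Jn B0 L0 piB piL eps e0.
(* A cell has width [2 * B / m], so a box of side [s / m] around one point of [E] covers all points
   of [E] in the same cell. The total volume is [s ^+ n / m ^+ (n - #|J|)], and this [m] makes it at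
   most [eps]. *)
pose s := 4 * L * B; have s0 : 0 <= s by rewrite !mulr_ge0 // ltW.
pose m' := Num.truncn (s ^+ n / eps); pose m := m'.+1.
have hm : s ^+ n / eps < m%:R by exact: truncnS_gt.
have m0 : 0 < m%:R :> R by rewrite ltr0n.
pose x z j : R := (pi z j + B) * m%:R / (2 * B).
(* The minimum places the right endpoint [pi z j = B] in the last cell. *)
pose cell z : {ffun J -> 'I_m} := [ffun j => inord (minn (Num.truncn (x z j)) m')].
have cellP z j : E z -> (cell z j)%:R <= x z j <= (cell z j)%:R + 1.
  move=> Ez; have := piB z j Ez; rewrite ler_norml => /andP[lo hi].
  have x0 : 0 <= x z j by rewrite divr_ge0 ?mulr_ge0 ?(ltW m0) ?(ltW B0) //; lra.
  have xm : x z j <= m%:R.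
    rewrite ler_pdivrMr ?mulr_gt0 // mulrC ler_wpM2l ?(ltW m0) //; lra.
  have /andP[t1 t2] := truncn_itv x0.
  rewrite ffunE inordK ?ltnS ?geq_minr // /minn; case: ltnP => tm.
    by rewrite t1 /= natr1 ltW.
  rewrite natr1 xm andbT; apply: le_trans t1; by rewrite ler_nat.
have close z z' i : E z -> E z' -> cell z = cell z' -> `|z i 0 - z' i 0| <= L * (2 * B / m%:R).
  move=> Ez Ez' ec; apply: (piL _ _ _ Ez Ez') => j.
  have := cellP z j Ez; have := cellP z' j Ez'; rewrite ec => /andP[a1 a2] /andP[b1 b2].
  have -> : pi z j - pi z' j = (x z j - x z' j) * (2 * B / m%:R).
    by rewrite /x; field; rewrite (gt_eqF B0) (gt_eqF m0).
  rewrite normrM (ger0_norm (_ : 0 <= 2 * B / m%:R)); last first.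
    by rewrite divr_ge0 ?mulr_ge0 // ltW.
  rewrite ler_piMl //; first by rewrite divr_ge0 ?mulr_ge0 // ltW.
  by rewrite ler_norml; apply/andP; split; lra.
pose T := {ffun J -> 'I_m}.
have pick (c : T) : exists zo : option 'cV[R]_n,
    if zo is Some z then E z /\ cell z = c else forall z, E z -> cell z <> c.
  have [[z [Ez zc]]|nz] := pselect (exists z, E z /\ cell z = c); first by exists (Some z).
  by exists None => z Ez zc; apply: nz; exists z.
pose zc c := sval (cid (pick c)); have zcP c := svalP (cid (pick c)).
pose side := L * (2 * B / m%:R).
(* Cells that miss [E], and indices past the last cell, get the degenerate box at 0, of volume 0 as
   [n] is positive. *)
pose box (sg : R) k : 'cV[R]_n :=
  if insub k is Some i then
    if zc (enum_val (i : 'I_#|T|)) is Some z then \col_l (z l 0 + sg * side) else 0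
  else 0.
exists (box (-1)), (box 1); split.
  move=> z Ez; exists (enum_rank (cell z)) => i.
  rewrite /box (valK (enum_rank (cell z))) enum_rankK; have := zcP (cell z); rewrite -/(zc _).
  case: (zc (cell z)) => [z' [Ez' ez']|/(_ z Ez) //].
  have := close z z' i Ez Ez' (esym ez'); rewrite -/side !mxE ler_norml => /andP[a b].
  by apply/andP; split; lra.
pose v0 := (s / m%:R) ^+ n.
have v00 : 0 <= v0 by apply: exprn_ge0; apply: divr_ge0 => //; exact: ltW.
have n0 : (0 < n)%N by apply: leq_ltn_trans Jn.
have vol0 : vol 0 0 = 0.
  by rewrite /vol (bigD1 (Ordinal n0)) //= !mxE subrr maxxx mul0r.
have hv k : vol (box (-1) k) (box 1 k) <= (k < #|T|)%N%:R * v0.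
  rewrite /box; case: insubP => [i ki _|/negPf ->]; last by rewrite vol0 mul0r.
  rewrite ki mulr1n [1 * v0]mul1r; case: (zc _) => [z|]; last first.
    by rewrite vol0.
  have -> : v0 = \prod_(i < n) (s / m%:R) by rewrite prodr_const card_ord.
  apply: ler_prod => l _; rewrite le_max lexx /= ge_max.
  rewrite (divr_ge0 s0 (ltW m0)) /= !mxE le_eqVlt; apply/orP; left; apply/eqP; rewrite /side /s; field.
  by rewrite (gt_eqF m0).
move=> K; apply: (@le_trans _ _ (#|T|%:R * v0)).
  have : \sum_(k < K) vol (box (-1) k) (box 1 k) <= (minn K #|T|)%:R * v0.
    elim: K => [|K IH]; first by rewrite big_ord0 mulr_ge0.
    rewrite big_ord_recr /=; apply: le_trans (lerD IH (hv K)) _.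
    rewrite -mulrDl -natrD ler_wpM2r // ler_nat.
    by rewrite /minn; case: (ltnP K #|T|) => h; case: ltnP => h'; rewrite ?addn0 ?addn1 //;
      rewrite ?(leq_trans _ h') // ltnW.
  by move=> /le_trans; apply; rewrite ler_wpM2r // ler_nat geq_minr.
rewrite card_ffun card_ord /v0 expr_div_n natrX.
have -> : m%:R ^+ #|J| * (s ^+ n / m%:R ^+ n) = s ^+ n / m%:R ^+ (n - #|J|).
  rewrite -{2}(subnK (ltnW Jn)) exprD; field.
  by rewrite !expf_neq0 // (gt_eqF m0).
rewrite ler_pdivrMr ?exprn_gt0 // mulrC -ler_pdivrMr //; apply: le_trans (ltW hm) _.
rewrite -{1}(expr1 m%:R) -!natrX ler_nat leq_pexp2l // subn_gt0 //.
Qed.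

Lemma null_bigcup (E : nat -> set 'cV[R]_n) : (0 < n)%N ->
  (forall k, null_set (E k)) -> null_set [set z | exists k, E k z].
Proof.
move=> n0 nE eps e0.
have ek k : 0 < eps * 2^-1 ^+ k.+1 by rewrite mulr_gt0 // exprn_gt0 // invr_gt0.
pose a k := sval (cid (nE k _ (ek k))).
pose b k := sval (cid (svalP (cid (nE k _ (ek k))))).
have abP k : (forall z, E k z -> exists j, forall i, a k j i 0 <= z i 0 <= b k j i 0) /\
    (forall K, \sum_(j < K) vol (a k j) (b k j) <= eps * 2^-1 ^+ k.+1).
  exact: (svalP (cid (svalP (cid (nE k _ (ek k)))))).
pose sel (c : nat -> nat -> 'cV[R]_n) p : 'cV[R]_n :=
  if pickle_inv p is Some kj then c (kj : nat * nat).1 kj.2 else 0.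
exists (sel a), (sel b); split.
  move=> z [k /(abP k).1[j hj]]; exists (pickle (k, j)) => i.
  by rewrite /sel pickleK_inv.
have vol0 : vol 0 0 = 0.
  by rewrite /vol (bigD1 (Ordinal n0)) //= !mxE subrr maxxx mul0r.
move=> K.
(* [N] exceeds both components of every pair coded below [K], so the partial sum is dominated by a
   sum over a square; numbers that code no pair carry a degenerate box. *)
pose N := (\sum_(p < K) (if pickle_inv p is Some kj then (kj : nat * nat).1 + kj.2 else 0)).+1%N.
pose V k j : R := vol (a k j) (b k j).
have e p : (p < K)%N -> vol (sel a p) (sel b p) =
    \sum_(k < N) \sum_(j < N) (pickle (nat_of_ord k, nat_of_ord j) == p)%:R * V k j.
  move=> pK; rewrite /sel; case ep: (pickle_inv p) => [[k j]|]; last first.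
    rewrite vol0 big1 // => k _; rewrite big1 // => j _.
    case: eqP => [h|]; last by rewrite mul0r.
    by move: ep; rewrite -h pickleK_inv.
  have hp : pickle (k, j) = p by have := @pickle_invK (nat * nat)%type p; rewrite /oapp ep.
  have kj : (k + j < N)%N.
    rewrite ltnS (bigD1 (Ordinal pK)) //= ep /=; exact: leq_addr.
  have kN : (k < N)%N := leq_ltn_trans (leq_addr _ _) kj.
  have jN : (j < N)%N := leq_ltn_trans (leq_addl _ _) kj.
  rewrite (bigD1 (Ordinal kN)) //= (bigD1 (Ordinal jN)) //= hp eqxx mul1r.
  have inj k' j' : (pickle (k', j') == p) = ((k' == k) && (j' == j)).
    by rewrite -hp (inj_eq (pcan_inj pickleK)) xpair_eqE.
  rewrite [X in _ + X + _]big1 ?addr0; last first.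
    move=> j' hj'; rewrite inj eqxx /=.
    have /negPf -> : nat_of_ord j' != j by apply: contraNneq hj' => h; exact/eqP/val_inj.
    by rewrite mul0r.
  rewrite big1 ?addr0 // => k' hk'; rewrite big1 // => j' _.
  rewrite inj; have /negPf -> : nat_of_ord k' != k.
    by apply: contraNneq hk' => h; exact/eqP/val_inj.
  by rewrite mul0r.
rewrite (eq_bigr (fun p : 'I_K => \sum_(k < N) \sum_(j < N) (pickle (nat_of_ord k, nat_of_ord j) == p)%:R * V k j)); last first.
  by move=> p _; rewrite -/(vol _ _) e.
rewrite exchange_big /=; under eq_bigr do rewrite exchange_big /=.
apply: (@le_trans _ _ (\sum_(k < N) \sum_(j < N) V k j)).
  apply: ler_sum => k _; apply: ler_sum => j _; rewrite -mulr_suml ler_piMl ?vol_ge0 //.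
  have [h|h] := ltnP (pickle (nat_of_ord k, nat_of_ord j)) K.
    rewrite (bigD1 (Ordinal h)) //= eqxx big1 ?addr0 // => p hp.
    by case: eqP => // hp'; case/eqP: hp; exact/val_inj.
  rewrite big1 // => p _; case: eqP => // hp.
  by have := ltn_ord p; rewrite -hp ltnNge h.
apply: (@le_trans _ _ (\sum_(k < N) eps * 2^-1 ^+ k.+1)).
  by apply: ler_sum => k _; exact: (abP k).2.
have -> : \sum_(k < N) eps * 2^-1 ^+ k.+1 = eps * (1 - 2^-1 ^+ N).
  elim: (N) => [|N' IH]; first by rewrite big_ord0 expr0 subrr mulr0.
  by rewrite big_ord_recr /= IH !exprS; field.
by rewrite ler_piMr ?(ltW e0) // gerBl exprn_ge0 // invr_ge0.
Qed.

Lemma null_bigcup_count (I : countType) (E : I -> set 'cV[R]_n) : (0 < n)%N ->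
  (forall k, null_set (E k)) -> null_set [set z | exists k, E k z].
Proof.
move=> n0 nE; pose E' k : set 'cV[R]_n := if unpickle k is Some i then E i else set0.
apply: (@null_setS _ [set z | exists k, E' k z]).
  by move=> z [i Ez]; exists (pickle i); rewrite /E' pickleK.
apply: null_bigcup => // k; rewrite /E'; case: (unpickle k) => // .
apply: (@null_lipschitz void set0 (fun _ _ => 0) 1 0) => //.
by rewrite card_void.
Qed.

End NullSets.

(** * Recovering a quaternion from its rotation and its norm *)

Section Quaternions.
Context {R : realType}.

Lemma ord4P (i : 'I_4) : [\/ i = inord 0, i = inord 1, i = inord 2 | i = inord 3].
Proof.
case: i => -[|[|[|[|//]]]] h; [apply: Or41|apply: Or42|apply: Or43|apply: Or44];
  by apply/val_inj; rewrite /= inordK.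
Qed.

Lemma big_ord4 (F : 'I_4 -> R) :
  \sum_i F i = F (inord 0) + F (inord 1) + F (inord 2) + F (inord 3).
Proof.
rewrite !big_ord_recr big_ord0 /= add0r.
by congr (F _ + F _ + F _ + F _); apply/val_inj; rewrite /= inordK.
Qed.

(** These normalized products are affine in the rotation matrix, which thus determines the
    quaternion up to scale and sign. *)
Lemma quat_rot_products (q : 'cV[R]_4) (A : 'M[R]_3) : q != 0 -> A = quat_rot q ->
  let p (a b : nat) := 4 * (q (inord a) 0 * q (inord b) 0 / fsq q) in
  [/\ p 0 0 = 1 + A (inord 0) (inord 0) + A (inord 1) (inord 1) + A (inord 2) (inord 2), p 1 1 = 1 + A (inord 0) (inord 0) - A (inord 1) (inord 1) - A (inord 2) (inord 2),
      p 2 2 = 1 - A (inord 0) (inord 0) + A (inord 1) (inord 1) - A (inord 2) (inord 2), p 3 3 = 1 - A (inord 0) (inord 0) - A (inord 1) (inord 1) + A (inord 2) (inord 2) &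
  [/\ p 0 1 = A (inord 2) (inord 1) - A (inord 1) (inord 2), p 0 2 = A (inord 0) (inord 2) - A (inord 2) (inord 0),
      p 0 3 = A (inord 1) (inord 0) - A (inord 0) (inord 1), p 1 2 = A (inord 0) (inord 1) + A (inord 1) (inord 0) &
      p 1 3 = A (inord 0) (inord 2) + A (inord 2) (inord 0) /\ p 2 3 = A (inord 1) (inord 2) + A (inord 2) (inord 1)]].
Proof.
move=> q0 ->; have : fsq q != 0 by rewrite fsq_eq0.
rewrite fsq_sum big_ord4 !big_ord1.
rewrite /quat_rot !(mxE, inordK) //=.
move: (q (inord 0) 0) (q (inord 1) 0) (q (inord 2) 0) (q (inord 3) 0) => w x y z n0.
by do !split; field.
Qed.

Lemma quarter_close3 (P P' x y z x' y' z' h : R) :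
  4 * P = 1 + x + y + z -> 4 * P' = 1 + x' + y' + z' ->
  `|x - x'| <= h -> `|y - y'| <= h -> `|z - z'| <= h -> `|P - P'| <= h.
Proof.
move=> e e'; rewrite !ler_norml => /andP[a a'] /andP[b b'] /andP[c c'].
by apply/andP; split; lra.
Qed.

Lemma quarter_close2 (P P' x y x' y' h : R) :
  4 * P = x + y -> 4 * P' = x' + y' ->
  `|x - x'| <= h -> `|y - y'| <= h -> `|P - P'| <= h.
Proof.
move=> e e'; rewrite !ler_norml => /andP[a a'] /andP[b b'].
by apply/andP; split; lra.
Qed.

Lemma quat_products_close (q q' : 'cV[R]_4) (h : R) : q != 0 -> q' != 0 ->
  (forall i j, `|quat_rot q i j - quat_rot q' i j| <= h) ->
  forall a b, `|q a 0 * q b 0 / fsq q - q' a 0 * q' b 0 / fsq q'| <= h.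
Proof.
move=> q0 q0' H.
have := quat_rot_products q0 erefl; have := quat_rot_products q0' erefl.
cbv zeta => -[a1 a2 a3 a4 [a5 a6 a7 a8 [a9 a10]]] [b1 b2 b3 b4 [b5 b6 b7 b8 [b9 b10]]].
have HP i j := H (inord i) (inord j).
have HN i j : `|- quat_rot q (inord i) (inord j) - - quat_rot q' (inord i) (inord j)| <= h.
  by rewrite -opprD normrN HP.
have K (x y x' y' : R) : `|x * y / fsq q - x' * y' / fsq q'| <= h -> `|y * x / fsq q - y' * x' / fsq q'| <= h.
  by rewrite (mulrC x) (mulrC x').
have c00 := quarter_close3 b1 a1 (HP 0 0) (HP 1 1) (HP 2 2).
have c11 := quarter_close3 b2 a2 (HP 0 0) (HN 1 1) (HN 2 2).
have c22 := quarter_close3 b3 a3 (HN 0 0) (HP 1 1) (HN 2 2).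
have c33 := quarter_close3 b4 a4 (HN 0 0) (HN 1 1) (HP 2 2).
have c01 := quarter_close2 b5 a5 (HP 2 1) (HN 1 2).
have c02 := quarter_close2 b6 a6 (HP 0 2) (HN 2 0).
have c03 := quarter_close2 b7 a7 (HP 1 0) (HN 0 1).
have c12 := quarter_close2 b8 a8 (HP 0 1) (HP 1 0).
have c13 := quarter_close2 b9 a9 (HP 0 2) (HP 2 0).
have c23 := quarter_close2 b10 a10 (HP 1 2) (HP 2 1).
move=> a b; case: (ord4P a) => ->; case: (ord4P b) => -> //; exact: K.
Qed.

(** On a piece where coordinate [i0] has sign [s] and at least half the norm, the unit quaternion is
    recovered from its products by dividing by [u i0 >= 1/2]; the norm then restores the scale. *)
Lemma quat_lipschitz (q q' : 'cV[R]_4) (i0 : 'I_4) (s h B : R) : q != 0 -> q' != 0 ->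
  s ^+ 2 = 1 -> 0 <= h ->
  Num.sqrt (fsq q) <= 2 * (s * q i0 0) -> Num.sqrt (fsq q') <= 2 * (s * q' i0 0) ->
  Num.sqrt (fsq q') <= B -> `|Num.sqrt (fsq q) - Num.sqrt (fsq q')| <= h ->
  (forall i j, `|quat_rot q i j - quat_rot q' i j| <= h) ->
  forall i, `|q i 0 - q' i 0| <= (1 + 4 * B) * h.
Proof.
move=> q0 q0' s1 h0 hq hq' hB hr H i.
set r := Num.sqrt (fsq q) in hq hr *; set r' := Num.sqrt (fsq q') in hq' hB hr *.
have rp : 0 < r by rewrite sqrtr_gt0 lt_def fsq_eq0 q0 fsq_ge0.
have rp' : 0 < r' by rewrite sqrtr_gt0 lt_def fsq_eq0 q0' fsq_ge0.
have r2 : fsq q = r ^+ 2 by rewrite sqr_sqrtr ?fsq_ge0.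
have r2' : fsq q' = r' ^+ 2 by rewrite sqr_sqrtr ?fsq_ge0.
pose u j := s * q j 0 / r; pose u' j := s * q' j 0 / r'.
have P a b : `|u a * u b - u' a * u' b| <= h.
  have := quat_products_close q0 q0' H a b; rewrite r2 r2'.
  have -> : u a * u b = s ^+ 2 * (q a 0 * q b 0 / r ^+ 2) by rewrite /u; field; rewrite gt_eqF.
  have -> : u' a * u' b = s ^+ 2 * (q' a 0 * q' b 0 / r' ^+ 2) by rewrite /u'; field; rewrite gt_eqF.
  by rewrite s1 !mul1r.
have u0 : 2^-1 <= u i0 by rewrite ler_pdivlMr // ler_pdivrMl //.
have u0' : 2^-1 <= u' i0 by rewrite ler_pdivlMr // ler_pdivrMl //.
have ub' j : `|u' j| <= 1.
  rewrite -(@ler_pXn2r _ 2) ?nnegrE // expr1n real_normK ?num_real //.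
  rewrite /u' !exprMn s1 mul1r exprVn -r2' ler_pdivrMr ?mul1r ?fsq_entry //.
  by rewrite r2' exprn_gt0.
have d0 : `|u i0 - u' i0| <= h.
  have := P i0 i0; have -> : u i0 * u i0 - u' i0 * u' i0 = (u i0 - u' i0) * (u i0 + u' i0) by ring.
  rewrite normrM; apply: le_trans; rewrite ler_peMr // ger0_norm; lra.
have d1 : `|u i - u' i| <= 4 * h.
  have e : (u i - u' i) * u i0 = (u i * u i0 - u' i * u' i0) - u' i * (u i0 - u' i0) by ring.
  have h1 : `|(u i - u' i) * u i0| <= h + h.
    rewrite e; apply: le_trans (ler_normB _ _) _; rewrite lerD ?P // normrM.
    by rewrite -[leRHS]mul1r ler_pM.
  have h2 : `|u i - u' i| * 2^-1 <= `|(u i - u' i) * u i0|.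
    by rewrite normrM ler_wpM2l // (le_trans u0) // ler_norm.
  by lra.
have s1' : `|s| = 1 by apply/eqP; rewrite -(@eqrXn2 _ 2) // expr1n real_normK ?num_real // s1.
have -> : `|q i 0 - q' i 0| = `|(r - r') * u i + r' * (u i - u' i)|.
  rewrite -[LHS]mul1r -s1' -normrM; congr `|_|; rewrite /u /u'; field.
  by rewrite !gt_eqF.
have ub : `|u i| <= 1.
  rewrite -(@ler_pXn2r _ 2) ?nnegrE // expr1n real_normK ?num_real //.
  rewrite /u !exprMn s1 mul1r exprVn -r2 ler_pdivrMr ?mul1r ?fsq_entry //.
  by rewrite r2 exprn_gt0.
apply: le_trans (ler_normD _ _) _; rewrite [`|(r - r') * _|]normrM [`|r' * _|]normrM (gtr0_norm rp').
have h1 : `|r - r'| * `|u i| <= h * 1 by rewrite ler_pM.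
have h2 : r' * `|u i - u' i| <= B * (4 * h) by rewrite ler_pM // ltW.
have -> : (1 + 4 * B) * h = h * 1 + B * (4 * h) by ring.
exact: lerD.
Qed.

(** One of four squares is at least a quarter of their sum, so eight pieces suffice. *)
Lemma quat_piece (q : 'cV[R]_4) : exists (i0 : 'I_4) (b : bool),
  Num.sqrt (fsq q) <= 2 * ((-1) ^+ b * q i0 0).
Proof.
set r := Num.sqrt (fsq q).
have [i0 hi0] : exists i, fsq q <= 4 * q i 0 ^+ 2.
  apply: contrapT => /forallNP h.
  have h' i : 4 * q i 0 ^+ 2 < fsq q by rewrite ltNge; apply/negP; exact: h.
  have := h' (inord 0); have := h' (inord 1); have := h' (inord 2); have := h' (inord 3).
  by rewrite fsq_sum big_ord4 !big_ord1; lra.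
have hr : r <= `|2 * q i0 0|.
  by rewrite -sqrtr_sqr ler_wsqrtr // exprMn; lra.
exists i0, (q i0 0 < 0); apply: le_trans hr _; rewrite normrM ger0_norm //.
rewrite ler_wpM2l //; case: ltrP => h /=.
  by rewrite expr1 mulN1r ltr0_norm.
by rewrite expr0 mul1r ger0_norm.
Qed.

End Quaternions.

(** * The closed loop *)

Section ClosedLoop.
Context {R : realType} {n : nat} {rho : 'I_3 -> R} {rm rM : R}.
Hypotheses (rm0 : 0 < rm) (rhom : forall i, rm <= rho i) (rhoM : forall i, rho i <= rM).
Hypothesis rho_inj : forall i j, i != j -> rho i != rho j.
Context {kR kk lam gam acl : R} {Gam : R -> 'M[R]_(3, n)} {Acl : R -> 'M[R]_n}.
Hypotheses (kR0 : 0 < kR) (kk0 : 0 < kk) (lam0 : 0 < lam) (gam0 : 0 < gam) (acl0 : 0 < acl).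
Hypothesis hGam : forall t, 0 <= t -> fsq (Gam t) <= gam.
Hypothesis hAcl : forall t, 0 <= t -> fsq (Acl t) <= acl.
Hypothesis decay : forall t0 (x : R -> 'cV[R]_n), 0 <= t0 ->
  mder t0 x (fun t => Acl t *m x t) ->
  forall t, t0 <= t -> fsq (x t) <= kk * expR (- lam * (t - t0)) * fsq (x t0).

Let M : 'M[R]_3 := diag_mx (\row_i rho i).

(** [Acl] stands for [A - K C]; the filter is present only through [hGam], [hAcl] and [decay]. *)
Definition closed_loop t0 (F : R -> 'M[R]_3) (x : R -> 'cV[R]_n) :=
  [/\ 0 <= t0, is_SO3 (F t0),
      mder t0 F (fun t => F t *m skew (- (kR *: psi_a (M *m F t)) - Gam t *m x t)) &
      mder t0 x (fun t => Acl t *m x t)].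

Lemma closed_loopW t0 t1 F x : t0 <= t1 -> closed_loop t0 F x -> closed_loop t1 F x.
Proof.
move=> t01 [t00 F0 dF dx]; split; first exact: le_trans t01.
- exact: SO3_invariant dF F0 t1 t01.
- exact: mderW dF.
- exact: mderW dx.
Qed.

Lemma closed_loop_orth t0 F x t : closed_loop t0 F x -> t0 <= t -> (F t)^T *m F t = 1%:M.
Proof. by move=> [t00 F0 dF dx] tt; have [] := SO3_invariant dF F0 tt. Qed.

Let sgn (k i : 'I_3) : R := if i == k then 1 else -1.
(** Weights seen from the half-turn: for [Z = flip k *m F] the gradient term is that of the diagonal
    matrix with entries [mk k i], see [mk_flip]. *)
Let mk (k i : 'I_3) : R := rho i * sgn k i.

Lemma norm_sgn k i : `|sgn k i| <= 1.
Proof. by rewrite /sgn; case: ifP => _; rewrite ?normrN1 ?normr1. Qed.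

Lemma norm_mk k i : `|mk k i| <= rM.
Proof.
rewrite normrM -[leRHS]mulr1 ler_pM ?norm_sgn //.
by rewrite gtr0_norm ?rhoM // (lt_le_trans rm0).
Qed.

Lemma sgn_sq k i : sgn k i * sgn k i = 1.
Proof. by rewrite /sgn; case: ifP => _; rewrite ?mulrNN mulr1. Qed.

Lemma flip_entry k (A : 'M[R]_3) i j : (flip k *m A) i j = sgn k i * A i j.
Proof. exact: (entry_diag_mulmx (rho := sgn k)). Qed.

Lemma flip_mul k (A : 'M[R]_3) : flip k *m (flip k *m A) = A.
Proof.
apply/matrixP => i j; rewrite !flip_entry mulrA.
by rewrite sgn_sq mul1r.
Qed.

Lemma flip_tr k : (flip k)^T = flip k :> 'M[R]_3.
Proof. exact: tr_diag_mx. Qed.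

Lemma flip_orth k (A : 'M[R]_3) : A^T *m A = 1%:M -> (flip k *m A)^T *m (flip k *m A) = 1%:M.
Proof. by move=> AA; rewrite trmx_mul flip_tr -mulmxA flip_mul. Qed.

Lemma mk_flip k (A : 'M[R]_3) : diag_mx (\row_i mk k i) *m (flip k *m A) = M *m A.
Proof.
apply/matrixP => i j; rewrite entry_diag_mulmx flip_entry entry_diag_mulmx /mk mulrA -(mulrA (rho i)).
by rewrite sgn_sq mulr1.
Qed.

Lemma norm_flip_mul k (A : 'M[R]_3) : `|flip k *m A| <= `|A|.
Proof. by rewrite -[leRHS]mul1r; apply: (norm_diag_mul (m := sgn k)); exact: norm_sgn. Qed.

Lemma norm_flip_sub k (A : 'M[R]_3) : `|flip k *m A - 1%:M| <= `|A - flip k|.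
Proof.
have -> : flip k *m A - 1%:M = flip k *m (A - flip k) :> 'M[R]_3.
  by rewrite mulmxBr -[in X in _ - X = _](flip_mul k 1%:M) mulmx1.
exact: norm_flip_mul.
Qed.

(** The gain along [e_k] is minus half the sum of the other two [rho], hence an expanding rate.
    Along another axis it is half a difference of two [rho], nonzero by distinctness but of either
    sign. *)
Lemma flip_gains k : exists2 al, 0 < al &
  (forall i, al <= `|- (kR * gain (m := mk k) i)|) /\ 0 < - (kR * gain (m := mk k) k).
Proof.
have rho0 i : 0 < rho i := lt_le_trans rm0 (rhom i).
have r0 := rho0 (inord 0); have r1 := rho0 (inord 1); have r2 := rho0 (inord 2).
have [[[[[n01 n02] n10] n12] n20] n21] := inord3_neq.
have d01 : rho (inord 0) - rho (inord 1) != 0 by rewrite subr_eq0 rho_inj // n01.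
have d02 : rho (inord 0) - rho (inord 2) != 0 by rewrite subr_eq0 rho_inj // n02.
have d12 : rho (inord 1) - rho (inord 2) != 0 by rewrite subr_eq0 rho_inj // n12.
have gk : gain (m := mk k) k < 0.
  rewrite /gain /mk /sgn.
  by case: (ord3P k) => ->; rewrite ?n01 ?n02 ?n10 ?n12 ?n20 ?n21 ?eqxx; lra.
have gi i : gain (m := mk k) i != 0.
  rewrite /gain /mk /sgn; apply/eqP.
  by case: (ord3P k) => ->; case: (ord3P i) => ->; rewrite ?n01 ?n02 ?n10 ?n12 ?n20 ?n21 ?eqxx => h;
    move: d01 d02 d12 => /eqP d01 /eqP d02 /eqP d12;
    (try by [apply: d01; lra]); (try by [apply: d02; lra]); (try by [apply: d12; lra]); lra.
have ai i : 0 < `|- (kR * gain (m := mk k) i)|.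
  by rewrite normr_gt0 oppr_eq0 mulf_neq0 ?gi // gt_eqF.
exists (Num.min `|- (kR * gain (m := mk k) (inord 0))|
  (Num.min `|- (kR * gain (m := mk k) (inord 1))| `|- (kR * gain (m := mk k) (inord 2))|)).
  by rewrite !lt_min !ai.
split; last by rewrite oppr_gt0 pmulr_rlt0.
by move=> i; case: (ord3P i) => ->; rewrite !ge_min lexx ?orbT.
Qed.

Let y (k : 'I_3) (F : R -> 'M[R]_3) t := psi_a (flip k *m F t).

(** Since direction [k] is among the expanding ones, the cone inequality bounds its square by the
    squares of the other two coordinates and the distance of the [x] parts, whatever the signs of
    the other rates. *)
Lemma trapped_forward k : exists eps c : R, [/\ 0 < eps, 0 < c & 
  forall T F1 x1 F2 x2 h, closed_loop T F1 x1 -> closed_loop T F2 x2 ->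
  (forall t, T <= t -> `|F1 t - flip k| <= eps) -> (forall t, T <= t -> `|F2 t - flip k| <= eps) ->
  (forall t, T <= t -> `|Gam t *m x2 t| <= eps) ->
  (forall j, j != k -> `|y k F1 T j 0 - y k F2 T j 0| <= h) ->
  fsq (x1 T - x2 T) <= n%:R * h ^+ 2 ->
  fsq (F1 T - F2 T) <= c * h ^+ 2].
Proof.
have [al al0 [ha hk]] := flip_gains k.
have rM0 : 0 < rM := lt_le_trans (lt_le_trans rm0 (rhom k)) (rhoM k).
pose ce := 18 * (kR * rM) + 6.
have ce0 : 0 < ce by rewrite addr_gt0 // mulr_gt0 // mulr_gt0.
(* [6^-1] is what [orth_pair] asks; the other term brings the relative error down to the [al / 12]
   of [cone_growth]. *)
pose eps := Num.min 6^-1 (al / (12 * ce)).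
have eps0 : 0 < eps by rewrite lt_min invr_gt0 ltr0n divr_gt0 // mulr_gt0.
have e6 : eps <= 6^-1 by rewrite ge_min lexx.
have eal : ce * eps <= al / 12.
  apply: (@le_trans _ _ (ce * (al / (12 * ce)))).
    by rewrite ler_wpM2l ?(ltW ce0) // ge_min lexx orbT.
  by rewrite le_eqVlt; apply/orP; left; apply/eqP; field; rewrite gt_eqF.
pose kap := 6 / (al * lam); have kap0 : 0 < kap by rewrite divr_gt0 // mulr_gt0.
pose g := 4 * gam * kk; have g0 : 0 < g by rewrite !mulr_gt0.
have gn0 : 0 <= kap * (g * n%:R).
  by apply: mulr_ge0; [exact: ltW|apply: mulr_ge0; [exact: ltW|exact: ler0n]].
(* 36 is nine entries times the squared factor 2 of [orth_pair]; 4 counts twice the two coordinates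
   other than [k]. *)
exists eps, (36 * (4 + kap * (g * n%:R))); split=> //.
  by apply: mulr_gt0 => //; apply: ltr_wpDr.
move=> T F1 x1 F2 x2 h s1 s2 n1 n2 nd hy hx.
have [T0 _ dF1 dx1] := s1; have [_ _ dF2 dx2] := s2.
pose u1 t := - (kR *: psi_a (M *m F1 t)) - Gam t *m x1 t.
pose u2 t := - (kR *: psi_a (M *m F2 t)) - Gam t *m x2 t.
pose Z1 t := flip k *m F1 t; pose Z2 t := flip k *m F2 t.
have o1 t : T <= t -> (Z1 t)^T *m Z1 t = 1%:M by move=> Tt; apply: flip_orth; exact: closed_loop_orth s1 Tt.
have o2 t : T <= t -> (Z2 t)^T *m Z2 t = 1%:M by move=> Tt; apply: flip_orth; exact: closed_loop_orth s2 Tt.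
have z1 t : T <= t -> `|Z1 t - 1%:M| <= eps by move=> Tt; apply: le_trans (norm_flip_sub _ _) (n1 t Tt).
have z2 t : T <= t -> `|Z2 t - 1%:M| <= eps by move=> Tt; apply: le_trans (norm_flip_sub _ _) (n2 t Tt).
pose Y t := psi_a (Z1 t) - psi_a (Z2 t).
pose Y' t := psi_a (Z1 t *m skew (u1 t)) - psi_a (Z2 t *m skew (u2 t)).
have dY : mder T Y Y'.
  have d1 := mder_psi (mderMl (flip k) dF1); have d2 := mder_psi (mderMl (flip k) dF2).
  by apply: eq_mder (mderB d1 d2) => [t _|//]; rewrite /Y' /Z1 /Z2 -!mulmxA.
pose D := g * fsq (x1 T - x2 T).
have D0 : 0 <= D := mulr_ge0 (ltW g0) (fsq_ge0 _).
pose del t := 2 * `|Gam t *m x1 t - Gam t *m x2 t|.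
have hdel t : T <= t -> del t ^+ 2 <= D * expR (- lam * (t - T)).
  move=> Tt; have t0 := le_trans T0 Tt.
  rewrite /del exprMn -mulmxBr.
  have dxx : mder T (fun t => x1 t - x2 t) (fun t => Acl t *m (x1 t - x2 t)).
    by apply: eq_mder (mderB dx1 dx2) => // s _; rewrite mulmxBr.
  have h1 := decay T0 dxx Tt.
  have h2 := mx_norm_sq_le (Gam t *m (x1 t - x2 t)).
  have h3 := fsq_mul_le (hGam t0) h1.
  have h4 := le_trans h2 h3.
  have -> : D * expR (- lam * (t - T)) = 4 * (gam * (kk * expR (- lam * (t - T)) * fsq (x1 T - x2 T))).
    by rewrite /D /g; ring.
  by rewrite -natrX ler_wpM2l.
have Yb t : T <= t -> fsq (Y t) <= 12.
  move=> Tt; apply: le_trans (fsqD_le _ _) _; rewrite fsqN.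
  have := fsq_psi_le (Z1 t); have := fsq_psi_le (Z2 t).
  by rewrite (fsq_orth (o1 t Tt)) (fsq_orth (o2 t Tt)); lra.
have step t i : T <= t ->
    `|Y' t i 0 - (- (kR * gain (m := mk k) i)) * Y t i 0| <= ce * eps * `|Y t| + del t.
  move=> Tt.
  have eu1 : u1 t = - (kR *: psi_a (diag_mx (\row_i mk k i) *m Z1 t)) - Gam t *m x1 t.
    by rewrite mk_flip.
  have eu2 : u2 t = - (kR *: psi_a (diag_mx (\row_i mk k i) *m Z2 t)) - Gam t *m x2 t.
    by rewrite mk_flip.
  exact: (cone_step (norm_mk k) kR0 e6 i eu1 eu2 (erefl (Y t)) (o1 t Tt) (o2 t Tt) (z1 t Tt) (z2 t Tt) (nd t Tt)).
have ce_eps0 : 0 <= ce * eps by rewrite mulr_ge0 // ltW.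
have := cone_growth al0 lam0 D0 ce_eps0 eal ha dY Yb step hdel.
rewrite -/kap => H.
have YT j : j != k -> Y T j 0 ^+ 2 <= h ^+ 2.
  move=> jk; have := hy j jk; rewrite /Y entryD entryN => h1.
  by rewrite -real_normK ?num_real // lerXn2r ?nnegrE // (le_trans _ h1).
have DT : kap * D <= kap * (g * n%:R) * h ^+ 2.
  have -> : kap * (g * n%:R) * h ^+ 2 = kap * (g * (n%:R * h ^+ 2)) by ring.
  by apply: (ler_wpM2l (ltW kap0)); exact: (ler_wpM2l (ltW g0)).
have fY : fsq (Y T) <= (4 + kap * (g * n%:R)) * h ^+ 2.
  have fE : fsq (Y T) = \sum_i Y T i 0 ^+ 2 by rewrite fsq_sum; apply: eq_bigr => i _; rewrite big_ord1.
  rewrite fE (bigD1 k) //=; move: H; rewrite (bigD1 k) //= hk mul1r => H.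
  have h1 : - \sum_(i | i != k) Y T i 0 ^+ 2 <=
      \sum_(i | i != k) (if 0 < - (kR * gain (m := mk k) i) then 1 else -1) * Y T i 0 ^+ 2.
    rewrite -sumrN; apply: ler_sum => i _; case: ifP => _; last by rewrite mulN1r.
    by rewrite mul1r; have := sqr_ge0 (Y T i 0); lra.
  have h2 : \sum_(i | i != k) Y T i 0 ^+ 2 <= 2 * h ^+ 2.
    apply: (@le_trans _ _ (\sum_(i < 3 | i != k) h ^+ 2)); first exact: ler_sum.
    by rewrite sumr_const cardC1 card_ord /= mulr_natl.
  by move: H h1 h2 DT; lra.
have [hZ _] := orth_pair e6 (o1 T (lexx T)) (o2 T (lexx T)) (z1 T (lexx T)) (z2 T (lexx T)).
rewrite psiB -/(Y T) in hZ.
have hF : `|F1 T - F2 T| <= 2 * `|Y T|.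
  apply: le_trans hZ; rewrite /Z1 /Z2 -mulmxBr -[X in `|X| <= _](flip_mul k).
  exact: norm_flip_mul.
apply: le_trans (fsq_le_norm _) _.
have h1 : `|F1 T - F2 T| ^+ 2 <= 4 * `|Y T| ^+ 2.
  have -> : 4 * `|Y T| ^+ 2 = (2 * `|Y T|) ^+ 2 by ring.
  by rewrite lerXn2r ?nnegrE // mulr_ge0.
have h2 := mx_norm_sq_le (Y T).
by rewrite (_ : (3 * 3)%:R = 9) //; move: h1 h2 fY; lra.
Qed.

(** Reversed Gronwall: the squared distance shrinks at rate at most [K]. The product of [F] with the
    input makes the rate depend on the size of one of the two inputs, hence the bound [B] on
    [x1 t0]. *)
Lemma backward_lipschitz t0 T B : 0 <= t0 -> t0 <= T -> 0 <= B -> exists2 L, 0 < L &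
  forall F1 x1 F2 x2, closed_loop t0 F1 x1 -> closed_loop t0 F2 x2 -> fsq (x1 t0) <= B ->
  fsq (F1 t0 - F2 t0) + fsq (x1 t0 - x2 t0) <= L * (fsq (F1 T - F2 T) + fsq (x1 T - x2 T)).
Proof.
move=> t00 tT B0.
pose m := fsq M * 3; have m0 : 0 <= m := mulr_ge0 (fsq_ge0 M) (ler0n _ 3).
have k20 : 0 <= kR ^+ 2 := sqr_ge0 kR.
pose U := 2 * (kR ^+ 2 * m + gam * (kk * B)).
pose K := 1 + 4 * U + 12 * (2 * (kR ^+ 2 * fsq M + gam)) + acl.
exists (expR (K * (T - t0))); first exact: expR_gt0.
move=> F1 x1 F2 x2 s1 s2 xB.
have [_ _ dF1 dx1] := s1; have [_ _ dF2 dx2] := s2.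
pose dF t := F1 t - F2 t; pose dx t := x1 t - x2 t.
have der1 := derD (der_fsq (mderB dF1 dF2)) (der_fsq (mderB dx1 dx2)).
have := gronwall_ge der1 (lexx t0) tT (c := - K).
move=> /(_ _)/wrap[r tr rT|]; last first.
  rewrite mulNr expRN ler_pdivrMl ?expR_gt0 //.
have rr := ltW tr; have r0 := le_trans t00 rr.
rewrite -/(dF r) -/(dx r).
pose u1 := - (kR *: psi_a (M *m F1 r)) - Gam r *m x1 r.
pose u2 := - (kR *: psi_a (M *m F2 r)) - Gam r *m x2 r.
rewrite -/u1 -/u2.
have hu1 : fsq u1 <= U.
  apply: le_trans (fsqD_le _ _) _; rewrite !fsqN fsqZ ler_wpM2l // lerD //.
    rewrite ler_wpM2l //; apply: le_trans (fsq_psi_le _) _.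
    by apply: fsq_mul_le => //; rewrite (fsq_orth (closed_loop_orth s1 rr)).
  apply: fsq_mul_le; first exact: hGam.
  apply: le_trans (decay t00 dx1 rr) _; rewrite -mulrA ler_wpM2l ?(ltW kk0) //.
  rewrite -[leRHS]mul1r ler_pM ?expR_ge0 ?fsq_ge0 // -expR0 ler_expR.
  by rewrite mulNr oppr_le0 mulr_ge0 ?(ltW lam0) // subr_ge0.
have hdu : fsq (u1 - u2) <= 2 * (kR ^+ 2 * (fsq M * fsq (dF r)) + gam * fsq (dx r)).
  have -> : u1 - u2 = - (kR *: psi_a (M *m dF r)) - Gam r *m dx r.
    rewrite /u1 /u2 /dF /dx !mulmxBr psiB.
    by apply/matrixP => a b; rewrite !(entryD, entryN, entryZ); ring.
  apply: le_trans (fsqD_le _ _) _; rewrite !fsqN fsqZ ler_wpM2l // lerD //.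
    by rewrite ler_wpM2l //; apply: le_trans (fsq_psi_le _) _; exact: fsq_mul.
  by apply: fsq_mul_le => //; exact: hGam.
have e1 : F1 r *m skew u1 - F2 r *m skew u2 = dF r *m skew u1 + F2 r *m skew (u1 - u2).
  rewrite (skewB u1 u2) /dF mulmxBl mulmxBr.
  by apply/matrixP => a b; rewrite !(entryD, entryN); ring.
have h1 : fsq (F1 r *m skew u1 - F2 r *m skew u2) <=
    2 * (fsq (dF r) * (2 * U) + 3 * (2 * fsq (u1 - u2))).
  rewrite e1; apply: le_trans (fsqD_le _ _) _; rewrite ler_wpM2l // lerD //.
    by apply: fsq_mul_le => //; rewrite fsq_skew ler_wpM2l.
  by apply: fsq_mul_le; rewrite ?fsq_skew // (fsq_orth (closed_loop_orth s2 rr)).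
have h2 : fsq (Acl r *m x1 r - Acl r *m x2 r) <= acl * fsq (dx r).
  by rewrite -mulmxBr; apply: fsq_mul_le => //; exact: hAcl.
have y1 := fdot_young (dF r) (- (F1 r *m skew u1 - F2 r *m skew u2)) ltr01.
have y2 := fdot_young (dx r) (- (Acl r *m x1 r - Acl r *m x2 r)) ltr01.
rewrite fdotNr fsqN invr1 !mul1r in y1; rewrite fdotNr fsqN invr1 !mul1r in y2.
have f1 := fsq_ge0 (dF r); have f2 := fsq_ge0 (dx r).
have g1 : 0 <= U * fsq (dx r).
  apply: mulr_ge0 => //; apply: mulr_ge0 => //; apply: addr_ge0; first exact: mulr_ge0.
  by apply: mulr_ge0; [exact: ltW|apply: mulr_ge0 => //; exact: ltW].
have g2 : 0 <= kR ^+ 2 * fsq M * fsq (dx r) by apply: mulr_ge0 => //; apply: mulr_ge0 => //; exact: fsq_ge0.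
have g3 : 0 <= gam * fsq (dF r) by apply: mulr_ge0 => //; exact: ltW.
have g4 : 0 <= acl * fsq (dF r) by apply: mulr_ge0 => //; exact: ltW.
rewrite /K; move: y1 y2 h1 h2 hdu g1 g2 g3 g4 f1 f2; move: (kR ^+ 2) => k2.
set a1 := fsq (dF r); set a2 := fsq (dx r); set a3 := fsq (u1 - u2).
set a4 := fsq (_ *m _ - _); set a5 := fsq (_ - _); set b1 := fdot _ _; set b2 := fdot _ _.
by move: a1 a2 a3 a4 a5 b1 b2 => a1 a2 a3 a4 a5 b1 b2; lra.
Qed.

(** [B] bounds the parameters, as [null_lipschitz] requires; [i0] and [b] select the piece on which
    the quaternion can be recovered. *)
Definition trapped k eps t0 T B i0 (b : bool) : set 'cV[R]_(4 + n) :=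
  [set z | [/\ usubmx z != 0, Num.sqrt (fsq (usubmx z)) <= 2 * ((-1) ^+ b * usubmx z i0 0),
      Num.sqrt (fsq (usubmx z)) <= B, fsq (dsubmx z) <= B &
      exists F x, [/\ closed_loop t0 F x, F t0 = quat_rot (usubmx z), x t0 = dsubmx z,
        forall t, T <= t -> `|F t - flip k| <= eps &
        forall t, T <= t -> `|Gam t *m x t| <= eps]]].

Lemma orth_norm (A : 'M[R]_3) : A^T *m A = 1%:M -> `|A| <= 1.
Proof.
move=> AA; apply: mx_norm_le => // i j.
by rewrite -(@ler_pXn2r _ 2) ?nnegrE // expr1n real_normK ?num_real // orth_entry.
Qed.

Lemma ler_of_sqr (X C d : R) : 0 <= C -> 0 <= d -> X ^+ 2 <= C * d ^+ 2 -> X <= (1 + C) * d.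
Proof.
move=> C0 d0 H; have Cd : 0 <= (1 + C) * d by rewrite mulr_ge0 // addr_ge0.
rewrite leNgt; apply/negP => h; have : ((1 + C) * d) ^+ 2 < X ^+ 2.
  by rewrite ltrXn2r // nnegrE // (le_trans Cd) // ltW.
have : 0 <= (1 + C + C ^+ 2) * d ^+ 2.
  by rewrite mulr_ge0 ?sqr_ge0 // addr_ge0 ?sqr_ge0 // addr_ge0.
by rewrite exprMn sqrrD expr1n; lra.
Qed.

(* A trapped initial state is a Lipschitz function of one coordinate fewer than the dimension:
   the norm of the quaternion and, at time [T], all coordinates except the expanding one of index
   [k]. *)
Lemma trapped_null k : exists2 eps, 0 < eps & forall t0 T B i0 b,
  0 <= t0 -> t0 <= T -> 0 < B -> null_set (trapped k eps t0 T B i0 b).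
Proof.
have [eps [c [eps0 c0 Hf]]] := trapped_forward k; exists eps => // t0 T B i0 b t00 tT B0.
have [L L0 HL] := backward_lipschitz t00 tT (ltW B0).
pose s : R := (-1) ^+ b; have s2 : s ^+ 2 = 1 by rewrite /s sqrr_sign.
pose E := trapped k eps t0 T B i0 b.
(* One trajectory is chosen for each trapped state, which makes the parameters [pi] functions of the
   state. *)
have pick z : exists Fx : (R -> 'M[R]_3) * (R -> 'cV[R]_n), E z ->
    [/\ closed_loop t0 Fx.1 Fx.2, Fx.1 t0 = quat_rot (usubmx z), Fx.2 t0 = dsubmx z,
        forall t, T <= t -> `|Fx.1 t - flip k| <= eps &
        forall t, T <= t -> `|Gam t *m Fx.2 t| <= eps].
  have [[_ _ _ _ [F [x H]]]|nE] := pselect (E z); first by exists (F, x).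
  by exists (fun=> 0, fun=> 0).
pose FF z := (sval (cid (pick z))).1; pose xx z := (sval (cid (pick z))).2.
have FxP z (Ez : E z) := svalP (cid (pick z)) Ez.
pose J := option ('I_2 + 'I_n).
pose pi z (j : J) : R := match j with
  | None => Num.sqrt (fsq (usubmx z))
  | Some (inl a) => y k (FF z) T (lift k a) 0
  | Some (inr a) => xx z T a 0 end.
pose c1 := L * (c + n%:R); have c10 : 0 <= c1 by rewrite mulr_ge0 ?(ltW L0) // addr_ge0 ?(ltW c0) ?ler0n.
have c1p : 1 <= 1 + c1 by rewrite lerDl.
have kB0 : 0 <= kk * B by rewrite mulr_ge0 // ltW.
apply: (@null_lipschitz _ _ J E pi (B + 1 + (1 + kk * B)) ((1 + 4 * B) * (1 + c1))).
- by rewrite card_option card_sum !card_ord !addSn add0n !ltnS.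
- by move: B0 kB0; lra.
- by apply: mulr_ge0; [move: B0; lra|move: c10; lra].
- move=> z j Ez; have [_ _ hB xB _] := Ez; have [sz Fz xz _ _] := FxP z Ez.
  case: j => [[a|a]|] /=.
  + have oF : (FF z T)^T *m FF z T = 1%:M := closed_loop_orth sz tT.
    have := orth_norm (flip_orth k oF); have := norm_psi (flip k *m FF z T).
    have := mx_norm_entry (psi_a (flip k *m FF z T)) (lift k a) 0.
    by rewrite -/(y k (FF z) T); lra.
  + have [_ _ _ dx] := sz; have h1 := decay t00 dx tT.
    have h2 := fsq_entry (xx z T) a 0.
    have h3 : fsq (xx z T) <= kk * B.
      apply: le_trans h1 _; rewrite -mulrA ler_wpM2l ?(ltW kk0) //.
      rewrite -[leRHS]mul1r ler_pM ?expR_ge0 ?fsq_ge0 //; last by rewrite xz.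
      by rewrite -expR0 ler_expR mulNr oppr_le0 mulr_ge0 ?(ltW lam0) // subr_ge0.
    have h4 := le_trans h2 h3.
    have : `|xx z T a 0| <= (1 + kk * B) * 1.
      by apply: ler_of_sqr => //; rewrite expr1n mulr1 real_normK ?num_real.
    by have := ltW B0; lra.
  + rewrite ger0_norm ?sqrtr_ge0 //; apply: le_trans hB _.
    by move: kB0; lra.
move=> z z' h Ez Ez' hj i.
have h0 : 0 <= h := le_trans (normr_ge0 _) (hj None).
have [q0 qs qB xB _] := Ez; have [q0' qs' qB' xB' _] := Ez'.
have [sz Fz xz nz gz] := FxP z Ez; have [sz' Fz' xz' nz' gz'] := FxP z' Ez'.
rewrite -/(FF z) -/(xx z) in sz Fz xz nz gz; rewrite -/(FF z') -/(xx z') in sz' Fz' xz' nz' gz'.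
have hx : fsq (xx z T - xx z' T) <= n%:R * h ^+ 2.
  rewrite fsq_sum; have -> : n%:R * h ^+ 2 = \sum_(a < n) h ^+ 2.
    by rewrite sumr_const card_ord mulr_natl.
  apply: ler_sum => a _; rewrite big_ord1 entryD entryN -real_normK ?num_real //.
  by rewrite lerXn2r ?nnegrE //; exact: (hj (Some (inr a))).
have hF : fsq (FF z T - FF z' T) <= c * h ^+ 2.
  apply: (Hf T (FF z) (xx z) (FF z') (xx z')) => //; try exact: (closed_loopW tT).
  move=> j jk; case: (unliftP k j) => [a ->|ej]; last by rewrite ej eqxx in jk.
  exact: (hj (Some (inl a))).
have hL : fsq (FF z t0 - FF z' t0) + fsq (xx z t0 - xx z' t0) <= c1 * h ^+ 2.
  apply: le_trans (HL _ _ _ _ sz sz' _) _; first by rewrite xz.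
  rewrite /c1 -mulrA ler_wpM2l ?(ltW L0) // mulrDl; exact: lerD.
have f1 := fsq_ge0 (FF z t0 - FF z' t0); have f2 := fsq_ge0 (xx z t0 - xx z' t0).
have hc : h <= (1 + c1) * h by rewrite ler_peMl.
have nF : `|FF z t0 - FF z' t0| <= (1 + c1) * h.
  apply: ler_of_sqr => //; apply: le_trans (mx_norm_sq_le _) (le_trans _ hL).
  by rewrite lerDl.
have nx : `|xx z t0 - xx z' t0| <= (1 + c1) * h.
  apply: ler_of_sqr => //; apply: le_trans (mx_norm_sq_le _) (le_trans _ hL).
  by rewrite lerDr.
rewrite -(vsubmxK z) -(vsubmxK z') -mulrA; case: (split_ordP i) => a ->.
  rewrite !col_mxEu; apply: (quat_lipschitz (i0 := i0) q0 q0' s2 _ qs qs' qB').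
  - exact: le_trans hc.
  - exact: le_trans (hj None) hc.
  - move=> u v; apply: le_trans nF; apply: le_trans (mx_norm_entry _ u v).
    by rewrite Fz Fz' entryD entryN.
rewrite !col_mxEd; apply: (@le_trans _ _ ((1 + c1) * h)).
  apply: le_trans nx; apply: le_trans (mx_norm_entry _ a 0).
  by rewrite xz xz' entryD entryN.
apply: ler_peMl; first by apply: mulr_ge0 => //; exact: le_trans c1p.
by rewrite lerDl mulr_ge0 // ltW.
Qed.

Lemma input_decay t0 F x : closed_loop t0 F x -> 0 <= gam * kk * fsq (x t0) /\
  forall t, t0 <= t -> fsq (Gam t *m x t) <= gam * kk * fsq (x t0) * expR (- lam * (t - t0)).
Proof.
move=> [t00 _ _ dx]; split; first by rewrite !mulr_ge0 ?fsq_ge0 // ltW.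
move=> t tt; apply: le_trans (fsq_mul_le (hGam (le_trans t00 tt)) (decay t00 dx tt)) _.
by rewrite le_eqVlt; apply/orP; left; apply/eqP; ring.
Qed.

Lemma exp_decay_lt (K eta : R) t0 : 0 <= K -> 0 < eta ->
  exists2 T, t0 <= T & forall t, T <= t -> K * expR (- lam * (t - t0)) < eta.
Proof.
move=> K0 eta0; exists (t0 + K / (eta * lam)).
  by rewrite lerDl divr_ge0 // mulr_ge0 // ltW.
move=> t; rewrite -lerBrDl => ht; rewrite mulNr expRN ltr_pdivrMr ?expR_gt0 //.
have h1 : K <= eta * (lam * (t - t0)) by move: ht; rewrite ler_pdivrMr ?mulr_gt0 //; lra.
apply: le_lt_trans h1 _; rewrite ltr_pM2l //.
apply: lt_le_trans (expR_ge1Dx _); by rewrite ltrDr.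
Qed.

(** Once [F t] is close to [signmx (F t)], its diagonal entries cannot vanish, so by continuity
    their signs freeze: the trajectory converges to a single equilibrium and not merely to the set
    of them. *)
Lemma closed_loop_cvg t0 F x : closed_loop t0 F x ->
  exists2 S : 'M[R]_3, (S = 1%:M \/ exists k, S = flip k) &
    forall eta, 0 < eta -> exists2 T, t0 <= T & forall t, T <= t ->
      [/\ fsq (F t - S) < eta, fsq (x t) < eta & fsq (Gam t *m x t) < eta].
Proof.
move=> s; have [t00 F0 dF dx] := s; have [D0 hD] := input_decay s.
have near eta : 0 < eta -> exists2 T, t0 <= T & forall t, T <= t -> fsq (F t - signmx (F t)) < eta.
  exact: (rotation_near_signmx rm0 rhom rho_inj kR0 lam0 D0 dF F0 hD).
have e10 : 0 < 10^-1 :> R by rewrite invr_gt0.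
have [T tT HT] := near _ e10.
have cF : cont_from T F := cont_fromW tT (mder_cont dF).
have nz i t : T <= t -> F t i i != 0.
  move=> Tt; apply/eqP => Fi; have := HT t Tt; have := fsq_entry (F t - signmx (F t)) i i.
  by rewrite entryD entryN signmxE eqxx Fi lexx mulr1n => h1 h2; lra.
have sg t : T <= t -> signmx (F t) = signmx (F T).
  move=> Tt; apply/matrixP => i j; rewrite !signmxE; congr (_ *+ _).
  have c1 : cont_from T (fun t => F t i i) by exact: ((cont_from_mxP _ _).1 cF).
  have [p|p|p] := ltrgtP 0 (F T i i).
  - have p1 : 0 < F t i i := cont_from_pos c1 (nz i) p Tt.
    by rewrite (ltW p1).
  - have p1 : 0 < - F t i i.
      apply: (cont_from_pos (cont_fromN c1) _ _ Tt); last by rewrite oppr_gt0.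
      by move=> u Tu; rewrite oppr_eq0 nz.
    by rewrite leNgt -oppr_gt0 p1.
  - by have := nz i T (lexx T); rewrite -p eqxx.
exists (signmx (F T)).
  by apply: signmx_SO3; [exact: SO3_invariant dF F0 T tT|exact: ltW (HT T (lexx T))].
move=> eta eta0; have [T1 tT1 H1] := near eta eta0.
have kx0 : 0 <= kk * fsq (x t0) by rewrite mulr_ge0 ?fsq_ge0 // ltW.
have [T2 tT2 H2] := exp_decay_lt t0 kx0 eta0; have [T3 tT3 H3] := exp_decay_lt t0 D0 eta0.
exists (Num.max T (Num.max T1 (Num.max T2 T3))); first by rewrite le_max tT.
move=> t; rewrite !ge_max => /and4P[u0 u1 u2 u3]; split.
- by rewrite -(sg t u0); exact: H1.
- apply: le_lt_trans (H2 t u2); rewrite mulrAC; apply: decay => //; exact: le_trans tT2 u2.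
- apply: le_lt_trans (H3 t u3); apply: hD; exact: le_trans tT3 u3.
Qed.

(** The input envelope is of second order in the initial distance, as is [fsq (1%:M - F t0)]; taking
    square roots gives an estimate linear in this distance and halves the rate. *)
Lemma closed_loop_exp_stable : exists r k l : R, [/\ 0 < r, 0 < k, 0 < l &
  forall t0 F x, closed_loop t0 F x -> `|F t0 - 1%:M| + `|x t0| < r ->
  forall t, t0 <= t -> `|F t - 1%:M| + `|x t| <=
    k * expR (- (l * (t - t0))) * (`|F t0 - 1%:M| + `|x t0|)].
Proof.
have [r [c [l [r0 c0 l0 H]]]] := rotation_exp_stable rm0 rhom rhoM rho_inj kR0 lam0.
pose C1 := 9 + gam * kk * n%:R.
have gk0 : 0 < gam * kk by rewrite mulr_gt0.
have C10 : 0 < C1 by rewrite ltr_wpDr // mulr_ge0 // ?ler0n // ltW.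
pose l2 := Num.min l lam / 2; have l20 : 0 < l2 by rewrite divr_gt0 // lt_min l0.
have cC0 : 0 <= c * C1 by rewrite mulr_ge0 // ltW.
have kn0 : 0 <= kk * n%:R by rewrite mulr_ge0 // ?ler0n // ltW.
exists (Num.min 1 (r / C1)), ((1 + c * C1) + (1 + kk * n%:R)), l2; split=> //.
- by rewrite lt_min ltr01 divr_gt0.
- by rewrite addr_gt0 // ltr_wpDr.
move=> t0 F x s; set d := _ + _; rewrite lt_min => /andP[d1 dr] t tt.
have [t00 F0 dF dx] := s; have [D0 hD] := input_decay s.
have d0 : 0 <= d by rewrite addr_ge0.
have dF0 : fsq (1%:M - F t0) <= 9 * d ^+ 2.
  apply: le_trans (fsq_le_norm _) _; rewrite distrC ler_wpM2l // lerXn2r ?nnegrE //.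
  by rewrite lerDl.
have dx0 : fsq (x t0) <= n%:R * d ^+ 2.
  apply: le_trans (fsq_le_norm _) _; rewrite muln1 ler_wpM2l ?ler0n // lerXn2r ?nnegrE //.
  by rewrite lerDr.
have hC : fsq (1%:M - F t0) + gam * kk * fsq (x t0) <= C1 * d ^+ 2.
  by rewrite mulrDl lerD // -[leRHS]mulrA ler_wpM2l // ltW.
have hr : fsq (1%:M - F t0) + gam * kk * fsq (x t0) <= r.
  apply: le_trans hC _; rewrite mulrC -ler_pdivlMr //; apply: le_trans (ltW dr).
  by rewrite expr2 ler_piMl // ltW.
have HF := H t0 _ F _ D0 dF F0 hD hr t tt.
pose e := expR (- (l2 * (t - t0))); have e0 : 0 < e by exact: expR_gt0.
have tt0 : 0 <= t - t0 by rewrite subr_ge0.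
have el (q : R) : 2 * l2 <= q -> expR (- q * (t - t0)) <= e ^+ 2.
  move=> /(ler_wpM2r tt0) h; rewrite -expRM_natl ler_expR.
  by lra.
have hF : `|F t - 1%:M| ^+ 2 <= c * C1 * (e * d) ^+ 2.
  rewrite distrC; apply: le_trans (mx_norm_sq_le _) _; apply: le_trans HF _.
  have h1 := el l; have -> : c * C1 * (e * d) ^+ 2 = c * e ^+ 2 * (C1 * d ^+ 2) by ring.
  rewrite ler_pM ?mulr_ge0 ?expR_ge0 ?(ltW c0) ?addr_ge0 ?fsq_ge0 //.
  rewrite ler_wpM2l ?(ltW c0) // h1 // /l2 mulrC divfK //.
  by rewrite ge_min lexx.
have hx : `|x t| ^+ 2 <= kk * n%:R * (e * d) ^+ 2.
  apply: le_trans (mx_norm_sq_le _) _; apply: le_trans (decay t00 dx tt) _.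
  have -> : kk * n%:R * (e * d) ^+ 2 = kk * e ^+ 2 * (n%:R * d ^+ 2) by ring.
  rewrite ler_pM ?mulr_ge0 ?expR_ge0 ?(ltW kk0) ?fsq_ge0 //.
  rewrite ler_wpM2l ?(ltW kk0) // el // /l2 mulrC divfK //.
  by rewrite ge_min lexx orbT.
have ed0 : 0 <= e * d by rewrite mulr_ge0 // ltW.
rewrite -mulrA mulrDl; apply: lerD; exact: ler_of_sqr.
Qed.

End ClosedLoop.

(** * The unstable equilibria *)

Section Equilibria.
Context {R : realType}.

Lemma der_inv1 a (f f' : R -> R) : der a f f' -> (forall t, f t != 0) ->
  der a (fun t => (f t)^-1) (fun t => - (f t) ^- 2 * f' t).
Proof.
move=> [cf df] f0; split; first by move=> t; apply: cvgV; [exact: f0|exact: cf].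
move=> t at_; have := df t at_ => d; exact: is_deriveV (f0 t) d.
Qed.

Lemma mderZl m n a (f f' : R -> R) (A : 'M[R]_(m, n)) : der a f f' ->
  mder a (fun t => f t *: A) (fun t => f' t *: A).
Proof.
by move=> df i j; apply: eq_der (derZ (A i j) df) => t; rewrite mxE mulrC.
Qed.

Lemma ebasisE k l : (ebasis R k) l 0 = (l == k)%:R.
Proof. by rewrite mxE eqxx andbT. Qed.

Lemma entry_flip k i j : (flip k : 'M[R]_3) i j = (if i == k then 1 else -1) * (i == j)%:R.
Proof. by rewrite flipE mulr_natr. Qed.

(** * Explicit solutions leaving a half-turn *)

Section Escape.
Context {n : nat} {rho : 'I_3 -> R} {kR : R} {Gam : R -> 'M[R]_(3, n)} {Acl : R -> 'M[R]_n}.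
Hypotheses (rho0 : forall i, 0 < rho i) (kR0 : 0 < kR).

(* Rotations about the axis [e_k] form an invariant manifold of the unforced system, on which the
   half-angle tangent decays exponentially. *)
Definition axis_rot k (c s : R) : 'M[R]_3 :=
  1%:M + s *: skew (ebasis R k) + (1 - c) *: (skew (ebasis R k) *m skew (ebasis R k)).

Definition axis_rate k := kR * (2^-1 * (rho (inord 0) + rho (inord 1) + rho (inord 2) - rho k)).

Lemma axis_rate_gt0 k : 0 < axis_rate k.
Proof.
have r0 := rho0 (inord 0); have r1 := rho0 (inord 1); have r2 := rho0 (inord 2).
by rewrite mulr_gt0 //; case: (ord3P k) => ->; lra.
Qed.

Lemma skewZ (a : R) (x : 'cV[R]_3) : skew (a *: x) = a *: skew x.
Proof.
apply/matrixP => i j.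
by case: (ord3P i) => ->; case: (ord3P j) => ->; rewrite !entryE; ring.
Qed.

Lemma skew_ebasis2 k : skew (ebasis R k) *m skew (ebasis R k) = 2^-1 *: (flip k - 1%:M).
Proof.
apply/matrixP => i j.
by case: (ord3P k) => ->; case: (ord3P i) => ->; case: (ord3P j) => ->;
  rewrite !(entryE, ebasisE, entry_flip) /=; field.
Qed.

Lemma skew_ebasis3 k : skew (ebasis R k) *m flip k = - skew (ebasis R k).
Proof.
apply/matrixP => i j.
by case: (ord3P k) => ->; case: (ord3P i) => ->; case: (ord3P j) => ->;
  rewrite !(entryE, ebasisE, entry_flip) /=; ring.
Qed.

Lemma axis_rotE k c s i j : axis_rot k c s i j =
  (i == j)%:R + s * skew (ebasis R k) i j +
  (1 - c) * (2^-1 * ((if i == k then 1 else -1) * (i == j)%:R - (i == j)%:R)).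
Proof.
by rewrite /axis_rot skew_ebasis2 !(entryD, entryZ, entryN, entry1, entry_flip).
Qed.

Lemma psi_axis_rot k c s : psi_a (diag_mx (\row_i rho i) *m axis_rot k c s) =
  (2^-1 * (rho (inord 0) + rho (inord 1) + rho (inord 2) - rho k) * s) *: ebasis R k.
Proof.
apply/matrixP => i j; rewrite ord1.
by case: (ord3P k) => ->; case: (ord3P i) => ->;
  rewrite entryZ psiE !entry_diag_mulmx !axis_rotE !skewE !ebasisE ?inord3_neq ?eqxx /=; field.
Qed.

(** Since [J *m J *m J = - J], the field is tangent to the family: it amounts to [s' = - a s c] and
    [c' = a s^2] with [a = axis_rate k]. *)
Lemma axis_rot_field k c s : axis_rot k c s *m
    skew (- (kR *: psi_a (diag_mx (\row_i rho i) *m axis_rot k c s))) =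
  (- axis_rate k * s * c) *: skew (ebasis R k) -
  (axis_rate k * s ^+ 2) *: (skew (ebasis R k) *m skew (ebasis R k)).
Proof.
rewrite psi_axis_rot scalerA -scaleNr skewZ -scalemxAr /axis_rot /axis_rate.
set J := skew _; have J3 : J *m J *m J = - J.
  rewrite skew_ebasis2 -scalemxAl mulmxBl mul1mx.
  rewrite -[flip k *m J]trmxK trmx_mul flip_tr skew_tr mulNmx skew_ebasis3 opprK -/J skew_tr -/J.
  by apply/matrixP => a b; rewrite !(entryZ, entryD, entryN); field.
rewrite !mulmxDl mul1mx -!scalemxAl J3.
by apply/matrixP => a b; rewrite !(entryZ, entryD, entryN); ring.
Qed.

Lemma axis_rot_SO3 k c s : c ^+ 2 + s ^+ 2 = 1 -> is_SO3 (axis_rot k c s).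
Proof.
move=> cs; have es : s * s = 1 - c * c by rewrite -!expr2; lra.
split.
  apply/matrixP => i j.
  by case: (ord3P k) => ->; case: (ord3P i) => ->; case: (ord3P j) => ->;
    rewrite entryM3 !entry_tr entry1 !axis_rotE !skewE !ebasisE ?inord3_neq ?eqxx /=; field: es.
by rewrite det3; case: (ord3P k) => ->; rewrite !axis_rotE !skewE !ebasisE ?inord3_neq ?eqxx /=; field: es.
Qed.

Lemma flip_escape k del : 0 < del -> exists F : R -> 'M[R]_3,
  [/\ closed_loop (rho := rho) (kR := kR) (Gam := Gam) (Acl := Acl) 0 F (fun=> 0),
      `|F 0 - flip k| < del & exists2 t, 0 <= t & 1 <= `|F t - flip k|].
Proof.
move=> del0; pose a := axis_rate k; have a0 : 0 < a := axis_rate_gt0 k.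
(* The initial half-angle tangent, so large that [2 c0 / (1 + c0^2)] is below [del]. *)
pose c0 := 2 / del + 1; have c01 : 1 <= c0 by rewrite lerDr divr_ge0 // ltW.
pose tau t := c0 * expR (- a * (t - 0)).
pose g t := (1 + tau t * tau t)^-1.
have t1 t : 0 < 1 + tau t * tau t by rewrite ltr_wpDr // -expr2 sqr_ge0.
have dtau := derZ c0 (der_exp 0 (- a) 0).
have dg := der_inv1 (derD (der_cst 0 1) (derM dtau dtau)) (fun t => lt0r_neq0 (t1 t)).
(* Cosine and sine of the angle in terms of its half-angle tangent [tau t]. *)
pose c t := 2 * g t - 1; pose s t := 2 * (tau t * g t).
have dc : der 0 c (fun t => a * s t ^+ 2).
  apply: eq_der (derB (derZ 2 dg) (der_cst 0 1)) => // t _.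
  rewrite /s /g /tau /=; field; exact: lt0r_neq0 (t1 t).
have ds : der 0 s (fun t => - a * s t * c t).
  apply: eq_der (derZ 2 (derM dtau dg)) => // t _.
  rewrite /s /c /g /tau /=; field; exact: lt0r_neq0 (t1 t).
have cs t : c t ^+ 2 + s t ^+ 2 = 1.
  by rewrite /c /s /g; field; exact: lt0r_neq0 (t1 t).
exists (fun t => axis_rot k (c t) (s t)); split.
- split=> //; first exact: axis_rot_SO3.
  + have d := mderD (mderD (mder_cst 1%:M) (mderZl (skew (ebasis R k)) ds))
      (mderZl (skew (ebasis R k) *m skew (ebasis R k)) (derB (der_cst 0 1) dc)).
    apply: eq_mder d => // t _; rewrite mulmx0 subr0 axis_rot_field add0r sub0r scaleNr.
    by [].
  + by apply: eq_mder (mder_cst 0) => // t _; rewrite mulmx0.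
- have tau0 : tau 0 = c0 by rewrite /tau subrr mulr0 expR0 mulr1.
  have g0 : 0 < g 0 by rewrite invr_gt0.
  have gc : 2 * (c0 * g 0) < del.
    rewrite /g tau0 mulrA ltr_pdivrMr; last by rewrite -tau0.
    have e : del * (1 + c0 * c0) = del + (2 + del) * c0 by rewrite /c0; field; rewrite gt_eqF.
    by rewrite e; have := mulr_gt0 del0 (lt_le_trans ltr01 c01); lra.
  have gg : g 0 <= c0 * g 0 by rewrite ler_peMl // ltW.
  apply: le_lt_trans gc; apply: mx_norm_le => [|i j].
    by rewrite mulr_ge0 // mulr_ge0 ?(ltW g0) // (le_trans ler01).
  have h1 : `|c 0 + 1| <= 2 * (c0 * g 0).
    by rewrite /c subrK ger0_norm ?mulr_ge0 ?(ltW g0) // ler_wpM2l.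
  have h2 : `|s 0| <= 2 * (c0 * g 0).
    by rewrite /s tau0 ger0_norm // mulr_ge0 // mulr_ge0 ?(ltW g0) // (le_trans ler01).
  have h0 : `|0 : R| <= 2 * (c0 * g 0) by apply: le_trans h2; rewrite normr0.
  have sN : `|- s 0| <= 2 * (c0 * g 0) by rewrite normrN.
  by case: (ord3P k) => ->; case: (ord3P i) => ->; case: (ord3P j) => ->;
    rewrite entryD entryN axis_rotE entry_flip !skewE ?ebasisE ?inord3_neq ?eqxx /=;
    match goal with |- is_true (`|?x| <= _) =>
      first [ rewrite (_ : x = 0) //; field | rewrite (_ : x = c 0 + 1) //; field
            | rewrite (_ : x = s 0) //; field | rewrite (_ : x = - s 0) //; field ] end.
(* Here [tau] is 1: the rotation is a quarter turn, and one off-diagonal entry equals 1 where that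
   of the half-turn is 0. *)
- exists (ln c0 / a); first by rewrite divr_ge0 ?ln_ge0 // ltW.
  set t := ln c0 / a; have tt : tau t = 1.
    rewrite /tau subr0 (_ : - a * t = - ln c0); last by rewrite /t; field; rewrite gt_eqF.
    by rewrite expRN lnK ?divff // ?posrE ?gt_eqF // (lt_le_trans ltr01).
  have st : s t = 1 by rewrite /s /g tt; field.
  have key i j : `|(axis_rot k (c t) (s t) - flip k) i j| = 1 -> 1 <= `|axis_rot k (c t) (s t) - flip k|.
    by move=> e; rewrite -e mx_norm_entry.
  move: key; rewrite st; case: (ord3P k) => -> key.
  + apply: (key (inord 2) (inord 1)); rewrite entryD entryN axis_rotE entry_flip !skewE ?ebasisE ?inord3_neq ?eqxx /=.
    by rewrite (_ : _ - _ = 1) ?normr1 //; field.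
  + apply: (key (inord 0) (inord 2)); rewrite entryD entryN axis_rotE entry_flip !skewE ?ebasisE ?inord3_neq ?eqxx /=.
    by rewrite (_ : _ - _ = 1) ?normr1 //; field.
  + apply: (key (inord 1) (inord 0)); rewrite entryD entryN axis_rotE entry_flip !skewE ?ebasisE ?inord3_neq ?eqxx /=.
    by rewrite (_ : _ - _ = 1) ?normr1 //; field.
Qed.

End Escape.

Lemma rot_axis_piE (v : 'cV[R]_3) : rot_axis pi v = 1%:M + 2 *: (skew v *m skew v).
Proof. by rewrite /rot_axis sinpi cospi scale0r addr0 opprK. Qed.

Lemma flip_rot_axis k : flip k = rot_axis pi (ebasis R k).
Proof.
rewrite rot_axis_piE; apply/matrixP => i j.
by case: (ord3P k) => ->; case: (ord3P i) => ->; case: (ord3P j) => ->;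
  rewrite !(entryE, ebasisE, entry_flip) /=; ring.
Qed.

Lemma unit_eigvec_ebasis (rho : 'I_3 -> R) k : unit_eigvec (diag_mx (\row_i rho i)) (ebasis R k).
Proof.
split.
  rewrite mxE (bigD1 k) //= big1 ?addr0 => [|i ik]; first by rewrite entry_tr !ebasisE eqxx mulr1.
  by rewrite entry_tr !ebasisE (negPf ik) mulr0.
exists (rho k); apply/matrixP => i j; rewrite ord1 entryZ mul_diag_mx !mxE eqxx andbT.
by case: eqP => [->|]; rewrite ?mulr0.
Qed.

(** Distinct [rho] force [v] to be [e_k] or its opposite, and both give the same half-turn because
    [rot_axis pi] is quadratic in the axis. *)
Lemma unit_eigvec_flip (rho : 'I_3 -> R) v : (forall i j, i != j -> rho i != rho j) ->
  unit_eigvec (diag_mx (\row_i rho i)) v -> exists k, rot_axis pi v = flip k.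
Proof.
move=> rho_inj [v1 [lam Mv]].
have ev i : rho i * v i 0 = lam * v i 0.
  by have := congr1 (fun A : 'cV[R]_3 => A i 0) Mv; rewrite mul_diag_mx !mxE.
have vv : v (inord 0) 0 * v (inord 0) 0 + v (inord 1) 0 * v (inord 1) 0 + v (inord 2) 0 * v (inord 2) 0 = 1.
  by rewrite -v1 entryM3 !entry_tr.
have [k vk] : exists k, v k 0 != 0.
  apply: contrapT => /forallNP h.
  have h' i : v i 0 = 0 by apply/eqP; apply/negPn/negP; exact: h.
  by move: vv; rewrite !h' !mulr0 !addr0 => /eqP; rewrite eq_sym oner_eq0.
have lamk : lam = rho k by apply/(mulIf vk); rewrite -ev.
have other i : i != k -> v i 0 = 0.
  move=> ik; have := ev i; rewrite lamk => /eqP; rewrite -subr_eq0 -mulrBl mulf_eq0 subr_eq0.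
  by rewrite (negPf (rho_inj _ _ ik)) => /eqP.
exists k; rewrite rot_axis_piE.
apply/matrixP => i j; move: other vv {vk lamk}.
case: (ord3P k) => -> other.
- rewrite !(other (inord 1)) ?inord3_neq // !(other (inord 2)) ?inord3_neq //.
  rewrite !mulr0 !addr0 => vv; case: (ord3P i) => ->; case: (ord3P j) => ->;
  by rewrite !(entryE, entry_flip) /= ?(other (inord 1)) ?(other (inord 2)) ?inord3_neq //; ring: vv.
- rewrite !(other (inord 0)) ?inord3_neq // !(other (inord 2)) ?inord3_neq //.
  rewrite !mulr0 !addr0 add0r => vv; case: (ord3P i) => ->; case: (ord3P j) => ->;
  by rewrite !(entryE, entry_flip) /= ?(other (inord 0)) ?(other (inord 2)) ?inord3_neq //; ring: vv.
- rewrite !(other (inord 0)) ?inord3_neq // !(other (inord 1)) ?inord3_neq //.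
  rewrite !mulr0 !add0r => vv; case: (ord3P i) => ->; case: (ord3P j) => ->;
  by rewrite !(entryE, entry_flip) /= ?(other (inord 0)) ?(other (inord 1)) ?inord3_neq //; ring: vv.
Qed.

End Equilibria.

(** * Main result *)

Section SystemMatrices.
Context {R : realType}.

(** The 25 blocks are examined only here; boundedness and continuity of [Amat] then follow entry by
    entry. *)
Lemma Amat_entry (g : 'cV[R]_3) i j :
  (exists a b, forall w, Amat w g i j = - skew w a b) \/ (exists c, forall w, Amat w g i j = c).
Proof.
have e w : Amat w g i j = _ := mxE _ _ _ _.
have [I eI] : exists I : 'I_5, inord (i %/ 3) = I by eexists.
have [J eJ] : exists J : 'I_5, inord (j %/ 3) = J by eexists.
move: e; rewrite eI eJ => e.
case: I {eI} e => [[|[|[|[|[|//]]]]] hI]; case: J {eJ} => [[|[|[|[|[|//]]]]] hJ] /= e;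
  try (by left; exists (inord (i %% 3)), (inord (j %% 3)) => w; rewrite e mxE);
  by right; eexists => w; rewrite e.
Qed.

Lemma Amat_bounded (w : R -> 'cV[R]_3) g : bounded_on_nonneg w ->
  bounded_on_nonneg (fun t => Amat (w t) g).
Proof.
move=> [B HB]; exists (B + `|Amat 0 g|) => t t0.
have B0 : 0 <= B := le_trans (normr_ge0 _) (HB t t0).
apply: mx_norm_le => [|i j]; first by rewrite addr_ge0.
have [[a [b e]]|[c e]] := Amat_entry g i j.
  rewrite e normrN; apply: le_trans (mx_norm_entry _ _ _) _; apply: le_trans (norm_skew _) _.
  by apply: le_trans (HB t t0) _; rewrite lerDl.
by rewrite e -(e 0); apply: le_trans (mx_norm_entry _ _ _) _; rewrite lerDr.
Qed.

Lemma Amat_cont (w : R -> 'cV[R]_3) g : cont_from 0 w -> cont_from 0 (fun t => Amat (w t) g).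
Proof.
move=> /cont_from_mxP cw; apply/cont_from_mxP => i j.
have [[a [b e]]|[c e]] := Amat_entry g i j; last first.
  by under eq_fun do rewrite e; exact: cont_from_cst.
under eq_fun do rewrite e; apply: cont_fromN.
have cN i' : cont_from 0 (fun t => - w t i' 0) by apply: cont_fromN; exact: cw.
by case: (ord3P a) => ->; case: (ord3P b) => ->; under eq_fun do rewrite skewE;
  [exact: cont_from_cst|exact: cN|exact: cw|exact: cw|exact: cont_from_cst|exact: cN|exact: cN|exact: cw|exact: cont_from_cst].
Qed.

Lemma Gammat_bound kR rho1 rho2 rho3 (Rh : 'M[R]_3) :
  0 < kR -> 0 < rho1 -> 0 < rho2 -> 0 < rho3 -> is_SO3 Rh ->
  `|Gammat kR rho1 rho2 rho3 Rh| <= kR / 2 * (3 * (rho1 + rho2 + rho3)).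
Proof.
move=> k0 r1 r2 r3 [oR _].
have s0 : 0 <= 3 * (rho1 + rho2 + rho3) by rewrite mulr_ge0 // !addr_ge0 // ltW.
have k20 : 0 <= kR / 2 by rewrite divr_ge0 // ltW.
apply: mx_norm_le => [|i j]; first exact: mulr_ge0.
rewrite mxE normrM ger0_norm // ler_wpM2l // mxE.
have he l a b : `|(skew (ebasis R l) *m Rh) a b| <= 3.
  apply: le_trans (mx_norm_entry _ _ _) _; apply: le_trans (mx_norm_mulmx _ _) _.
  rewrite -[leRHS]mulr1 ler_wpM2l // -[leRHS]mulr1 ler_pM ?(orth_norm oR) //.
  apply: le_trans (norm_skew _) _; apply: mx_norm_le => // c d.
  by rewrite ord1 ebasisE; case: eqP => _; rewrite ?normr1 ?normr0.
have hs (r : R) l a b : 0 < r -> `|(r *: (skew (ebasis R l) *m Rh)) a b| <= 3 * r.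
  by move=> r0; rewrite entryZ normrM gtr0_norm // mulrC ler_wpM2r // ltW.
move: (inord (j %/ 3)) (inord (j %% 3)) => I b.
have h1 := hs rho1 (inord 0) i b r1; have h2 := hs rho2 (inord 1) i b r2.
have h3 := hs rho3 (inord 2) i b r3.
case: I => [[|[|[|[|[|//]]]]] hI] /=; rewrite ?[(0 : 'M[R]_3) i b]mxE ?normr0 //.
- by apply: le_trans h1 _; lra.
- by apply: le_trans h2 _; lra.
- by apply: le_trans h3 _; lra.
Qed.

Lemma exists_bounds3 (rho : 'I_3 -> R) : (forall i, 0 < rho i) ->
  exists rm rM, [/\ 0 < rm, forall i, rm <= rho i & forall i, rho i <= rM].
Proof.
move=> r0; exists (Num.min (rho (inord 0)) (Num.min (rho (inord 1)) (rho (inord 2)))).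
exists (Num.max (rho (inord 0)) (Num.max (rho (inord 1)) (rho (inord 2)))); split.
- by rewrite !lt_min !r0.
- by move=> i; case: (ord3P i) => ->; rewrite !ge_min lexx ?orbT.
- by move=> i; case: (ord3P i) => ->; rewrite !le_max lexx ?orbT.
Qed.

End SystemMatrices.

Theorem theorem1 (R : realType) (N : nat)
  (w : R -> 'cV[R]_3) (g : 'cV[R]_3) (Rhat : R -> 'M[R]_3)
  (C : R -> 'M[R]_(3 * N, 15))
  (Q : R -> 'M[R]_(3 * N)) (V : R -> 'M[R]_15) (P : R -> 'M[R]_15)
  (kR rho1 rho2 rho3 : R) :
  (0 < N)%N ->
  {within [set t : R | 0 <= t], continuous w} -> bounded_on_nonneg w ->
  {within [set t : R | 0 <= t], continuous Rhat} ->
  (forall t : R, 0 <= t -> is_SO3 (Rhat t)) ->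
  {within [set t : R | 0 <= t], continuous C} -> bounded_on_nonneg C ->
  unif_observable (fun t => Amat (w t) g) C ->
  0 < kR -> 0 < rho1 -> 0 < rho2 -> 0 < rho3 ->
  rho1 != rho2 -> rho1 != rho3 -> rho2 != rho3 ->
  {within [set t : R | 0 <= t], continuous Q} -> bounded_on_nonneg Q ->
  unif_pos_def Q ->
  {within [set t : R | 0 <= t], continuous V} -> bounded_on_nonneg V ->
  unif_pos_def V ->
  sym_pos_def (P 0) ->
  {within [set t : R | 0 <= t], continuous P} ->
  (forall t : R, 0 < t ->
     is_derive t 1 P
       (Amat (w t) g *m P t + P t *m (Amat (w t) g)^T
        - P t *m (C t)^T *m Q t *m C t *m P t + V t)) ->
  let M := diag_mx (\row_(i < 3) [:: rho1; rho2; rho3]`_i) in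
  let sol := closed_loop_sol kR M
               (fun t => Gammat kR rho1 rho2 rho3 (Rhat t))
               (fun t => Amat (w t) g)
               (fun t => P t *m (C t)^T *m Q t) C in
  let e : state R := (1%:M, 0) in
  (* (i) *)
  (forall (t0 : R) Rs xs, sol t0 Rs xs ->
     conv_to_set ([set e] `|` PsiM M) Rs xs) /\
  (* (ii) *)
  loc_exp_stable sol e /\
  (* (iii) *)
  (forall s, PsiM M s -> unstable sol s) /\
  almost_GAS sol e.
Proof.
move=> _ cw bw cRh SRh cC bC obs kR0 r1 r2 r3 r12 r13 r23 cQ bQ pQ cV bV pV P0 cP dP M sol e.
pose rho (i : 'I_3) : R := [:: rho1; rho2; rho3]`_i.
pose A t := Amat (w t) g; pose Gam t := Gammat kR rho1 rho2 rho3 (Rhat t).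
pose Acl t := A t - P t *m (C t)^T *m Q t *m C t.
have rhoE : [/\ rho (inord 0) = rho1, rho (inord 1) = rho2 & rho (inord 2) = rho3].
  by split; rewrite /rho inordK.
case: rhoE => e0 e1 e2.
have rho0 i : 0 < rho i by case: (ord3P i) => ->; rewrite ?e0 ?e1 ?e2.
have rho_inj i j : i != j -> rho i != rho j.
  case: (ord3P i) => ->; case: (ord3P j) => ->; rewrite ?eqxx // ?e0 ?e1 ?e2 // => _.
  - by rewrite eq_sym.
  - by rewrite eq_sym.
  - by rewrite eq_sym.
have [rm [rM [rm0 rhom rhoM]]] := exists_bounds3 rho0.
have cA : cont_from 0 A by exact: Amat_cont.
have bA : bounded_on_nonneg A by exact: Amat_bounded.
have dP' : mder 0 P (fun t => A t *m P t + P t *m (A t)^T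
    - P t *m (C t)^T *m Q t *m C t *m P t + V t).
  by apply/mderP; split.
have [kk [lam [kk0 lam0 decay]]] := riccati_decay cA bA cC bC cQ bQ pQ bV pV P0 dP' obs.
have [b b0 hP] := riccati_bounded cA bA cC bC cQ bQ pQ bV pV P0 dP' obs.
have [a a0 hA] := bounded_fsq bA; have [c c0 hC] := bounded_fsq bC; have [q q0 hQ] := bounded_fsq bQ.
pose acl := 2 * (a + b * c * q * c).
have acl0 : 0 < acl by rewrite mulr_gt0 // addr_gt0 // !mulr_gt0.
have hAcl t : 0 <= t -> fsq (Acl t) <= acl.
  move=> t0; apply: le_trans (fsqD_le _ _) _; rewrite fsqN ler_wpM2l // lerD ?hA //.
  by do 3?apply: fsq_mul_le; rewrite ?fsq_tr ?hP ?hC ?hQ.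
have bG : bounded_on_nonneg Gam.
  exists (kR / 2 * (3 * (rho1 + rho2 + rho3))) => t t0.
  by apply: Gammat_bound => //; exact: SRh.
have [gam gam0 hG] := bounded_fsq bG.
have decay' t0 (x : R -> 'cV[R]_15) : 0 <= t0 -> mder t0 x (fun t => Acl t *m x t) ->
    forall t, t0 <= t -> fsq (x t) <= kk * expR (- lam * (t - t0)) * fsq (x t0).
  move=> t00 dx; apply: decay => //; apply: eq_mder dx => // t _.
  by rewrite /Acl mulmxBl !mulmxA.
have solP t0 F x : sol t0 F x <-> closed_loop (rho := rho) (kR := kR) (Gam := Gam) (Acl := Acl) t0 F x.
  have eA t : A t *m x t - P t *m (C t)^T *m Q t *m (C t *m x t) = Acl t *m x t.
    by rewrite /Acl mulmxBl !mulmxA.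
  split=> [[t00 [F0 [cF [cx d]]]]|[t00 F0 dF dx]].
    split=> //; first by apply/mderP; split=> // t tt; exact: (d t tt).1.
    by apply/mderP; split=> // t tt; rewrite -eA; exact: (d t tt).2.
  have [cF dF'] := (mderP _ _ _).1 dF; have [cx dx'] := (mderP _ _ _).1 dx.
  split=> //; split=> //; split=> //; split=> // t tt; split; first exact: dF' t tt.
  by have := dx' t tt; rewrite -eA.
have cvg := closed_loop_cvg rm0 rhom rho_inj kR0 kk0 lam0 gam0 hG decay'.
have near_sdist (S : 'M[R]_3) F x t eta : 0 < eta ->
    fsq (F t - S) < (eta / 2) ^+ 2 -> fsq (x t) < (eta / 2) ^+ 2 -> sdist (F t, x t) (S, 0) < eta.
  move=> eta0 h1 h2; rewrite /sdist /= subr0 (splitr eta).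
  have e2' : 0 <= eta / 2 by rewrite divr_ge0 // ltW.
  by apply: ltrD; rewrite -(@ltr_pXn2r _ 2) ?nnegrE //; apply: le_lt_trans (mx_norm_sq_le _) _.
have sq0 eta : 0 < eta -> 0 < (eta / 2) ^+ 2 :> R by move=> h; rewrite exprn_gt0 // divr_gt0.
have les : loc_exp_stable sol e.
  have [r [k [l [hr hk hl H]]]] := closed_loop_exp_stable rm0 rhom rhoM rho_inj kR0 kk0 lam0 gam0 hG decay'.
  exists r, k, l; split=> //; split=> //; split=> // t0 F x /solP s.
  by rewrite /sdist /= subr0 => hd t tt; rewrite subr0; exact: H.
split; [|split; [exact: les|split]].
- move=> t0 F x /solP s eps eps0; have [S hS H] := cvg t0 F x s.
  have [T _ HT] := H _ (sq0 _ eps0); exists T => t Tt; have [h1 h2 _] := HT t Tt.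
  exists (S, 0); split; last exact: near_sdist.
  case: hS => [->|[k ->]]; [by left|right].
  by exists (ebasis R k); split; [exact: unit_eigvec_ebasis|rewrite flip_rot_axis].
- move=> [S x0] [v [/= hv [eS ex]]] st.
  have [k ek] := unit_eigvec_flip rho_inj hv.
  (* Stability is refuted at initial time 0 with radius 1, the distance reached by [flip_escape]. *)
  have [del [del0 H]] := st 0 1 (lexx 0) ltr01.
  have [F [s F0 [t t0 Ft]]] := @flip_escape R 15 rho kR Gam Acl rho0 kR0 k del del0.
  have := H F (fun=> 0) ((solP _ _ _).2 s); rewrite /sdist /= eS ex ek subr0 normr0 addr0.
  by move=> /(_ F0 t t0); rewrite addr0 ltNge Ft.
- split.
    move=> t0 eps t00 eps0; have [r [k [l [hr [hk [hl H]]]]]] := les.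
    exists (Num.min r (eps / k)); split; first by rewrite lt_min hr divr_gt0.
    move=> F x s; rewrite lt_min => /andP[d1 d2] t tt.
    apply: le_lt_trans (H t0 F x s d1 t tt) _.
    rewrite ltr_pdivlMr // mulrC in d2; apply: le_lt_trans d2.
    rewrite ler_wpM2r ?addr_ge0 // ler_piMr ?(ltW hk) // -expR0 ler_expR oppr_le0.
    by rewrite mulr_ge0 ?(ltW hl) // subr_ge0.
  move=> t0 t00.
  have tn k := cid2 (trapped_null rm0 rhom rhoM rho_inj kR0 kk0 lam0 gam0 acl0 hG hAcl decay' k).
  pose eps k := s2val (tn k); have eps0 k : 0 < eps k := s2valP (tn k).
  (* The exceptional states are exactly those from which some solution fails to converge to [e];
     only nullity remains. *)
  exists [set s | exists F x, [/\ sol t0 F x, s = (F t0, x t0) & ~ conv_to_set [set e] F x]].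
  split; last by move=> F x s ns; apply: contrapT => nc; apply: ns; exists F, x.
  (* Countable index: the half-turn, the time lag after which the trajectory is trapped, the bound
     on the initial state, and the quaternion piece. *)
  pose I := ('I_3 * nat * nat * 'I_4 * bool)%type.
  pose E (i : I) := trapped (rho := rho) (kR := kR) (Gam := Gam) (Acl := Acl)
    i.1.1.1.1 (eps i.1.1.1.1) t0 (t0 + i.1.1.1.2%:R) i.1.1.2.+1%:R i.1.2 i.2.
  apply: (@null_setS _ _ _ [set z | exists i, E i z]); last first.
    by apply: null_bigcup_count => // -[[[[k T] B] i0] bb]; apply: (s2valP' (tn k)) => //; rewrite lerDl.
  move=> z [z0 [F [x [/solP s [zF zx] nc]]]].
  have [S hS H] := cvg t0 F x s.
  case: hS => [S1|[k Sk]].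
    exfalso; apply: nc => eta eta0; have [T _ HT] := H _ (sq0 _ eta0).
    exists T => t Tt; have [h1 h2 _] := HT t Tt; exists e; split=> //.
    by apply: near_sdist => //; rewrite -S1.
  have [T _ HT] := H _ (exprn_gt0 2 (eps0 k)).
  have [i0 [bb hq]] := quat_piece (usubmx z).
  (* The real entry time and bounds are rounded up to naturals to stay within the countable
     family. *)
  pose Tn := Num.truncn `|T - t0|; pose TN := Tn.+1.
  pose m1 := Num.truncn (Num.sqrt (fsq (usubmx z))); pose m2 := Num.truncn (fsq (dsubmx z)).
  exists (k, TN, (m1 + m2)%N, i0, bb).
  have b1 : Num.sqrt (fsq (usubmx z)) <= (m1 + m2).+1%:R.
    by apply: le_trans (ltW (truncnS_gt _)) _; rewrite ler_nat ltnS leq_addr.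
  have b2 : fsq (dsubmx z) <= (m1 + m2).+1%:R.
    by apply: le_trans (ltW (truncnS_gt _)) _; rewrite ler_nat ltnS leq_addl.
  have hT t : t0 + TN%:R <= t -> T <= t.
    apply: le_trans; rewrite -lerBlDl; apply: le_trans (ler_norm _) _.
    by apply: ltW; exact: truncnS_gt.
  have sq (X eta : R) : 0 < eta -> X ^+ 2 <= eta ^+ 2 -> X <= eta.
    move=> et h; apply: le_trans (ler_norm X) _.
    by rewrite -(@ler_pXn2r _ 2) ?nnegrE ?real_normK ?num_real // ltW.
  split=> //=; exists F, x; split=> //.
  + move=> t /hT Tt; have [h1 _ _] := HT t Tt; apply: sq => //.
    by apply: le_trans (mx_norm_sq_le _) _; rewrite -Sk ltW.
  + move=> t /hT Tt; have [_ _ h3] := HT t Tt; apply: sq => //.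
    by apply: le_trans (mx_norm_sq_le _) _; rewrite ltW.
Qed.
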